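(* In the setting described in the context, assume there exist $q$ processes $Y^i=(Y^i_t)_{0\le t\le T}$, $i=1,\dots,q$, in $\mathcal{S}^p$ that satisfy, for every $i\in\mathcal{J}$ and $0\le t\le T$, $$Y^i_t=\operatorname*{ess\,sup}_{\tau\ge t}E\Big[\int_t^\tau\psi_i(s,X_s)\,ds+\max_{j\in\mathcal{J}^{-i}}\big(-\ell_{ij}(\tau)+Y^j_\tau\big)\mathbf{1}_{[\tau<T]}\,\Big|\,\mathcal{F}_t\Big]\qquad(\text{so } Y^i_T=0),$$ where the essential supremum is over $\mathbf{F}$-stopping times $\tau$ with $t\le\tau\le T$. Then $Y^1,\dots,Y^q$ are unique. Furthermore: (i) $Y^1_0=\sup_{(\theta,v)\in\mathcal{D}}J(\theta,v)$. (ii) Put $\tau_0=0$, $\xi_0=1$ and define recursively, for $n\ge1$, $$\tau_n=\inf\Big\{s\ge\tau_{n-1}:\ Y^{\xi_{n-1}}_s=\max_{k\in\mathcal{J}^{-\xi_{n-1}}}\big(-\ell_{\xi_{n-1}k}(s)+Y^k_s\big)\Big\}\wedge T,$$ and let $\xi_n$ be an $\mathcal{F}_{\tau_n}$-measurable random variable with values in $\mathcal{J}^{-\xi_{n-1}}$ such that $$\max_{k\in\mathcal{J}^{-\xi_{n-1}}}\big(-\ell_{\xi_{n-1}k}(\tau_n)+Y^k_{\tau_n}\big)=-\ell_{\xi_{n-1}\xi_n}(\tau_n)+Y^{\xi_n}_{\tau_n}.$$ Then the strategy $(\delta,u)$ given by $\delta=(\tau_n)_{n\ge1}$ and $(\xi_n)_{n\ge1}$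 is optimal, i.e. $J(\delta,u)\ge J(\theta,v)$ for any $(\theta,v)\in\mathcal{D}$.
   Context: Fix a horizon $T>0$, an exponent $p>1$, integers $d,k\ge 1$, $q\ge 2$, and let $\mathcal{J}=\{1,\dots,q\}$ and $\mathcal{J}^{-i}=\mathcal{J}\setminus\{i\}$. On a probability space $(\Omega,\mathcal{F},P)$ let $B=(B_t)_{0\le t\le T}$ be a standard $d$-dimensional Brownian motion and let $\mathbf{F}=(\mathcal{F}_t)_{0\le t\le T}$ be its natural filtration completed with the $P$-null sets of $\mathcal{F}$. Let $\mathcal{S}^p$ be the set of $\mathbf{F}$-progressively measurable, continuous, real-valued processes $w$ with $E[\sup_{0\le t\le T}|w_t|^p]<\infty$. Data: $X=(X_t)_{0\le t\le T}$ is an $\mathbb{R}^k$-valued process each of whose components is in $\mathcal{S}^p$. For $i\in\mathcal{J}$, $\psi_i:[0,T]\times\mathbb{R}^k\to\mathbb{R}$ is continuous and there is a constant $C$ with $|\psi_i(t,x)|\le C(1+|x|)$ for all $(t,x)$. For $i\ne j$ in $\mathcal{J}$, the switching cost $\ell_{ij}=(\ell_{ij}(t))_{0\le t\le T}$ is in $\mathcal{S}^p$, and there is a real constant $\gamma>0$ such that $P$-a.s., for all $0\le t\le T$, $\min\{\ell_{ij}(t): i,j\in\mathcal{J}, i\neq j\}\ge\gamma$. Strategies: a strategy $(\delta,u)$ consists of a nondecreasing sequence $\delta=(\tau_n)_{n\ge1}$ of $\mathbf{F}$-stopping times with values in $[0,T]$ ($\tau_0=0$) and a sequence $(\xi_n)_{n\ge1}$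 of $\mathcal{J}$-valued random variables with $\xi_n$ $\mathcal{F}_{\tau_n}$-measurable; put $\xi_0=1$ (the initial mode is $1$); it is required that $P[\xi_n=\xi_{n+1}]=0$ for all $n\ge 0$. The mode indicator is $$u_t=\mathbf{1}_{[0,\tau_1]}(t)+\sum_{n\ge1}\xi_n\mathbf{1}_{(\tau_n,\tau_{n+1}]}(t).$$ The strategy is admissible if $\lim_{n\to\infty}\tau_n=T$ $P$-a.s. An admissible strategy is finite if $P[\tau_n<T\text{ for all }n\ge0]=0$; $\mathcal{D}$ is the set of finite strategies. The expected total profit is $$J(\delta,u)=E\Big[\int_0^T\psi_{u_s}(s,X_s)\,ds-\sum_{n\ge1}\ell_{\xi_{n-1}\xi_n}(\tau_n)\mathbf{1}_{[\tau_n<T]}\Big]\in[-\infty,\infty).$$ *)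

(* Defs.v *)
From HB Require Import structures.
From mathcomp Require Import all_boot all_order all_algebra.
From mathcomp Require Import all_classical all_reals all_analysis measurable_realfun.

Set Implicit Arguments.
Unset Strict Implicit.
Unset Printing Implicit Defensive.

Import Order.TTheory GRing.Theory Num.Theory.
Import numFieldNormedType.Exports.

Local Open Scope classical_set_scope.
Local Open Scope ring_scope.

(* A process is a function [R -> Omega -> V]; only its values at times in
   [0, T] are ever used.  A filtration is a family [R -> set (set Omega)] of
   sigma-algebras on Omega. *)

Section stochastic_basis.
Context {R : realType} {disp : measure_display} {Omega : measurableType disp}.
Variable P : probability Omega R.

Definition natural_filtration {d} (B : R -> Omega -> 'rV[R]_d) (t : R) :
    set (set Omega) :=
  <<s \bigcup_(s in `[0, t]) \bigcup_(k in [set: 'I_d])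
        preimage_set_system setT (fun w => B s w ord0 k) measurable >>.

Definition null_sets : set (set Omega) :=
  [set A | measurable A /\ P A = 0%E].

Definition completed_filtration {d} (B : R -> Omega -> 'rV[R]_d) (t : R) :
    set (set Omega) :=
  <<s natural_filtration B t `|` null_sets >>.

Definition increment_sigma {d} (B : R -> Omega -> 'rV[R]_d) (s t : R) :
    set (set Omega) :=
  <<s \bigcup_(k in [set: 'I_d])
        preimage_set_system setT (fun w => B t w ord0 k - B s w ord0 k)
          measurable >>.

(* Increments over [s, t] have law N(0, (t - s) I_d), the d-fold product of
   N(0, t - s), characterised by its values on boxes; the second parameter of
   [normal_prob] is the standard deviation. *)
Definition brownian_motion (T : R) {d} (B : R -> Omega -> 'rV[R]_d) : Prop :=
  [/\ forall t (k : 'I_d), 0 <= t <= T ->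
        measurable_fun setT (fun w => B t w ord0 k),
      {ae P, forall w, B 0 w = 0},
      {ae P, forall w, {within `[0, T], continuous (fun t => B t w)}},
      forall s t, 0 <= s -> s < t -> t <= T ->
        forall U : 'I_d -> set R, (forall k, measurable (U k)) ->
        P [set w | forall k, U k (B t w ord0 k - B s w ord0 k)] =
        (\prod_(k < d) normal_prob 0 (Num.sqrt (t - s)) (U k))%E
    & forall s t, 0 <= s -> s < t -> t <= T ->
        forall A C, natural_filtration B s A -> increment_sigma B s t C ->
        P (A `&` C) = (P A * P C)%E].

Variables (T : R) (F : R -> set (set Omega)).

Definition progressive (w : R -> Omega -> R) : Prop :=
  forall t, 0 <= t <= T ->
    measurable_fun (`[0, t] `*` setT)
      (fun z : measurableTypeR R * g_sigma_algebraType (F t) => w z.1 z.2).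

Definition Sp_process (p : R) (w : R -> Omega -> R) : Prop :=
  [/\ progressive w,
      forall om, {within `[0, T], continuous (fun t => w t om)}
    & (\int[P]_om ereal_sup [set (`|w t om| `^ p)%:E | t in `[0%R, T]]
         < +oo)%E].

Definition stopping_time (tau : Omega -> R) : Prop :=
  (forall w, 0 <= tau w <= T) /\
  (forall t, 0 <= t <= T -> F t [set w | tau w <= t]).

(* The sigma-algebra F_tau; since tau <= T, taking t = T gives F_tau `<=` F T. *)
Definition stopped_sigma (tau : Omega -> R) : set (set Omega) :=
  [set A | forall t, 0 <= t <= T -> F t (A `&` [set w | tau w <= t])].

Definition cond_exp_version (G : set (set Omega)) (X Z : Omega -> R) : Prop :=
  [/\ P.-integrable setT (EFin \o X),
      P.-integrable setT (EFin \o Z),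
      measurable_fun setT (Z : g_sigma_algebraType G -> R)
    & forall A, G A -> (\int[P]_(w in A) (Z w)%:E = \int[P]_(w in A) (X w)%:E)%E].

(* Z is the P-essential supremum of the family Fam of random variables: the
   P-a.s. least random variable that dominates every member of Fam P-a.s. *)
Definition is_esssup (Fam : set (Omega -> R)) (Z : Omega -> R) : Prop :=
  [/\ measurable_fun setT Z,
      forall f, Fam f -> {ae P, forall w, f w <= Z w}
    & forall Z' : Omega -> \bar R, measurable_fun setT Z' ->
        (forall f, Fam f -> {ae P, forall w, ((f w)%:E <= Z' w)%E}) ->
        {ae P, forall w, ((Z w)%:E <= Z' w)%E}].

End stochastic_basis.

Section switching.
Context {R : realType} {disp : measure_display} {Omega : measurableType disp}.
Variables (P : probability Omega R) (T : R) (F : R -> set (set Omega)).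
Variables (q k : nat).
Variables (X : R -> Omega -> 'rV[R]_k) (psi : 'I_q -> R -> 'rV[R]_k -> R).
Variable l : 'I_q -> 'I_q -> R -> Omega -> R.

(* The modes 1, ..., q are encoded as 0, ..., q - 1 in 'I_q. *)
Definition mode1 (hq : (2 <= q)%N) : 'I_q := Ordinal (ltnW hq).

Section value_processes.
Variable Y : 'I_q -> R -> Omega -> R.

(* max_(j != i) (- l_ij(t) + Y^j_t); the index set is nonempty as q >= 2, so
   the maximum taken in \bar R is finite. *)
Definition switch_max (i : 'I_q) (t : R) (w : Omega) : R :=
  fine (\big[maxe/-oo%E]_(j < q | j != i) (- l i j t w + Y j t w)%:E).

Definition stopping_reward (i : 'I_q) (t : R) (tau : Omega -> R) (w : Omega) :
    R :=
  (\int[lebesgue_measure]_(s in `[t, tau w]) psi i s (X s w))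
  + switch_max i (tau w) w * (tau w < T)%R%:R.

Definition snell_system : Prop :=
  forall (i : 'I_q) t, 0 <= t <= T ->
    is_esssup P
      [set Z | exists tau : Omega -> R,
        [/\ stopping_time T F tau, forall w, t <= tau w
          & cond_exp_version P (F t) (stopping_reward i t tau) Z]]
      (Y i t).

(* [T |` A] encodes (inf A) /\ T for A included in [0, T], with the convention
   that inf of the empty set is +oo (whereas [inf set0 = 0] for reals). *)
Definition next_switch_time (tau : Omega -> R) (xi : Omega -> 'I_q)
    (w : Omega) : R :=
  inf (T |` [set s | tau w <= s <= T /\ Y (xi w) s w = switch_max (xi w) s w]).

Definition recursive_strategy (hq : (2 <= q)%N)
    (tau : nat -> Omega -> R) (xi : nat -> Omega -> 'I_q) : Prop :=
  [/\ forall w, tau 0%N w = 0,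
      forall w, xi 0%N w = mode1 hq
    & forall n : nat,
      [/\ forall w, tau n.+1 w = next_switch_time (tau n) (xi n) w,
          forall A : set 'I_q,
            stopped_sigma T F (tau n.+1) (xi n.+1 @^-1` A)
        & {ae P, forall w, xi n.+1 w != xi n w /\
            switch_max (xi n w) (tau n.+1 w) w =
            - l (xi n w) (xi n.+1 w) (tau n.+1 w) w
            + Y (xi n.+1 w) (tau n.+1 w) w}]].

End value_processes.

Definition strategy (hq : (2 <= q)%N)
    (tau : nat -> Omega -> R) (xi : nat -> Omega -> 'I_q) : Prop :=
  [/\ forall w, tau 0%N w = 0 /\ xi 0%N w = mode1 hq,
      forall n, (0 < n)%N -> stopping_time T F (tau n),
      forall n w, tau n w <= tau n.+1 w,
      forall n, (0 < n)%N -> forall A : set 'I_q,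
        stopped_sigma T F (tau n) (xi n @^-1` A)
    & forall n, P [set w | xi n w = xi n.+1 w] = 0%E].

Definition admissible (tau : nat -> Omega -> R) : Prop :=
  {ae P, forall w, tau n w @[n --> \oo] --> T}.

Definition finite_strategy (hq : (2 <= q)%N)
    (tau : nat -> Omega -> R) (xi : nat -> Omega -> 'I_q) : Prop :=
  [/\ strategy hq tau xi, admissible tau
    & P [set w | forall n, tau n w < T] = 0%E].

(* u_t = xi_n for the unique n with tau_n < t <= tau_{n+1}.  At t = 0 there is
   no such n and the default n = 0 gives xi_0.  For an admissible strategy,
   P-a.s. the only other time where the default may be used is t = T. *)
Definition mode_indicator (tau : nat -> Omega -> R) (xi : nat -> Omega -> 'I_q)
    (t : R) (w : Omega) : 'I_q :=
  xi (xget 0%N [set n | tau n w < t <= tau n.+1 w]) w.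

(* The n-th term of the series (n >= 0) is the cost of the (n+1)-th switch. *)
Definition total_profit (tau : nat -> Omega -> R)
    (xi : nat -> Omega -> 'I_q) : \bar R :=
  (\int[P]_w
     ((\int[lebesgue_measure]_(s in `[0%R, T])
         psi (mode_indicator tau xi s w) s (X s w))%R%:E
      - \sum_(0 <= n <oo)
          (l (xi n w) (xi n.+1 w) (tau n.+1 w) w
           * (tau n.+1 w < T)%R%:R)%R%:E))%E.

End switching.

(* Main.v *)
(* For each mode i, the process Y^i + int_0^. psi_i(s, X_s) ds is a
   supermartingale, and it is a martingale from any time until Y^i next meets the
   obstacle max_(j <> i) (Y^j - l_ij).  Since Y^i dominates its obstacle, summing
   over the successive switching intervals of a strategy bounds the expected
   gains minus costs by the initial value, up to the value left at the n-th
   switching time, which tends to 0 when T is reached; equality holds when the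
   switches take place at the hitting times, towards modes attaining the maximum.
   Along such a strategy, the total expected cost is therefore bounded, and
   since each switch costs at least gamma, the strategy is finite.  Comparing two
   solutions along a strategy that is optimal for one of them and starts at an
   arbitrary time from an arbitrary mode yields uniqueness, while starting at
   time 0 yields (i) and (ii), as F_0 is P-trivial. *)

Require Import Defs.
From HB Require Import structures.
From mathcomp Require Import all_boot all_order all_algebra.
From mathcomp Require Import all_classical all_reals all_analysis measurable_realfun.
From mathcomp Require Import ring lra.

Set Implicit Arguments.
Unset Strict Implicit.
Unset Printing Implicit Defensive.

Import Order.TTheory GRing.Theory Num.Theory.
Import numFieldNormedType.Exports.

Local Open Scope classical_set_scope.
Local Open Scope ring_scope.


(** * Expectation *)

(** Conditional expectations serve only to decode the essential supremum. Afterwards every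
    supermartingale or martingale property is a comparison of integrals over events of F_s, and an
    almost sure inequality is obtained by testing on the event where it fails. The delicate point is
    the martingale property up to the hitting time. The family under the essential supremum is
    stable under pairwise maxima, so some stopping time after t comes within e of E[Y_t]. With e =
    2^-(n+1), the expected gaps between Y and its obstacle at these times are summable, so the gaps
    tend to 0 almost surely. By compactness such times are, in the limit, not before the hitting
    time, and dominated convergence transfers near-optimality to it. Random times are reached from
    deterministic ones by rounding up to a grid, which only involves events sigma <= s < tau, known
    at time s. As l i i is arbitrary and a strategy may repeat a mode on a null set, costs are
    handled through a measurable process that agrees with them almost surely. *)

Section measurable_comparisons.
Context {R : realType} d {T : measurableType d} (f g : T -> R).
Hypotheses (mf : measurable_fun setT f) (mg : measurable_fun setT g).

Lemma measurable_setlt : measurable [set x | f x < g x].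
Proof.
have := measurable_fun_ltr mf mg measurableT (Y := [set true]).
by rewrite setTI; exact.
Qed.

Lemma measurable_setle : measurable [set x | f x <= g x].
Proof.
have := measurable_fun_ler mf mg measurableT (Y := [set true]).
by rewrite setTI; exact.
Qed.

Lemma measurable_seteq : measurable [set x | f x = g x].
Proof.
have := measurable_fun_eqr mf mg measurableT (Y := [set true]).
rewrite setTI => /(_ I); congr measurable.
by apply/seteqP; split=> x /= /eqP.
Qed.

End measurable_comparisons.

Section expectation.
Context {R : realType} {disp : measure_display} {Omega : measurableType disp}.
Variable P : probability Omega R.
Implicit Types (A B : set Omega) (f g : Omega -> R).

Definition L1 f := P.-integrable setT (EFin \o f).

Lemma L1_measurable f : L1 f -> measurable_fun setT f.
Proof. by move=> /measurable_int /measurable_EFinP. Qed.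

Lemma L1S f A : measurable A -> L1 f -> P.-integrable A (EFin \o f).
Proof. by move=> mA; exact: integrableS. Qed.

Lemma L1D f g : L1 f -> L1 g -> L1 (fun w => f w + g w).
Proof. by move=> hf hg; exact: (integrableD measurableT hf hg). Qed.

Lemma L1N f : L1 f -> L1 (fun w => - f w).
Proof. by move=> hf; exact: (integrableN hf). Qed.

Lemma L1B f g : L1 f -> L1 g -> L1 (fun w => f w - g w).
Proof. by move=> hf hg; exact: (integrableB measurableT hf hg). Qed.

Lemma L1_cst (r : R) : L1 (cst r).
Proof. exact: finite_measure_integrable_cst. Qed.

Lemma L1_le f g : measurable_fun setT f -> L1 g -> (forall w, `|f w| <= g w) ->
  L1 f.
Proof.
move=> mf hg fg; apply: (le_integrable measurableT _ _ hg) => //.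
  exact/measurable_EFinP.
by move=> w _ /=; rewrite lee_fin (le_trans (fg w))// ler_norm.
Qed.

Lemma L1_norm f : L1 f -> L1 (fun w => `|f w|).
Proof. by move=> hf; exact: (integrable_abse hf). Qed.

Lemma L1Z (r : R) f : L1 f -> L1 (fun w => r * f w).
Proof. by move=> hf; exact: (integrableZl measurableT r hf). Qed.

Lemma L1_sum (I : Type) (s : seq I) (Q : pred I) (h : I -> Omega -> R) :
  (forall i, Q i -> L1 (h i)) -> L1 (fun w => \sum_(i <- s | Q i) h i w).
Proof.
move=> hh; elim: s => [|i s IH].
  by under eq_fun do rewrite big_nil; exact: L1_cst.
under eq_fun do rewrite big_cons; have [Qi|] := boolP (Q i); last first.
  by move=> _; exact: IH.
by apply: L1D => //; exact: hh.
Qed.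

Lemma L1_indic f A : measurable A -> L1 f -> L1 (fun w => f w * \1_A w).
Proof.
move=> mA hf; apply: (L1_le _ (L1_norm hf)).
  by apply: measurable_funM; [exact: L1_measurable|exact: measurable_indic].
move=> w; rewrite normrM indicE; have [_|_] := boolP (w \in A) => /=.
  by rewrite normr1 mulr1.
by rewrite normr0 mulr0.
Qed.

Local Notation Ex A f := (Rintegral P A f).

Lemma ExD A f g : measurable A -> L1 f -> L1 g ->
  Ex A (fun w => f w + g w) = Ex A f + Ex A g.
Proof. by move=> mA hf hg; rewrite RintegralD//; exact: L1S. Qed.

Lemma ExB A f g : measurable A -> L1 f -> L1 g ->
  Ex A (fun w => f w - g w) = Ex A f - Ex A g.
Proof. by move=> mA hf hg; rewrite RintegralB//; exact: L1S. Qed.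

Lemma ExN A f : measurable A -> L1 f -> Ex A (fun w => - f w) = - Ex A f.
Proof.
move=> mA hf; under eq_Rintegral do rewrite -mulN1r.
by rewrite RintegralZl ?mulN1r//; exact: L1S.
Qed.

Lemma Ex_sum A (I : Type) (s : seq I) (Q : pred I) (h : I -> Omega -> R) :
  measurable A -> (forall i, Q i -> L1 (h i)) ->
  Ex A (fun w => \sum_(i <- s | Q i) h i w) = \sum_(i <- s | Q i) Ex A (h i).
Proof.
move=> mA hh; elim: s => [|i s IH].
  under eq_Rintegral do rewrite big_nil.
  by rewrite Rintegral_cst// mul0r big_nil.
under eq_Rintegral do rewrite big_cons.
rewrite big_cons; case: ifPn => // Qi.
by rewrite -IH -ExD//; [exact: hh|exact: L1_sum].
Qed.

Lemma Ex_split A B f : measurable A -> measurable B -> L1 f ->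
  Ex A f = Ex (A `&` B) f + Ex (A `\` B) f.
Proof.
move=> mA mB hf; rewrite -Rintegral_setU.
- by rewrite setDE -setIUr setUv setIT.
- exact: measurableI.
- exact: measurableD.
- by rewrite setDE -setIUr setUv setIT; exact: L1S.
- by apply/disj_setPS => w [[_ +] []].
Qed.

Lemma Ex_splitT A f : measurable A -> L1 f ->
  Ex setT f = Ex A f + Ex (~` A) f.
Proof. by move=> mA hf; rewrite (@Ex_split _ A)// setTI setTD. Qed.

Lemma Ex_fin (I : finType) (xi : Omega -> I) A f : measurable A -> L1 f ->
  (forall i, measurable (A `&` xi @^-1` [set i])) ->
  Ex A f = \sum_i Ex (A `&` xi @^-1` [set i]) f.
Proof.
move=> mA hf mxi.
rewrite (@eq_Rintegral _ _ _ _ _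
   (fun w => \sum_i f w * \1_(A `&` xi @^-1` [set i]) w)).
  rewrite Ex_sum//; last by move=> i _; exact: L1_indic.
  apply: eq_bigr => i _.
  rewrite [RHS](_ : _ = Ex (A `&` (A `&` xi @^-1` [set i])) f).
    rewrite Rintegral_mkcondr; apply: eq_Rintegral => w _.
    by rewrite patchE indicE; case: ifPn => _; rewrite ?mulr1 ?mulr0.
  by rewrite setIA setIid.
move=> w /set_mem Aw.
rewrite (bigD1 (xi w))//= indicE mem_set// mulr1 big1 ?addr0// => i ixi.
by rewrite indicE memNset ?mulr0// => -[_ /= xii]; rewrite xii eqxx in ixi.
Qed.

Lemma le_Ex_ae A f g : measurable A -> L1 f -> L1 g ->
  {ae P, forall w, A w -> f w <= g w} -> Ex A f <= Ex A g.
Proof.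
move=> mA hf hg fg; rewrite -subr_ge0 -ExB//.
(* The truncation is nonnegative everywhere, whereas [g w - f w] is so only almost surely on A; both
   have the same integral. *)
pose h w := Num.max 0 (g w - f w).
have mgf : measurable_fun setT (fun w => g w - f w).
  by apply: L1_measurable; exact: L1B.
rewrite (_ : Ex A _ = Ex A h); first by apply: Rintegral_ge0 => w _; rewrite /h le_max lexx.
congr fine; apply: ae_eq_integral => //.
- by apply/measurable_EFinP; exact: measurable_funTS.
- apply/measurable_EFinP; apply: measurable_funTS.
  exact: measurable_maxr.
- apply: filterS fg => w fgw Aw; congr EFin.
  by rewrite /h max_r// subr_ge0 fgw.
Qed.

Lemma eq_Ex_ae A f g : measurable A -> L1 f -> L1 g ->
  {ae P, forall w, A w -> f w = g w} -> Ex A f = Ex A g.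
Proof.
move=> mA hf hg fg; apply/eqP; rewrite eq_le !le_Ex_ae//.
  by apply: filterS fg => w + Aw => ->.
by apply: filterS fg => w + Aw => ->.
Qed.

Lemma Ex_EFin A f : measurable A -> L1 f ->
  (\int[P]_(w in A) (f w)%:E)%E = (Ex A f)%:E.
Proof.
move=> mA hf; rewrite fineK//; apply: (@integrable_fin_num _ _ _ P) => //.
exact: L1S.
Qed.

Lemma Ex_dominated A (f_ : nat -> Omega -> R) f g : measurable A ->
  (forall n, measurable_fun setT (f_ n)) -> measurable_fun setT f ->
  {ae P, forall w, A w -> f_ n w @[n --> \oo] --> f w} -> L1 g ->
  {ae P, forall w n, `|f_ n w| <= g w} ->
  Ex A (f_ n) @[n --> \oo] --> Ex A f.
Proof.
move=> mA mf_ mf ff hg fg.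
have := @dominated_convergence _ _ _ P A mA (fun n => EFin \o f_ n) (EFin \o f)
  (EFin \o g).
case.
- by move=> n; apply/measurable_EFinP; exact: measurable_funTS.
- by apply/measurable_EFinP; exact: measurable_funTS.
- apply: filterS ff => w ff Aw; apply: cvg_EFin; last exact: ff.
  exact: nearW.
- exact: L1S.
- by apply: filterS fg => w fgw n _ /=; rewrite lee_fin.
move=> inf _; rewrite /= -[X in _ --> X]fineK; first exact: fine_cvg.
exact: (@integrable_fin_num _ _ _ P).
Qed.

(** On the tested event f - g is positive, so a nonpositive integral makes the event null. If f and
    g are F_t-measurable, that event lies in F_t, where the comparisons of integrals are
    available. *)
Lemma ae_le_of_Ex f g : L1 f -> L1 g ->
  Ex [set w | g w < f w] f <= Ex [set w | g w < f w] g ->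
  {ae P, forall w, f w <= g w}.
Proof.
move=> hf hg; set A := [set w | _] => le.
have mA : measurable A.
  by apply: measurable_setlt => //; exact: L1_measurable.
have hfg : L1 (fun w => f w - g w) by exact: L1B.
have : Ex A (fun w => f w - g w) <= 0 by rewrite ExB// subr_le0.
have : (\int[P]_(w in A) `|(f w - g w)%:E| = 0)%E -> {ae P, forall w, f w <= g w}.
  have mfg : measurable_fun A (fun w => (f w - g w)%:E).
    by apply/measurable_EFinP; apply: measurable_funTS; exact: L1_measurable.
  have [h _] := ae_eq_integral_abs P mA mfg.
  move/h; apply: filterS => w /= {}h; rewrite leNgt; apply/negP => gf.
  by have [] := h gf; move/eqP; rewrite subr_eq0 gt_eqF.
move=> h h2; apply: h.
rewrite (eq_integral (fun w => (f w - g w)%:E)); last first.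
  by move=> w /set_mem /= gf; rewrite ger0_norm// subr_ge0 ltW.
rewrite Ex_EFin//; congr EFin; apply/eqP; rewrite eq_le h2 /=.
by apply: Rintegral_ge0 => w /= gf; rewrite subr_ge0 ltW.
Qed.

Lemma ae_eq_of_Ex f g : L1 f -> L1 g -> {ae P, forall w, f w <= g w} ->
  Ex setT g <= Ex setT f -> {ae P, forall w, f w = g w}.
Proof.
move=> hf hg fg gf.
have mfg : L1 (fun w => g w - f w) by exact: L1B.
set A := [set w | f w < g w].
have mA : measurable A.
  by apply: measurable_setlt => //; exact: L1_measurable.
have : {ae P, forall w, g w <= f w}.
  apply: ae_le_of_Ex => //; rewrite -/A.
  move: gf; rewrite (Ex_splitT mA hf) (Ex_splitT mA hg).
  have : Ex (~` A) f <= Ex (~` A) g.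
    apply: le_Ex_ae => //; first exact: measurableC.
    by apply: filterS fg.
  move=> h1 h2; rewrite -(lerD2r (Ex (~` A) f)).
  by apply: le_trans h2; rewrite lerD2l.
by apply: filterS2 fg => w h1 h2; apply/eqP; rewrite eq_le h1.
Qed.

(** The expectations are summable, so the series of the |D n| is integrable, hence finite almost
    surely, and its terms tend to 0. *)
Lemma ae_cvg0_of_Ex (D : nat -> Omega -> R) : (forall n, L1 (D n)) ->
  (forall n, {ae P, forall w, 0 <= D n w}) ->
  (forall n, Ex setT (D n) <= 1 / (2 ^ n.+1)%:R) ->
  {ae P, forall w, D n w @[n --> \oo] --> 0}.
Proof.
move=> hD D0 ED.
pose h w := (\sum_(n <oo) `|D n w|%:E)%E.
have mD n : measurable_fun setT (fun w => `|D n w|%:E).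
  apply/measurable_EFinP; apply: L1_measurable; exact: L1_norm.
have intn n : (\int[P]_w `|D n w|%:E <= (1 / (2 ^ n.+1)%:R)%:E)%E.
  rewrite Ex_EFin//; last exact: L1_norm.
  rewrite lee_fin; apply: le_trans (ED n); apply: le_Ex_ae => //.
    exact: L1_norm.
  by apply: filterS (D0 n) => w D0w _; rewrite ger0_norm.
have hint : P.-integrable setT h.
  apply/integrableP; split.
    by apply: ge0_emeasurable_sum => // n w _ _; rewrite lee_fin.
  rewrite (eq_integral h); last first.
    by move=> w _; rewrite gee0_abs// nneseries_ge0// => n _ _; rewrite lee_fin.
  rewrite /h integral_nneseries//.
  apply: (@le_lt_trans _ _ (\sum_(n <oo) (1 / (2 ^ n.+1)%:R)%:E)%E).
    apply: lee_nneseries => [n _ _|n _]; last exact: intn.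
    by apply: integral_ge0 => w _; rewrite lee_fin.
  by apply: le_lt_trans (ltry 1); apply: epsilon_trick0.
have := integrable_ae measurableT hint.
apply: filterS => w /(_ I) hw.
have hfin : (\sum_(0 <= k <oo) `|D k w|%:E < +oo)%E.
  by move: hw; rewrite ge0_fin_numE// /h nneseries_ge0// => n _ _; rewrite lee_fin.
have := @nneseries_tail_cvg _ (fun n => `|D n w|%:E) xpredT hfin.
move=> /(_ (fun _ _ => _)) tl.
apply/norm_cvg0P.
have {}tl := tl ltac:(move=> *; exact: normr_ge0).
have : (`|D n w|%:E @[n --> \oo] --> 0)%E.
  apply: squeeze_cvge (cvg_cst _) tl; apply: nearW => n.
  rewrite lee_fin normr_ge0/=.
  rewrite (nneseries_split _ 1); last by move=> *; rewrite lee_fin.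
  rewrite addn1 big_nat1 leeDl// nneseries_ge0//.
by move=> /fine_cvg.
Qed.

End expectation.

(** * Continuous processes *)

Section caratheodory.
Context {R : realType} d {U : measurableType d}.

Lemma cvg_floor_grid (s : R) :
  (Num.floor (n.+1%:R * s))%:~R / n.+1%:R @[n --> \oo] --> s.
Proof.
have h : (s - n.+1%:R^-1) @[n --> \oo] --> s.
  rewrite -[X in _ --> X]subr0; apply: cvgB; first exact: cvg_cst.
  exact: cvg_harmonic.
apply: squeeze_cvgr h (cvg_cst s); apply: nearW => n.
have n0 : (0 : R) < n.+1%:R by [].
have /andP[h1 h2] := floor_itv (n.+1%:R * s).
rewrite ler_pdivrMr// ler_pdivlMr// mulrBl mulVf ?gt_eqF// (mulrC s) h1 andbT.
by rewrite lerBlDr; apply: ltW; move: h2; rewrite intrD.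
Qed.

(** Rounding the time down to a multiple of 1/(n+1) gives a function that on each of countably many
    strips depends on u only; continuity in time makes f the pointwise limit. *)
Lemma caratheodory_function_measurable (f : R -> U -> R) :
  (forall u, continuous (f ^~ u)) -> (forall s, measurable_fun setT (f s)) ->
  measurable_fun setT (fun z : measurableTypeR R * U => f z.1 z.2).
Proof.
move=> cf mf.
have cvgf (u : U) (s : R) :
    f ((Num.floor (n.+1%:R * s))%:~R / n.+1%:R) u @[n --> \oo] --> f s u.
  apply: (@cvg_comp _ _ _ (fun n : nat => (Num.floor (n.+1%:R * s))%:~R / n.+1%:R)
    (f ^~ u) \oo (nbhs s) (nbhs (f s u))); last exact: (cf u s).
  exact: cvg_floor_grid.
pose h n (z : measurableTypeR R * U) :=
  f ((Num.floor (n.+1%:R * z.1))%:~R / n.+1%:R) z.2.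
apply: (@measurable_fun_cvg _ _ _ _ h) => [n|z _]; last first.
  exact: cvgf.
move=> _ Y mY; rewrite setTI.
rewrite (_ : _ @^-1` Y = \bigcup_(m : int)
    ([set z : measurableTypeR R * U | m%:~R <= n.+1%:R * z.1] `&`
     [set z : measurableTypeR R * U | n.+1%:R * z.1 < (m + 1)%:~R] `&`
     (fun z : measurableTypeR R * U => f (m%:~R / n.+1%:R) z.2) @^-1` Y)).
  have mz : measurable_fun setT
      (fun z : measurableTypeR R * U => n.+1%:R * z.1 : R).
    by apply: measurable_funM => //; exact: measurable_fst.
  apply: countable_bigcupT_measurable => [|m]; first exact: countableP.
  apply: measurableI.
    by apply: measurableI; [exact: measurable_setle|exact: measurable_setlt].
  rewrite -[X in measurable X]setTI; apply: (measurableT_comp (mf _)) => //.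
apply/seteqP; split=> z /=.
  move=> Yz; exists (Num.floor (n.+1%:R * z.1)) => //=.
  by have /andP[h1 h2] := floor_itv (n.+1%:R * z.1).
by case=> m _ /= [[h1 h2]]; rewrite /h (@floor_def _ _ m)// h1.
Qed.

End caratheodory.

Section clip.
Context {R : realType} (a b : R).
Hypothesis ab : a <= b.

(** The retraction of the line onto [a, b]: composing with it turns continuity within the interval
    into continuity on the whole line, and conversely. *)
Definition clip (s : R) : R := Num.max a (Num.min s b).

Lemma clip_itv s : a <= clip s <= b.
Proof. by rewrite /clip le_max lexx ge_max ab ge_min lexx orbT. Qed.

Lemma clip_id s : a <= s <= b -> clip s = s.
Proof. by move=> /andP[h1 h2]; rewrite /clip min_l// max_r. Qed.

Lemma clip_continuous : continuous clip.
Proof.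
move=> s; apply: (@continuous_max R R (cst a) (id \min cst b) s).
  exact: cvg_cst.
by apply: (@continuous_min R R id (cst b) s); [exact: cvg_id|exact: cvg_cst].
Qed.

Lemma within_clip (V : topologicalType) (f : R -> V) :
  {within `[a, b], continuous f} -> continuous (f \o clip).
Proof.
move=> /subspace_continuousP cf s.
have cs : `[a, b]%classic (clip s) by rewrite /= in_itv/= clip_itv.
apply: cvg_comp (cf _ cs) => //.
move=> V' h; have := clip_continuous h.
rewrite /nbhs/= => h'; apply: (@filterS R (nbhs s) _ _ _ _ h') => y /=; apply.
by rewrite /= in_itv/= clip_itv.
Qed.

Lemma clip_within (V : topologicalType) (f : R -> V) :
  continuous (f \o clip) -> {within `[a, b], continuous f}.
Proof.
move=> cf; apply/subspace_continuousP => s /= ss.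
have es : clip s = s by rewrite clip_id// -[X in is_true X]/(s \in `[a, b]).
move=> V' /= hV; have := cf s V'; rewrite /= es => /(_ hV).
rewrite /within/= => h; apply: (@filterS R (nbhs s) _ _ _ _ h) => y /= + yab.
by rewrite clip_id// -[X in is_true X]/(y \in `[a, b]).
Qed.

End clip.

Section rationals.
Context {R : realType}.

Definition rat_enum (n : nat) : R := ratr (odflt 0 (unpickle n)).

Lemma rat_enum_dense (U : set R) : open U -> U !=set0 -> exists n, U (rat_enum n).
Proof.
move=> oU U0; have [x [Ux [q _ qx]]] := @dense_rat R U U0 oU.
by exists (pickle q); rewrite /rat_enum pickleK/= qx.
Qed.

Lemma le_rat_dense (f g : R -> R) : continuous f -> continuous g ->
  (forall n, f (rat_enum n) <= g (rat_enum n)) -> forall s, f s <= g s.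
Proof.
move=> cf cg fg s; rewrite leNgt; apply/negP => gf.
have := @rat_enum_dense [set x | 0 < f x - g x].
case.
- rewrite (_ : [set _ | _] = (fun x => f x - g x) @^-1` `]0, +oo[); last first.
    by apply/seteqP; split=> x /=; rewrite in_itv/= andbT.
  apply: open_comp => // x _; apply: cvgB; [exact: cf|exact: cg].
- by exists s; rewrite /= subr_gt0.
by move=> n /=; rewrite subr_gt0 ltNge fg.
Qed.

End rationals.

(** * Monotonicity of the integral for possibly non-measurable functions *)

Section nomeas.
Local Open Scope ereal_scope.
Context {R : realType} d {U : measurableType d}.
Variable mu : {measure set U -> \bar R}.
Import HBNNSimple.

(** The integral is a supremum over simple functions below the integrand. A simple function below f,
    set to 0 on the exceptional null set N, is below g and has the same integral. *)
Lemma ge0_ae_le_integral_nomeas (f g : U -> \bar R) :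
  (forall x, 0 <= f x) -> (forall x, 0 <= g x) ->
  {ae mu, forall x, f x <= g x} -> \int[mu]_x f x <= \int[mu]_x g x.
Proof.
move=> f0 g0 [N [mN N0 fgN]].
rewrite !ge0_integralTE//; apply: ge_ereal_sup => _ [h /= hf <-].
have mNC := measurableC mN.
apply: le_ereal_sup_tmp; exists (sintegral mu (proj_nnsfun h mNC)); last first.
  rewrite -!integralT_nnsfun le_eqVlt; apply/orP; left; apply/eqP.
  apply: ge0_ae_eq_integral => //.
  - exact/measurable_EFinP.
  - exact/measurable_EFinP.
  - by move=> x _; rewrite lee_fin.
  - by move=> x _; rewrite lee_fin.
  - exists N; split=> // x /= h1; apply: contrapT => Nx; apply: h1 => _ /=.
    by rewrite mindicE mem_set//= mulr1.
exists (proj_nnsfun h mNC) => // x /=.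
rewrite mindicE; have [/set_mem Nx|_] := boolP (x \in ~` N); last first.
  by rewrite mulr0.
rewrite mulr1; apply: le_trans (hf x) _; apply: contrapT => fgx; apply: Nx.
exact: fgN.
Qed.

(* The integrand of [total_profit] need not be measurable, since a strategy may
   switch from a mode to itself on a null set. *)
Lemma ae_le_integral_nomeas (f g : U -> \bar R) :
  {ae mu, forall x, f x <= g x} -> \int[mu]_x f x <= \int[mu]_x g x.
Proof.
move=> fg; rewrite integralE [leRHS]integralE; apply: leeB;
  apply: ge0_ae_le_integral_nomeas => //; apply: filterS fg => x fgx.
  by rewrite !funeposE ge_max !le_max fgx lexx orbT.
by rewrite !funenegE ge_max !le_max leeN2 fgx lexx orbT.
Qed.

End nomeas.

(** * Sampling, suprema and zeros of continuous paths *)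

Section processes.
Context {R : realType} (T : R).
Hypothesis hT : 0 <= T.
Local Notation clip := (clip 0 T).

Lemma clipT s : 0 <= clip s <= T.
Proof. exact: clip_itv. Qed.

Section paths.
Context d {U : measurableType d}.
Implicit Types N : R -> U -> R.

Definition cpath N := forall u, continuous (fun s => N (clip s) u).

Definition mprocess N :=
  cpath N /\ forall s, 0 <= s <= T -> measurable_fun setT (N s).

Lemma mprocess_clip N : mprocess N ->
  measurable_fun setT (fun z : measurableTypeR R * U => N (clip z.1) z.2).
Proof.
move=> [cN mN]; apply: (@caratheodory_function_measurable _ _ _ (fun s => N (clip s))).
  exact: cN.
by move=> s; apply: mN; exact: clipT.
Qed.

Lemma mprocess_sample N (tau : U -> R) : mprocess N ->
  measurable_fun setT tau -> (forall u, 0 <= tau u <= T) ->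
  measurable_fun setT (fun u => N (tau u) u).
Proof.
move=> mN mtau tauT.
rewrite (_ : (fun u => _) =
  (fun z : measurableTypeR R * U => N (clip z.1) z.2) \o (fun u => (tau u, u))).
  apply: measurableT_comp; first exact: mprocess_clip.
  exact: measurable_fun_pair.
by apply/funext => u /=; rewrite clip_id.
Qed.

Lemma cpath_bounded N : cpath N ->
  forall u, exists2 s, 0 <= s <= T &
    forall t, 0 <= t <= T -> `|N t u| <= `|N s u|.
Proof.
move=> cN u.
have [|c + h] := @EVT_max R (fun s => `|N (clip s) u|) 0 T hT.
  apply: continuous_subspaceT => s.
  by apply: continuous_comp; [exact: cN|exact: norm_continuous].
rewrite in_itv/= => cT; exists c => // t tT.
by have := h t; rewrite in_itv/= !clip_id// => /(_ tT).
Qed.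

(** Countably many times make this measurable; by continuity it is the maximum of |N| over
    [0, T]. *)
Definition path_sup N (u : U) := sups (fun n => `|N (clip (rat_enum n)) u|) 0.

Let has_ub N u : cpath N ->
  has_ubound (range (fun n => `|N (clip (rat_enum n)) u|)).
Proof.
move=> cN; have [s _ h] := cpath_bounded cN u.
by exists `|N s u| => _ [n _ <-]; apply: h; exact: clipT.
Qed.

Let path_supE N u : path_sup N u =
  sup (range (fun n => `|N (clip (rat_enum n)) u|)).
Proof.
rewrite /path_sup /sups/=; congr sup; apply/seteqP; split=> x /=.
  by move=> [n _ <-]; exists n.
by move=> [n _ <-]; exists n.
Qed.

Lemma path_sup_measurable N : mprocess N -> measurable_fun setT (path_sup N).
Proof.
move=> [cN mN]; apply: measurable_fun_sups.
  by move=> u _; exact: has_ub.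
by move=> n; apply: measurableT_comp => //; apply: mN; exact: clipT.
Qed.

Lemma le_path_sup N u t : cpath N -> 0 <= t <= T -> `|N t u| <= path_sup N u.
Proof.
move=> cN tT.
have := @le_rat_dense R (fun s => `|N (clip s) u|) (cst (path_sup N u)) _ _ _ t.
rewrite /= clip_id//; apply.
- by move=> s; apply: continuous_comp; [exact: cN|exact: norm_continuous].
- by move=> s; exact: cvg_cst.
move=> n; rewrite path_supE; apply: ub_le_sup; first exact: has_ub.
by exists n.
Qed.

Lemma path_sup_attained N u : cpath N ->
  exists2 s, 0 <= s <= T & path_sup N u = `|N s u|.
Proof.
move=> cN; have [s sT h] := cpath_bounded cN u; exists s => //.
apply/eqP; rewrite eq_le le_path_sup// andbT path_supE; apply: ge_sup.
  by exists `|N (clip (rat_enum 0)) u|; exists 0%N.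
by move=> _ [n _ <-]; apply: h; exact: clipT.
Qed.

Lemma cpathD N N' : cpath N -> cpath N' -> cpath (fun s u => N s u + N' s u).
Proof. by move=> h h' u s; apply: cvgD; [exact: h|exact: h']. Qed.

Lemma cpathN N : cpath N -> cpath (fun s u => - N s u).
Proof. by move=> h u s; apply: cvgN; exact: h. Qed.

Lemma cpath_max N N' : cpath N -> cpath N' ->
  cpath (fun s u => Num.max (N s u) (N' s u)).
Proof.
by move=> h h' u s; apply: (@continuous_max R R); [exact: h|exact: h'].
Qed.

Lemma cpath_stop N (tau : U -> R) : (forall u, 0 <= tau u <= T) -> cpath N ->
  cpath (fun s u => N (Num.min s (tau u)) u).
Proof.
move=> tauT h u.
rewrite (_ : (fun s => _) =
    (fun s => N (clip s) u) \o ((fun s => Num.min (clip s) (tau u)))).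
  move=> s; apply: continuous_comp; last exact: h.
  apply: (@continuous_min R R clip (cst (tau u)) s).
    exact: clip_continuous.
  exact: cvg_cst.
apply/funext => s /=; congr (N _ u); rewrite [RHS]clip_id//.
have /andP[h1 h2] := clipT s; have /andP[h3 h4] := tauT u.
by rewrite le_min h1 h3 ge_min h2.
Qed.

Lemma cpath_cvg N u (s_ : nat -> R) s : cpath N -> (forall n, 0 <= s_ n <= T) ->
  0 <= s <= T -> s_ n @[n --> \oo] --> s -> N (s_ n) u @[n --> \oo] --> N s u.
Proof.
move=> cN s_T sT ss.
rewrite (_ : (fun n => _) = (fun n => N (clip (s_ n)) u)); last first.
  by apply/funext => n; rewrite clip_id.
rewrite -[in X in _ --> X](clip_id sT).
apply: (@cvg_comp _ _ _ s_ (fun s => N (clip s) u) \oo (nbhs s)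
  (nbhs (N (clip s) u))) => //.
exact: (cN u s).
Qed.

Lemma le_cpath N N' u : cpath N -> cpath N' ->
  (forall n, N (clip (rat_enum n)) u <= N' (clip (rat_enum n)) u) ->
  forall s, 0 <= s <= T -> N s u <= N' s u.
Proof.
move=> cN cN' h s sT.
have := @le_rat_dense R (fun s => N (clip s) u) (fun s => N' (clip s) u).
by move=> /(_ (cN u) (cN' u) h s); rewrite clip_id.
Qed.

End paths.

Section hitting.
Context d {U : measurableType d}.

(* By compactness, a continuous path vanishes somewhere on [s, t] if and only if
   its absolute value is arbitrarily small at points of a countable dense set. *)
Lemma measurable_hit (N : R -> U -> R) (sigma : U -> R) (t : R) :
  0 <= t <= T -> mprocess N -> measurable_fun setT sigma ->
  (forall u, 0 <= sigma u <= t) ->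
  measurable [set u | exists s, sigma u <= s <= t /\ N s u = 0].
Proof.
move=> /andP[t0 tT] mN msigma sigmat.
pose s_ n u := Num.max (sigma u) (Num.min (rat_enum n) t).
have s_t n u : sigma u <= s_ n u <= t.
  have /andP[h1 h2] := sigmat u.
  by rewrite /s_ le_max lexx ge_max h2 ge_min lexx orbT.
have s_T n u : 0 <= s_ n u <= T.
  have /andP[h1 h2] := sigmat u; have /andP[h3 h4] := s_t n u.
  by rewrite (le_trans h1 h3) (le_trans h4 tT).
have ms_ n : measurable_fun setT (s_ n).
  by apply: measurable_maxr => //; exact: measurable_cst.
rewrite (_ : [set u | _] = \bigcap_m \bigcup_n
    [set u | `|N (s_ n u) u| <= m.+1%:R^-1]).
  apply: bigcapT_measurable => m; apply: bigcupT_measurable => n.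
  apply: measurable_setle; last exact: measurable_cst.
  apply: measurableT_comp => //; exact: mprocess_sample.
apply/seteqP; split=> u /=.
  move=> [s [/andP[s1 s2] Ns]] m _.
  have sT : 0 <= s <= T.
    by have /andP[h1 _] := sigmat u; rewrite (le_trans h1 s1) (le_trans s2 tT).
  have [e e0 he] : exists2 e, 0 < e & forall r, `|s - r| < e -> 0 <= r <= T ->
      `|N r u| < m.+1%:R^-1.
    have : N (clip r) u @[r --> s] --> N (clip s) u := mN.1 u s.
    rewrite clip_id// Ns => /cvgrPdist_lt.
    move=> /(_ m.+1%:R^-1); rewrite invr_gt0 ltr0n => /(_ isT).
    move=> /nbhs_ballP[e e0 he]; exists e => // r sr rT.
    by have := he r sr; rewrite /= sub0r normrN clip_id.
  have [n hn] : exists n, ball s e (rat_enum n).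
    apply: rat_enum_dense; first exact: ball_open.
    by exists s; exact: ballxx.
  exists n => //=; apply: ltW; apply: he => //.
  (* Clamping to [sigma u, t] does not move a point away from s, which belongs to that interval. *)
  apply: le_lt_trans hn; rewrite /s_.
  move: (rat_enum n) => r.
  have st : sigma u <= t by exact: le_trans s2.
  have [rt|rt] := leP r t; last first.
    by rewrite (max_r st) !ler0_norm; lra.
  have [sr|sr] := leP (sigma u) r; first by [].
  by rewrite !ger0_norm; lra.
move=> h.
have st : sigma u <= t by have /andP[] := sigmat u.
(* Conversely, |N| attains its minimum on [sigma u, t], and this minimum is below every 1/(m+1). *)
have [|c] := @EVT_min R (fun s => `|N (clip s) u|) _ _ st.
  apply: continuous_subspaceT => s.
  by apply: continuous_comp; [exact: mN.1|exact: norm_continuous].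
rewrite in_itv/= => ct hc; exists c; split=> //.
have cT : 0 <= c <= T.
  have /andP[h1 _] := sigmat u; have /andP[h3 h4] := ct.
  by rewrite (le_trans h1 h3) (le_trans h4 tT).
apply/normr0_eq0/eqP; rewrite eq_le normr_ge0 andbT.
apply/ler_addgt0Pr => e e0; rewrite add0r.
have [m] := ltr_add_invr e0; rewrite add0r => me.
have [n _ /= hn] := h m I.
apply: le_trans (ltW me); apply: le_trans hn.
by have := hc (s_ n u); rewrite in_itv/= !clip_id// s_t; exact.
Qed.

End hitting.
End processes.

Section good_processes.
Context {R : realType} {disp : measure_display} {Omega : measurableType disp}.
Variables (P : probability Omega R) (T : R).
Hypothesis hT : 0 <= T.
Implicit Types (N : R -> Omega -> R) (tau sigma : Omega -> R) (s t : R).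
Implicit Types A : set Omega.

(** A single integrable variable bounds the whole path, so dominated convergence applies along
    arbitrary sequences of random times. *)
Definition dominated N := exists2 G : Omega -> R, L1 P G &
  forall w t, 0 <= t <= T -> `|N t w| <= G w.

Definition good N := mprocess T N /\ dominated N.

Lemma good_cpath N : good N -> cpath T N. Proof. by case=> -[]. Qed.

Lemma goodD N N' : good N -> good N' -> good (fun t w => N t w + N' t w).
Proof.
move=> [[c m] [G hG NG]] [[c' m'] [G' hG' NG']]; split; first split.
- exact: cpathD.
- by move=> s sT; apply: measurable_funD; [exact: m|exact: m'].
exists (fun w => G w + G' w); first exact: L1D.
by move=> w t tT; rewrite (le_trans (ler_normD _ _))// lerD ?NG ?NG'.
Qed.

Lemma goodN N : good N -> good (fun t w => - N t w).
Proof.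
move=> [[c m] [G hG NG]]; split; first split.
- exact: cpathN.
- by move=> s sT; apply: measurable_funN; exact: m.
by exists G => // w t tT; rewrite normrN NG.
Qed.

Lemma good_max N N' : good N -> good N' ->
  good (fun t w => Num.max (N t w) (N' t w)).
Proof.
move=> [[c m] [G hG NG]] [[c' m'] [G' hG' NG']]; split; first split.
- exact: cpath_max.
- by move=> s sT; apply: measurable_maxr; [exact: m|exact: m'].
exists (fun w => G w + G' w); first exact: L1D.
move=> w t tT; rewrite /Num.max; case: ifPn => _.
  by apply: le_trans (NG' w t tT) _; rewrite lerDr (le_trans _ (NG w t tT)).
by apply: le_trans (NG w t tT) _; rewrite lerDl (le_trans _ (NG' w t tT)).
Qed.

Lemma good_sample N tau : good N -> measurable_fun setT tau ->
  (forall w, 0 <= tau w <= T) -> L1 P (fun w => N (tau w) w).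
Proof.
move=> [mN [G hG NG]] mtau tauT; apply: (L1_le _ hG).
  exact: (mprocess_sample hT).
by move=> w; exact: NG.
Qed.

Lemma good_L1 N t : good N -> 0 <= t <= T -> L1 P (N t).
Proof. by move=> gN tT; apply: (good_sample (tau := cst t) gN). Qed.

Lemma good_stop N tau : good N -> measurable_fun setT tau ->
  (forall w, 0 <= tau w <= T) -> good (fun s w => N (Num.min s (tau w)) w).
Proof.
move=> [[c m] [G hG NG]] mtau tauT; split; first split.
- exact: cpath_stop.
- move=> s sT; apply: (mprocess_sample hT) => //.
    by apply: measurable_minr => //; exact: measurable_cst.
  move=> w; have /andP[h1 h2] := sT; have /andP[h3 h4] := tauT w.
  by rewrite le_min h1 h3 ge_min h2.
exists G => // w t tT; apply: NG.
have /andP[h1 h2] := tT; have /andP[h3 h4] := tauT w.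
by rewrite le_min h1 h3 ge_min h2.
Qed.

Lemma good_cvg N A (s_ : nat -> Omega -> R) (s : Omega -> R) : measurable A ->
  good N -> (forall n, measurable_fun setT (s_ n)) ->
  (forall n w, 0 <= s_ n w <= T) -> measurable_fun setT s ->
  (forall w, 0 <= s w <= T) ->
  {ae P, forall w, s_ n w @[n --> \oo] --> s w} ->
  Rintegral P A (fun w => N (s_ n w) w) @[n --> \oo] -->
  Rintegral P A (fun w => N (s w) w).
Proof.
move=> mA gN ms_ s_T ms sT ss; have [mN [G hG NG]] := gN.
apply: (@Ex_dominated _ _ _ _ _ (fun n w => N (s_ n w) w) _ G) => //.
- by move=> n; exact: (mprocess_sample hT).
- exact: (mprocess_sample hT).
- by apply: filterS ss => w ssw _; apply: (cpath_cvg (T := T)) => //; case: mN.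
- by apply: aeW => w n; exact: NG.
Qed.

End good_processes.

(** * Filtrations and stopping times *)

Section filtrations.
Context {R : realType} {disp : measure_display} {Omega : measurableType disp}.
Variables (P : probability Omega R) (T : R) (F : R -> set (set Omega)).
Hypothesis hT : 0 <= T.

Definition is_filtration := [/\ forall t, sigma_algebra setT (F t),
  forall t, 0 <= t <= T -> F t `<=` measurable &
  forall s t, 0 <= s -> s <= t -> t <= T -> F s `<=` F t].

Hypothesis FF : is_filtration.
Implicit Types (N : R -> Omega -> R) (tau sigma : Omega -> R) (s t : R).
Implicit Types A : set Omega.

Local Notation OmegaF t := (g_sigma_algebraType (F t)).

Lemma F_measurableE t A : F t A = measurable (A : set (OmegaF t)).
Proof.
rewrite /measurable/=; rewrite sigma_algebra_id//.
by case: FF => + _ _; exact.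
Qed.

Lemma F_measurable t A : 0 <= t <= T -> F t A -> measurable A.
Proof. by move=> tT; case: FF => _ + _; exact. Qed.

Lemma F_mono s t A : 0 <= s -> s <= t -> t <= T -> F s A -> F t A.
Proof. by move=> s0 st tT; case: FF => _ _; exact. Qed.

Lemma F_T t : F t setT.
Proof. by rewrite F_measurableE; exact: measurableT. Qed.

Lemma F_0 t : F t set0.
Proof. by rewrite F_measurableE; exact: measurable0. Qed.

Lemma F_C t A : F t A -> F t (~` A).
Proof. by rewrite !F_measurableE; exact: measurableC. Qed.

Lemma F_I t A B : F t A -> F t B -> F t (A `&` B).
Proof. by rewrite !F_measurableE; exact: measurableI. Qed.

Lemma F_U t A B : F t A -> F t B -> F t (A `|` B).
Proof. by rewrite !F_measurableE; exact: measurableU. Qed.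

Lemma F_fun_measurable t (f : Omega -> R) : 0 <= t <= T ->
  measurable_fun setT (f : OmegaF t -> R) -> measurable_fun setT f.
Proof.
move=> tT mf _ Y mY; apply: (F_measurable tT).
by rewrite F_measurableE; exact: mf.
Qed.

Lemma F_fun_mono s t (f : Omega -> R) : 0 <= s -> s <= t -> t <= T ->
  measurable_fun setT (f : OmegaF s -> R) ->
  measurable_fun setT (f : OmegaF t -> R).
Proof.
move=> s0 st tT mf _ Y mY.
have : F t ([set: Omega] `&` f @^-1` Y).
  apply: (F_mono s0 st tT); rewrite F_measurableE; exact: mf.
by rewrite F_measurableE.
Qed.

Definition adapted (N : R -> Omega -> R) :=
  cpath T N /\
  forall t, 0 <= t <= T -> measurable_fun setT (N t : OmegaF t -> R).

(** Up to time t everything is F_t-measurable, so the sampling and hitting lemmas can be applied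
    over the measurable space (Omega, F_t) and yield events of F_t. *)
Lemma adapted_mprocess N t : adapted N -> 0 <= t <= T ->
  mprocess t (N : R -> OmegaF t -> R).
Proof.
move=> [cN mN] /andP[t0 tT]; split.
  move=> u; rewrite (_ : (fun s => _) = (fun s => N (clip 0 T s) u) \o clip 0 t).
    move=> s; apply: continuous_comp; last exact: (cN u).
    exact: clip_continuous.
  apply/funext => s /=; congr (N _ u); rewrite [RHS]clip_id//.
  by have /andP[h1 h2] := clip_itv t0 s; rewrite h1 (le_trans h2).
move=> s /andP[s0 st]; apply: (F_fun_mono s0) => //.
by apply: mN; rewrite s0 (le_trans st).
Qed.

Lemma adaptedN N : adapted N -> adapted (fun t w => - N t w).
Proof.
move=> [c m]; split; first exact: cpathN.
by move=> s sT; apply: (@measurable_funN _ (OmegaF s)); exact: m.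
Qed.

Lemma adaptedD N N' : adapted N -> adapted N' ->
  adapted (fun t w => N t w + N' t w).
Proof.
move=> [c m] [c' m']; split; first exact: cpathD.
by move=> s sT; apply: (@measurable_funD _ (OmegaF s)); [exact: m|exact: m'].
Qed.

Lemma adapted_max N N' : adapted N -> adapted N' ->
  adapted (fun t w => Num.max (N t w) (N' t w)).
Proof.
move=> [c m] [c' m']; split; first exact: cpath_max.
by move=> s sT; apply: (@measurable_maxr _ (OmegaF s)); [exact: m|exact: m'].
Qed.

Lemma Sp_adapted p N : Sp_process P T F p N -> adapted N.
Proof.
move=> [pN cN _]; split; first by move=> u; exact: (within_clip hT (cN u)).
move=> t tT.
have := pN t tT; have /andP[t0 _] := tT => mN.
have := @measurable_comp _ _ _ (OmegaF t) _ R
  (`[0, t] `*` setT) (fun z : measurableTypeR R * OmegaF t => N z.1 z.2) setT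
  (fun w : OmegaF t => ((t : measurableTypeR R), w)).
apply => //.
- by apply: measurableX.
- by move=> _ [w _ <-]; split=> //=; rewrite in_itv/= t0 lexx.
- by apply: measurable_fun_pair => //; exact: measurable_cst.
Qed.

(** The dominating variable is the supremum of the path: its p-th power is integrable, and x <= 1 +
    x^p for x >= 0. *)
Lemma Sp_good p N : 1 < p -> Sp_process P T F p N -> good P T N.
Proof.
move=> p1 SN; have aN := Sp_adapted SN; have cN := aN.1.
have mN : mprocess T N.
  split=> // s sT; apply: (F_fun_measurable sT); exact: aN.2.
split=> //; exists (path_sup T N); last by move=> w t tT; exact: le_path_sup.
have mG := path_sup_measurable hT mN.
have Gp : L1 P (fun w => path_sup T N w `^ p).
  apply/integrableP; split.
    by apply/measurable_EFinP; exact: (measurableT_comp (measurable_powR p) mG).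
  case: SN => _ _; apply: le_lt_trans; rewrite le_eqVlt; apply/orP; left.
  apply/eqP; apply: eq_integral => w _ /=.
  rewrite ger0_norm ?powR_ge0//; apply/eqP; rewrite eq_le; apply/andP; split.
    have [s sT ->] := path_sup_attained hT w cN.
    by apply: ereal_sup_ubound; exists s => //=; rewrite in_itv.
  apply: ge_ereal_sup => _ [s /= + <-]; rewrite in_itv/= => sT.
  rewrite lee_fin; apply: ge0_ler_powR.
  - by rewrite ltW// (lt_trans _ p1).
  - by rewrite nnegrE.
  - by rewrite nnegrE (le_trans _ (le_path_sup hT w cN sT)).
  - exact: le_path_sup.
apply: (L1_le mG (L1D (L1_cst P 1) Gp)) => w.
have [s sT e] := path_sup_attained hT w cN.
have G0 : 0 <= path_sup T N w by rewrite e.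
rewrite ger0_norm//=; have [G1|G1] := leP (path_sup T N w) 1.
  by rewrite (le_trans G1)// lerDl powR_ge0.
rewrite -[leLHS]powRr1//; apply: (@le_trans _ _ (path_sup T N w `^ p)).
  by apply: ler_powR; exact: ltW.
by rewrite lerDr.
Qed.

Lemma stopping_min_measurable tau t : stopping_time T F tau -> 0 <= t <= T ->
  measurable_fun setT ((fun w => Num.min (tau w) t) : OmegaF t -> R).
Proof.
move=> [tauT Ftau] /andP[t0 tT].
apply: (measurability _ (RGenOInfty.measurableE R)) => //.
move=> _ [_ [x ->] <-]; rewrite -F_measurableE setTI.
rewrite (_ : _ @^-1` _ = ~` [set w | Num.min (tau w) t <= x]); last first.
  by apply/seteqP; split=> w /=; rewrite in_itv/= andbT ltNge => /negP.
apply: F_C; have [xt|tx] := ltP x t; last first.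
  rewrite (_ : [set _ | _] = setT); first exact: F_T.
  by apply/seteqP; split=> w //= _; rewrite ge_min tx orbT.
have [x0|x0] := ltP x 0.
  rewrite (_ : [set _ | _] = set0); first exact: F_0.
  apply/seteqP; split=> w //=; rewrite ge_min leNgt (lt_le_trans x0)/=.
    by rewrite leNgt xt.
  by have /andP[] := tauT w.
rewrite (_ : [set _ | _] = [set w | tau w <= x]); last first.
  by apply/seteqP; split=> w /=; rewrite ge_min (leNgt t) xt orbF.
apply: (F_mono x0 (ltW xt) tT); apply: Ftau.
by rewrite x0 (le_trans (ltW xt)).
Qed.

Lemma stopping_measurable tau : stopping_time T F tau -> measurable_fun setT tau.
Proof.
move=> st; have TT : 0 <= T <= T by rewrite hT lexx.
have := F_fun_measurable TT (stopping_min_measurable st TT).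
rewrite (_ : (fun w => _) = tau)//; apply/funext => w.
by rewrite min_l//; have /andP[] := st.1 w.
Qed.

Lemma stopping_cst t : 0 <= t <= T -> stopping_time T F (cst t).
Proof.
move=> tT; split=> // s sT; have [ts|st] := leP t s.
  by rewrite (_ : [set _ | _] = setT); [exact: F_T|apply/seteqP; split].
rewrite (_ : [set _ | _] = set0); first exact: F_0.
by apply/seteqP; split=> w //=; rewrite leNgt st.
Qed.

Lemma stopping_min tau tau' : stopping_time T F tau -> stopping_time T F tau' ->
  stopping_time T F (fun w => Num.min (tau w) (tau' w)).
Proof.
move=> [h1 h2] [h1' h2']; split=> [w|t tT].
  have /andP[a b] := h1 w; have /andP[a' b'] := h1' w.
  by rewrite le_min a a' ge_min b.
rewrite (_ : [set _ | _] = [set w | tau w <= t] `|` [set w | tau' w <= t]).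
  by apply: F_U; [exact: h2|exact: h2'].
apply/seteqP; split=> w /=; first by rewrite ge_min => /orP.
by rewrite ge_min => /orP.
Qed.

Lemma stopped_FT tau A : stopping_time T F tau -> stopped_sigma T F tau A ->
  F T A.
Proof.
move=> st h; have TT : 0 <= T <= T by rewrite hT lexx.
have := h T TT; rewrite (_ : [set w | _] = setT) ?setIT//.
by apply/seteqP; split=> // w _ /=; have /andP[] := st.1 w.
Qed.

Lemma stopped_measurable tau A : stopping_time T F tau ->
  stopped_sigma T F tau A -> measurable A.
Proof.
move=> st /(stopped_FT st); apply: F_measurable; by rewrite hT lexx.
Qed.

Lemma stopped_mono sigma tau A : stopping_time T F tau ->
  (forall w, sigma w <= tau w) -> stopped_sigma T F sigma A ->
  stopped_sigma T F tau A.
Proof.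
move=> st le h t tT.
rewrite (_ : A `&` _ = (A `&` [set w | sigma w <= t]) `&` [set w | tau w <= t]).
  by apply: F_I; [exact: h|exact: st.2].
apply/seteqP; split=> w /=; last by move=> [[]].
by move=> [Aw h2]; split=> //; split=> //; exact: le_trans h2.
Qed.

Lemma stopped_I tau A B : stopped_sigma T F tau A -> stopped_sigma T F tau B ->
  stopped_sigma T F tau (A `&` B).
Proof.
move=> hA hB t tT; rewrite (_ : A `&` B `&` _ =
  (A `&` [set w | tau w <= t]) `&` (B `&` [set w | tau w <= t])).
  by apply: F_I; [exact: hA|exact: hB].
apply/seteqP; split=> w /=; first by move=> [[? ?] ?].
by move=> [[? ?] [? ?]].
Qed.

Lemma stopped_cst t A : F t A -> 0 <= t -> stopped_sigma T F (cst t) A.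
Proof.
move=> FA t0 s /andP[s0 sT]; have [ts|st] := leP t s.
  rewrite (_ : [set _ | _] = setT); last by apply/seteqP; split.
  by rewrite setIT; exact: (F_mono t0 ts sT).
rewrite (_ : [set _ | _] = set0); first by rewrite setI0; exact: F_0.
by apply/seteqP; split=> w //=; rewrite leNgt st.
Qed.

(** On tau <= t the sampled value is the one at min(tau, t), which is F_t-measurable. *)
Lemma stopped_set0 N tau : adapted N -> stopping_time T F tau ->
  stopped_sigma T F tau [set w | N (tau w) w = 0].
Proof.
move=> aN st t tT; have /andP[t0 _] := tT.
rewrite (_ : _ `&` _ =
  [set w | N (Num.min (tau w) t) w = 0] `&` [set w | tau w <= t]); last first.
  apply/seteqP; split=> w /=; first by move=> [h le]; rewrite min_l.
  by move=> [+ le]; rewrite min_l.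
apply: F_I; last exact: st.2.
rewrite F_measurableE.
apply: (@measurable_seteq _ _ (OmegaF t)); last exact: measurable_cst.
apply: (mprocess_sample t0) => //.
- exact: adapted_mprocess.
- exact: stopping_min_measurable.
- move=> w; have /andP[h1 h2] := st.1 w.
  by rewrite le_min h1 t0 ge_min lexx orbT.
Qed.

End filtrations.

(** * Optimal stopping *)

Section conditional_expectation.
Context {R : realType} {disp : measure_display} {Omega : measurableType disp}.
Variables (P : probability Omega R) (G : set (set Omega)).
Hypotheses (Gs : sigma_algebra setT G) (Gm : G `<=` measurable).
Local Notation OmegaG := (g_sigma_algebraType G).

Let G_E A : G A = measurable (A : set OmegaG).
Proof. by rewrite /measurable/= sigma_algebra_id. Qed.

(* The Radon-Nikodym derivative on (Omega, G) of the charge A |-> E[X 1_A] with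
   respect to the restriction of P, i.e. its image under the identity map. *)
Lemma cond_exp_exists (X : Omega -> R) : L1 P X ->
  exists Z, cond_exp_version P G X Z.
Proof.
move=> hX.
have mid : measurable_fun setT (idfun : Omega -> OmegaG).
  by move=> _ A mA; rewrite setTI; apply: Gm; rewrite G_E.
pose mid_mixin := isMeasurableFun.Build _ _ _ _ _ mid.
pose idG : {mfun Omega >-> OmegaG} :=
  MeasurableFun.Pack (MeasurableFun.Class mid_mixin).
pose mu := distribution P idG.
pose nu := pushforward (induced_charge hX) idG.
have numu : nu `<< mu.
  apply/null_content_dominatesP => A mA muA.
  rewrite /nu /pushforward /induced_charge; apply: null_set_integral => //.
    by apply: Gm; rewrite G_E.
  by apply: measurable_funTS; exact: measurable_int hX.
have [f [ffin intf nuE]] : exists f : OmegaG -> \bar R,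
    [/\ forall w, f w \is a fin_num, mu.-integrable setT f &
        forall A, measurable A -> nu A = (\int[mu]_(w in A) f w)%E].
  pose f0 := Radon_Nikodym nu mu.
  exists (f0 mid); split=> [w||A mA].
  - exact: Radon_Nikodym_fin_num.
  - exact: Radon_Nikodym_integrable.
  - exact: Radon_Nikodym_integral.
have mf : measurable_fun setT f by exact: measurable_int intf.
have mfP : measurable_fun setT (f : Omega -> \bar R).
  by apply: (measurableT_comp mf mid).
have intfP : P.-integrable setT (f : Omega -> \bar R).
  apply/integrableP; split=> //.
  case/integrableP : intf => _; rewrite /mu /distribution.
  by rewrite ge0_integral_pushforward//; exact: measurableT_comp.
have fE : EFin \o (fun w => fine (f w)) = f by apply/funext => w /=; rewrite fineK.
exists (fun w => fine (f w)); split=> //.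
- by rewrite fE.
- by apply: (measurableT_comp _ mf); exact: fine_measurable.
move=> A GA; have mA : measurable (A : set OmegaG) by rewrite -G_E.
rewrite (eq_integral (f : Omega -> \bar R)); last by move=> w _; rewrite fineK.
have := nuE A mA.
rewrite /mu /distribution integral_pushforward//.
exact: integrableS (Gm GA) _ intfP.
Qed.

Lemma cond_exp_Ex X Z A : cond_exp_version P G X Z -> G A ->
  Rintegral P A Z = Rintegral P A X.
Proof. by move=> [_ _ _ h] GA; congr fine; exact: h. Qed.

End conditional_expectation.

Section snell_envelope.
Context {R : realType} {disp : measure_display} {Omega : measurableType disp}.
Variables (P : probability Omega R) (T : R) (F : R -> set (set Omega)).
Hypotheses (hT : 0 <= T) (FF : is_filtration T F).
Variables (t : R) (r : R -> Omega -> R) (Yt : Omega -> R).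
Hypothesis tT : 0 <= t <= T.
Local Notation reward tau := (fun w => r (tau w) w).
Local Notation OmegaF := (g_sigma_algebraType (F t)).

Definition stopping_from (tau : Omega -> R) :=
  stopping_time T F tau /\ forall w, t <= tau w.

Hypothesis r_L1 : forall tau, stopping_from tau -> L1 P (reward tau).
Hypothesis Yt_L1 : L1 P Yt.
Local Notation Fam := [set Z | exists tau : Omega -> R,
        [/\ stopping_time T F tau, forall w, t <= tau w
          & cond_exp_version P (F t) (reward tau) Z]].
Hypothesis YtE : is_esssup P Fam Yt.

Let Fs : sigma_algebra setT (F t). Proof. by case: FF. Qed.
Let Fm : F t `<=` measurable. Proof. by move=> A; exact: (F_measurable FF). Qed.

Lemma snell_ge tau A : stopping_from tau -> F t A ->
  Rintegral P A (reward tau) <= Rintegral P A Yt.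
Proof.
move=> st FA; have [Z ZE] := cond_exp_exists Fs Fm (r_L1 st).
rewrite -(cond_exp_Ex ZE FA); apply: le_Ex_ae => //.
- exact: Fm.
- by case: ZE.
case: YtE => _ + _ => /(_ Z) h; have {}h : {ae P, forall w, Z w <= Yt w}.
  by apply: h; exists tau; case: st.
by apply: filterS h.
Qed.

Let Fam_L1 Z : Fam Z -> L1 P Z. Proof. by case=> tau [_ _ []]. Qed.

(** Use tau1 where Z2 <= Z1 and tau2 elsewhere. The choice is made on an event of F_t and both times
    are at least t, so the pasted time is a stopping time, and its reward has the maximum as
    conditional expectation. *)
Lemma snell_family_max Z1 Z2 : Fam Z1 -> Fam Z2 ->
  Fam (fun w => Num.max (Z1 w) (Z2 w)).
Proof.
move=> F1 F2; have L1Z1 := Fam_L1 F1; have L1Z2 := Fam_L1 F2.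
move: F1 F2 => [tau1 [st1 t1 cZ1]] [tau2 [st2 t2 cZ2]].
pose tau w := if Z2 w <= Z1 w then tau1 w else tau2 w.
pose A := [set w | Z2 w <= Z1 w].
have FA : F t A.
  rewrite (F_measurableE FF); apply: (@measurable_setle _ _ OmegaF).
    by case: cZ2.
  by case: cZ1.
have tauE1 w : A w -> tau w = tau1 w by rewrite /A /tau /= => ->.
have tauE2 w : ~ A w -> tau w = tau2 w by rewrite /A /tau /= => /negP/negbTE ->.
have maxE1 w : A w -> Num.max (Z1 w) (Z2 w) = Z1 w by move=> h; rewrite max_l.
have maxE2 w : ~ A w -> Num.max (Z1 w) (Z2 w) = Z2 w.
  by move=> /negP; rewrite -ltNge => h; rewrite max_r// ltW.
have ttau w : t <= tau w by rewrite /tau; case: ifP.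
have sttau : stopping_time T F tau.
  split=> [w|s /andP[s0 sT]]; first by rewrite /tau; case: ifP => _; [exact: st1.1|exact: st2.1].
  have [ts|st] := leP t s; last first.
    rewrite (_ : [set _ | _] = set0); first exact: (F_0 FF).
    by apply/seteqP; split=> w //=; rewrite leNgt (lt_le_trans st).
  have FsA : F s A by apply: (F_mono FF _ ts sT) => //; case/andP : tT.
  rewrite (_ : [set _ | _] = (A `&` [set w | tau1 w <= s]) `|`
                              (~` A `&` [set w | tau2 w <= s])).
    by apply: (F_U FF); apply: (F_I FF) => //;
      [apply: st1.2; rewrite s0|exact: (F_C FF)|apply: st2.2; rewrite s0].
  apply/seteqP; split=> w /=.
    have [Aw|Aw] := pselect (A w); first by rewrite tauE1//; left.
    by rewrite tauE2//; right.
  by case=> -[Aw]; [rewrite tauE1|rewrite tauE2].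
have L1max : L1 P (fun w => Num.max (Z1 w) (Z2 w)).
  apply: (L1_le _ (L1D (L1_norm L1Z1) (L1_norm L1Z2))).
    by apply: measurable_maxr; [exact: L1_measurable L1Z1|exact: L1_measurable L1Z2].
  by move=> w; rewrite /Num.max; case: ifP => _; rewrite ?lerDl ?lerDr.
exists tau; split=> //; split=> //.
- exact: r_L1.
- by apply: (@measurable_maxr _ OmegaF); [case: cZ1|case: cZ2].
move=> C FC; have mC := Fm FC; have mA := Fm FA.
have L1r : L1 P (reward tau) by exact: r_L1.
have L1r1 : L1 P (reward tau1) by exact: r_L1.
have L1r2 : L1 P (reward tau2) by exact: r_L1.
rewrite !Ex_EFin//; congr EFin.
rewrite (Ex_split mC mA L1max) (Ex_split mC mA L1r).
congr (_ + _).
  transitivity (Rintegral P (C `&` A) Z1).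
    by apply: eq_Rintegral => w /set_mem[_ Aw]; rewrite maxE1.
  rewrite (cond_exp_Ex cZ1); last exact: (F_I FF).
  by apply: eq_Rintegral => w /set_mem[_ Aw]; rewrite tauE1.
transitivity (Rintegral P (C `\` A) Z2).
  by apply: eq_Rintegral => w /set_mem[_ Aw]; rewrite maxE2.
rewrite (cond_exp_Ex cZ2); last by apply: (F_I FF) => //; exact: (F_C FF).
by apply: eq_Rintegral => w /set_mem[_ Aw]; rewrite tauE2.
Qed.

(* Maxima of a sequence in Fam whose expectations approach the supremum increase
   to a random variable dominating Fam, hence to Yt. *)
Lemma snell_approx (e : R) : 0 < e -> exists tau, stopping_from tau /\
  Rintegral P setT Yt <= Rintegral P setT (reward tau) + e.
Proof.
move=> e0.
have TT : 0 <= T <= T by rewrite hT lexx.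
have Fam_le Z : Fam Z -> {ae P, forall w, Z w <= Yt w}.
  by case: YtE => _ + _ => /(_ Z) h FZ; exact: h.
have [Zb FZb] : exists Z, Fam Z.
  have stT : stopping_from (cst T).
    by split; [exact: stopping_cst|move=> w; case/andP : tT].
  have [Z ZE] := cond_exp_exists Fs Fm (r_L1 stT).
  by exists Z, (cst T); case: stT.
pose V := [set Rintegral P setT Z | Z in Fam].
have V_sup : has_sup V.
  split; first by exists (Rintegral P setT Zb), Zb.
  exists (Rintegral P setT Yt) => _ [Z FZ <-].
  by apply: le_Ex_ae => //; [exact: Fam_L1|apply: filterS (Fam_le _ FZ)].
have Vle Z : Fam Z -> Rintegral P setT Z <= sup V.
  by move=> FZ; apply: sup_upper_bound => //; exists Z.
have /choice[Z ZP] : forall n : nat, exists Z, Fam Z /\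
    sup V - 1 / (2 ^ n.+1)%:R < Rintegral P setT Z.
  move=> n; have n0 : 0 < 1 / (2 ^ n.+1)%:R :> R by rewrite divr_gt0// ltr0n expn_gt0.
  by have [_ [Z' FZ' <-] h] := sup_adherent n0 V_sup; exists Z'.
have FZ n := (ZP n).1.
have L1Z n := Fam_L1 (FZ n).
pose W := fix W n := if n is m.+1 then fun w => Num.max (W m w) (Z m.+1 w) else Z 0%N.
have FW n : Fam (W n) by elim: n => [|n IH]; [exact: FZ|exact: snell_family_max].
have ZW n w : Z n w <= W n w by case: n => //= n; rewrite le_max lexx orbT.
have Wnd n m w : (n <= m)%N -> W n w <= W m w.
  elim: m => [|m IH]; first by rewrite leqn0 => /eqP ->.
  rewrite leq_eqVlt ltnS => /predU1P[->//|/IH/le_trans]; apply => /=.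
  by rewrite le_max lexx.
(* The supremum lives in the extended reals, as do the competing upper bounds in [is_esssup]. *)
pose Zs w := ereal_sup (range (fun n => (Z n w)%:E)).
have mZs : measurable_fun setT Zs.
  rewrite (_ : Zs = fun w => esups (fun n => (Z n w)%:E) 0).
    apply: measurable_fun_esups => n; apply/measurable_EFinP.
    exact: L1_measurable (L1Z n).
  apply/funext => w; rewrite /Zs /esups/=; congr ereal_sup.
  by apply/seteqP; split=> _ [n _ <-]; exists n.
have Zs_ub f : Fam f -> {ae P, forall w, ((f w)%:E <= Zs w)%E}.
  move=> Ff; have L1f := Fam_L1 Ff.
  (* This is the positive part of f - Z n. As the maximum is again in the family, its expectation is
     at most sup V - E[Z n] < 2^-(n+1), so it tends to 0 almost surely and f cannot exceed the
     supremum of the Z n. *)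
  pose D n w := Num.max (f w) (Z n w) - Z n w.
  have Fmax n := snell_family_max Ff (FZ n).
  have : {ae P, forall w, D n w @[n --> \oo] --> 0}.
    apply: ae_cvg0_of_Ex => n.
    - by apply: L1B => //; exact: Fam_L1 (Fmax n).
    - by apply: aeW => w; rewrite /D subr_ge0 le_max lexx orbT.
    - rewrite ExB//; last exact: Fam_L1 (Fmax n).
      rewrite lerBlDl; apply: le_trans (Vle _ (Fmax n)) _.
      by rewrite -lerBlDr; apply: ltW; case: (ZP n).
  apply: filterS => w Dw; rewrite leNgt; apply/negP => Zf.
  have Zn n : ((Z n w)%:E <= Zs w)%E by apply: ereal_sup_ubound; exists n.
  case: (Zs w) Zf Zn => [z| |]; last 2 first.
  - by rewrite ltNge leey.
  - by move=> _ /(_ 0%N).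
  rewrite lte_fin => zf Zn.
  have /cvgrPdist_lt/(_ (f w - z)) := Dw.
  rewrite subr_gt0 => /(_ zf) [n _ /(_ n (leqnn n))] /=.
  rewrite sub0r normrN; apply/negP; rewrite -leNgt.
  apply: (@le_trans _ _ (D n w)); last exact: ler_norm.
  rewrite /D; apply: lerB; first by rewrite le_max lexx.
  by rewrite -lee_fin.
have YZs : {ae P, forall w, ((Yt w)%:E <= Zs w)%E} by case: YtE => _ _; exact.
have WY : {ae P, forall w, forall n, W n w <= Yt w}.
  by apply: ae_foralln => n; exact: Fam_le.
have Wcvg : {ae P, forall w, W n w @[n --> \oo] --> Yt w}.
  apply: filterS2 YZs WY => w h1 h2; apply/cvgrPdist_le => d d0.
  have : ((Yt w - d)%:E < Zs w)%E.
    by apply: lt_le_trans h1; rewrite lte_fin ltrBlDr ltrDl.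
  move=> /ereal_sup_gt[_ [n _ <-]]; rewrite lte_fin => hn.
  exists n => // m /= nm; rewrite ger0_norm ?subr_ge0//.
  rewrite lerBlDr -lerBlDl; apply: ltW; apply: lt_le_trans hn _.
  by apply: le_trans (ZW n w) _; exact: Wnd.
have : Rintegral P setT (W n) @[n --> \oo] --> Rintegral P setT Yt.
  apply: (@Ex_dominated _ _ _ P setT W Yt (fun w => `|Z 0%N w| + `|Yt w|)) => //.
  - by move=> n; exact: L1_measurable (Fam_L1 (FW n)).
  - exact: L1_measurable Yt_L1.
  - by apply: filterS Wcvg.
  - by apply: L1D; exact: L1_norm.
  - apply: filterS WY => w h n; rewrite ler_norml; apply/andP; split.
      apply: (@le_trans _ _ (W 0%N w)); last exact: Wnd.
      rewrite lerNl /=; apply: (@le_trans _ _ `|Z 0%N w|).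
        by rewrite -normrN ler_norm.
      by rewrite lerDl.
    by apply: le_trans (h n) _; apply: le_trans (ler_norm _) _; rewrite lerDr.
move=> /cvgrPdist_lt/(_ e e0)[n _ /(_ n (leqnn n))]/= hn.
have [tau [st ttau ce]] := FW n; exists tau; split=> //.
rewrite -(cond_exp_Ex ce (F_T FF t)).
rewrite -lerBlDl; apply: ltW; apply: le_lt_trans hn; exact: ler_norm.
Qed.

End snell_envelope.

(** * Rounding up to a grid, and optional stopping *)

Section grid.
Context {R : realType} (T : R).
Hypothesis hT : 0 < T.

Definition grid (n k : nat) : R := T * k%:R / n.+1%:R.

Definition grid_index (n : nat) (x : R) : nat :=
  `|Num.ceil (x * n.+1%:R / T)|%N.

Definition grid_up (n : nat) (x : R) : R := grid n (grid_index n x).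

Lemma grid_itv n k : (k <= n.+1)%N -> 0 <= grid n k <= T.
Proof.
move=> kn; rewrite /grid divr_ge0 ?mulr_ge0 ?(ltW hT)//=.
by rewrite ler_pdivrMr// ler_pM2l// ler_nat.
Qed.

Lemma grid_lt n k x : 0 <= x -> (grid n k < x) = (k < grid_index n x)%N.
Proof.
move=> x0; have c0 : 0 <= Num.ceil (x * n.+1%:R / T).
  by rewrite ceil_ge0 (lt_le_trans (ltrN10 _))// divr_ge0 ?mulr_ge0 ?(ltW hT).
rewrite /grid ltr_pdivrMr// mulrC -ltr_pdivlMr//.
rewrite -[k%:R]/((Posz k)%:~R) -ceil_gt_int -[X in _ < X]gez0_abs//.
Qed.

Lemma grid_index_le n x : 0 <= x <= T -> (grid_index n x <= n.+1)%N.
Proof.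
move=> /andP[x0 xT]; rewrite leqNgt -grid_lt// -leNgt.
by rewrite /grid mulfK.
Qed.

Lemma grid_up_itv n x : 0 <= x <= T -> 0 <= grid_up n x <= T.
Proof. by move=> xT; apply: grid_itv; exact: grid_index_le. Qed.

Lemma grid_up_ge n x : 0 <= x -> x <= grid_up n x.
Proof. by move=> x0; rewrite leNgt grid_lt// ltnn. Qed.

Lemma grid_up_le n x : 0 <= x -> grid_up n x <= x + T / n.+1%:R.
Proof.
move=> x0; rewrite /grid_up; case: (grid_index n x) (fun k => grid_lt n k x0) => [|m].
  by move=> _; rewrite /grid mulr0 mul0r addr_ge0// divr_ge0// ltW.
move=> /(_ m); rewrite ltnSn /grid -[m.+1%:R]natr1 mulrDr mulr1 mulrDl lerD2r.
exact: ltW.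
Qed.

Lemma cvg_grid_up x : 0 <= x -> grid_up n x @[n --> \oo] --> x.
Proof.
move=> x0.
have h : (x + T * n.+1%:R^-1) @[n --> \oo] --> x.
  rewrite -[X in _ --> X]addr0; apply: cvgD; first exact: cvg_cst.
  rewrite -(mulr0 T); apply: cvgM; first exact: cvg_cst.
  exact: cvg_harmonic.
apply: squeeze_cvgr (cvg_cst x) h; apply: nearW => n.
by rewrite grid_up_ge//= grid_up_le.
Qed.

(** With x a stopping time, randomness enters the right-hand side only through the events
    [grid n k < x], which are known at time [grid n k]: this is the benefit of rounding up. *)
Lemma grid_up_telescope n x (f : R -> R) : 0 <= x <= T ->
  f (grid_up n x) - f 0 =
  \sum_(k < n.+1) (f (grid n k.+1) - f (grid n k)) * (grid n k < x)%R%:R.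
Proof.
move=> xT; have x0 : 0 <= x by case/andP : xT.
have f0 : f 0 = f (grid n 0) by rewrite /grid mulr0 mul0r.
rewrite f0 /grid_up -(telescope_sumr (f \o grid n) (leq0n _)).
rewrite big_mkord (big_ord_widen _ (fun k => (f \o grid n) k.+1 - (f \o grid n) k)
  (grid_index_le n xT)).
rewrite [LHS]big_mkcond; apply: eq_bigr => k _.
by rewrite grid_lt//; case: ifP; rewrite ?mulr1 ?mulr0.
Qed.

End grid.

Section optional_stopping.
Context {R : realType} {disp : measure_display} {Omega : measurableType disp}.
Variables (P : probability Omega R) (T : R) (F : R -> set (set Omega)).
Hypotheses (hT : 0 < T) (FF : is_filtration T F).
Let hT0 : 0 <= T := ltW hT.

Lemma grid_up_measurable n (tau : Omega -> R) : measurable_fun setT tau ->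
  (forall w, 0 <= tau w <= T) ->
  measurable_fun setT (fun w => grid_up T n (tau w)).
Proof.
move=> mtau tauT.
rewrite (_ : (fun w => _) = (fun w => \sum_(k < n.+1)
   (grid T n k.+1 - grid T n k) * (grid T n k < tau w)%R%:R)).
  apply: measurable_sum => k; apply: measurable_funM => //.
  rewrite (_ : (fun w => _) = \1_[set w | grid T n k < tau w]).
    by apply: measurable_indic; apply: measurable_setlt.
  by apply/funext => w; rewrite indicE; congr ((nat_of_bool _)%:R);
    apply/idP/idP => [?|/set_mem//]; exact/mem_set.
apply/funext => w; rewrite -(grid_up_telescope hT n id (tauT w)).
by rewrite subr0.
Qed.

(** After rounding up, N_tau - N_sigma on A is a sum of increments over grid steps, the one starting
    at s being carried by the event sigma <= s < tau of F_s; then the mesh tends to 0. The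
    comparison is required only for events within sigma <= s < tau because [hit_opt] can supply it
    only before the hitting time. *)
Lemma optional_stopping N (sigma tau : Omega -> R) A : good P T N ->
  stopping_time T F sigma -> stopping_time T F tau ->
  (forall w, sigma w <= tau w) -> stopped_sigma T F sigma A ->
  (forall s t C, 0 <= s -> s <= t -> t <= T -> F s C ->
    C `<=` A `&` [set w | sigma w <= s /\ s < tau w] ->
    Rintegral P C (N t) <= Rintegral P C (N s)) ->
  Rintegral P A (fun w => N (tau w) w) <= Rintegral P A (fun w => N (sigma w) w).
Proof.
move=> gN ssigma stau le FA H.
have msigma := stopping_measurable hT0 FF ssigma.
have mtau := stopping_measurable hT0 FF stau.
have mA := stopped_measurable hT0 FF ssigma FA.
have sigT := ssigma.1; have tauT := stau.1.
have cv (rho : Omega -> R) : measurable_fun setT rho -> (forall w, 0 <= rho w <= T) ->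
    Rintegral P A (fun w => N (grid_up T n (rho w)) w) @[n --> \oo] -->
    Rintegral P A (fun w => N (rho w) w).
  move=> mrho rhoT; apply: (good_cvg hT0) => //.
  - by move=> n; exact: grid_up_measurable.
  - by move=> n w; exact: grid_up_itv.
  - by apply: aeW => w; apply: cvg_grid_up => //; case/andP : (rhoT w).
apply: ler_cvg_to (cv _ mtau tauT) (cv _ msigma sigT) _; apply: nearW => n.
have L1up (rho : Omega -> R) : measurable_fun setT rho -> (forall w, 0 <= rho w <= T) ->
    L1 P (fun w => N (grid_up T n (rho w)) w).
  move=> mrho rhoT; apply: (good_sample hT0) => //; first exact: grid_up_measurable.
  by move=> w; exact: grid_up_itv.
have L1tau := L1up _ mtau tauT; have L1sig := L1up _ msigma sigT.
rewrite -subr_le0 -ExB//.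
pose B k := [set w | sigma w <= grid T n k /\ grid T n k < tau w].
have gk (k : 'I_n.+1) : 0 <= grid T n k <= T by apply: grid_itv => //; exact: ltnW.
have gk1 (k : 'I_n.+1) : 0 <= grid T n k.+1 <= T by apply: grid_itv.
have FB (k : 'I_n.+1) : F (grid T n k) (A `&` B k).
  rewrite (_ : A `&` _ = (A `&` [set w | sigma w <= grid T n k]) `&`
                         ~` [set w | tau w <= grid T n k]).
    apply: (F_I FF); first exact: FA.
    by apply: (F_C FF); apply: stau.2.
  apply/seteqP; split=> w /=.
    by move=> [Aw [h1 h2]]; split=> //; apply/negP; rewrite -ltNge.
  by move=> [[Aw h1] /negP]; rewrite -ltNge.
have mB (k : 'I_n.+1) : measurable (A `&` B k) by exact: F_measurable FF _ _ (gk k) (FB k).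
rewrite (@eq_Rintegral _ _ _ _ _ (fun w => \sum_(k < n.+1)
    (N (grid T n k.+1) w - N (grid T n k) w) * \1_(A `&` B k) w)); last first.
  move=> w /set_mem Aw.
  rewrite -[LHS](subrKA (N 0 w)) -[X in _ + X]opprB.
  rewrite (grid_up_telescope hT n (N ^~ w) (tauT w)).
  rewrite (grid_up_telescope hT n (N ^~ w) (sigT w)).
  rewrite -sumrB; apply: eq_bigr => k _; rewrite -mulrBr; congr (_ * _).
  rewrite indicE; have [/set_mem[_ [h1 h2]]|] := boolP (w \in _).
    by rewrite h2 ltNge h1 subr0.
  move=> /negP h; have [h1|h1] := leP (sigma w) (grid T n k); last first.
    by rewrite (lt_le_trans h1)// subrr.
  by have [h2|//] := ltP (grid T n k) (tau w); [case: h; apply/mem_set|rewrite subrr].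
have L1k (k : 'I_n.+1) : L1 P (fun w => N (grid T n k.+1) w - N (grid T n k) w).
  by apply: L1B; apply: (good_L1 hT0 gN).
rewrite Ex_sum//; last by move=> k _; exact: L1_indic.
apply: sumr_le0 => k _.
rewrite [leLHS](_ : _ = Rintegral P (A `&` (A `&` B k))
    (fun w => N (grid T n k.+1) w - N (grid T n k) w)); last first.
  rewrite Rintegral_mkcondr; apply: eq_Rintegral => w _.
  by rewrite patchE indicE; case: ifPn => _; rewrite ?mulr1 ?mulr0.
rewrite setIA setIid ExB//; [|exact: (good_L1 hT0 gN)..].
rewrite subr_le0; apply: H => //.
- by case/andP : (gk k).
- by rewrite /grid ler_pM2r// ler_pM2l// ler_nat.
- by case/andP : (gk1 k).
Qed.

End optional_stopping.

(** * Hitting time of the obstacle *)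

Section hitting_time.
Context {R : realType} {disp : measure_display} {Omega : measurableType disp}.
Variables (T : R) (F : R -> set (set Omega)).
Hypothesis FF : is_filtration T F.
Variables (Y S : R -> Omega -> R).
Hypotheses (aY : adapted T F Y) (aS : adapted T F S).

Definition hit_set (s : R) (w : Omega) : set R :=
  T |` [set r | s <= r <= T /\ Y r w = S r w].

Definition hit (s : R) (w : Omega) : R := inf (hit_set s w).

Let Z t w := Y t w - S t w.
Let aZ : adapted T F Z.
Proof. by apply: adaptedD => //; exact: adaptedN. Qed.

Let lb_hit s w : s <= T -> lbound (hit_set s w) s.
Proof. by move=> sT r [->//|[/andP[]]]. Qed.

Lemma hit_itv s w : s <= T -> s <= hit s w <= T.
Proof.
move=> sT; apply/andP; split.
  by apply: lb_le_inf; [exists T; left|exact: lb_hit].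
by apply: ge_inf; [exists s; exact: lb_hit|left].
Qed.

(** If the infimum were not attained, Y - S would be nonzero there, hence nearby by continuity, so
    that no point of the set could approach it. *)
Lemma hit_in s w : 0 <= s -> s <= T -> hit_set s w (hit s w).
Proof.
move=> s0 sT; apply: contrapT => nh.
have hi : has_inf (hit_set s w).
  by split; [exists T; left|exists s; exact: lb_hit].
have /andP[h1 h2] := hit_itv w sT.
have cT : 0 <= hit s w <= T by rewrite (le_trans s0 h1) h2.
have hneT : hit s w != T by apply/eqP => e; apply: nh; left.
have Zne : Z (hit s w) w != 0.
  apply/eqP => e; apply: nh; right; split; first by rewrite h1 h2.
  by apply/eqP; rewrite -subr_eq0; apply/eqP.
have [e e0 he] : exists2 e, 0 < e & forall r, `|hit s w - r| < e ->
    0 <= r <= T -> Z r w != 0.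
  have : Z (clip 0 T r) w @[r --> hit s w] --> Z (clip 0 T (hit s w)) w := aZ.1 w _.
  rewrite clip_id// => /cvgrPdist_lt/(_ `|Z (hit s w) w|).
  rewrite normr_gt0 => /(_ Zne) /nbhs_ballP[e e0 he]; exists e => // r sr rT.
  have := he r sr; rewrite /= clip_id//; apply: contraTneq => ->.
  by rewrite subr0 ltxx.
(* The second bound prevents the approximating point from being the extra element T, where Y and S
   may differ. *)
have e1 : 0 < Num.min e (T - hit s w).
  by rewrite lt_min e0 subr_gt0 lt_neqAle hneT.
have [r hr] := inf_adherent e1 hi.
have rge : hit s w <= r by apply: ge_inf hr; exists s; exact: lb_hit.
rewrite -ltrBlDl lt_min => /andP[r1 r2].
case: hr => [rT|[/andP[sr rT] YS]].
  by move: r2; rewrite rT ltxx.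
have : Z r w != 0.
  apply: he; first by rewrite distrC ger0_norm ?subr_ge0.
  by rewrite (le_trans s0 sr).
by rewrite /Z YS subrr eqxx.
Qed.

Lemma hit_eq s w : 0 <= s -> s <= T -> hit s w < T ->
  Y (hit s w) w = S (hit s w) w.
Proof.
move=> s0 sT hlt; case: (hit_in w s0 sT) => [e|[]//].
by move: hlt; rewrite e ltxx.
Qed.

Lemma hit_before s r w : s <= T -> s <= r -> r < hit s w -> Y r w != S r w.
Proof.
move=> sT sr rh; apply: contraTneq rh => YS; rewrite -leNgt.
have [rT|Tr] := leP r T.
  by apply: ge_inf; [exists s; exact: lb_hit|right; split=> //; rewrite sr rT].
by apply: le_trans (ltW Tr); case/andP : (hit_itv w sT).
Qed.

(** No meeting occurs between s and r. This lets the optimality of the hitting time started from a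
    deterministic r be used for one started at a random earlier time. *)
Lemma hit_later s r w : 0 <= s -> s <= T -> s <= r -> r < hit s w ->
  hit r w = hit s w.
Proof.
move=> s0 sT sr rh.
have hsT : hit s w <= T by case/andP : (hit_itv w sT).
have rT : r <= T by exact: ltW (lt_le_trans rh hsT).
have r0 : 0 <= r by exact: le_trans sr.
apply/eqP; rewrite eq_le; apply/andP; split.
  apply: ge_inf; first by exists r; exact: lb_hit.
  case: (hit_in w s0 sT) => [->|[/andP[h1 h2] h3]]; first by left.
  by right; split=> //; rewrite (ltW rh) h2.
apply: ge_inf; first by exists s; exact: lb_hit.
case: (hit_in w r0 rT) => [->|[/andP[h1 h2] h3]]; first by left.
by right; split=> //; rewrite (le_trans sr h1) h2.
Qed.

(** For t < T, the hitting time is at most t exactly when sigma <= t and Y - S has a zero on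
    [sigma, t], because the infimum is attained; [measurable_hit] over F_t then applies. *)
Lemma hit_stopping (sigma : Omega -> R) : stopping_time T F sigma ->
  stopping_time T F (fun w => hit (sigma w) w).
Proof.
move=> st; have sT := st.1; split=> [w|t /andP[t0 tT]].
  have /andP[h1 h2] := sT w; have /andP[h3 h4] := hit_itv w h2.
  by rewrite (le_trans h1 h3) h4.
(* The time T is separate: the hitting time may equal T without Y and S meeting. *)
move: tT; rewrite le_eqVlt => /predU1P[->|tT].
  rewrite (_ : [set _ | _] = setT); first exact: (F_T FF).
  apply/seteqP; split=> // w _ /=.
  by have /andP[h1 h2] := sT w; case/andP : (hit_itv w h2).
have tT' : 0 <= t <= T by rewrite t0 ltW.
rewrite (_ : [set _ | _] = [set w | sigma w <= t] `&`
  [set w | exists s, Num.min (sigma w) t <= s <= t /\ Z s w = 0]).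
  apply: (F_I FF); first exact: st.2.
  rewrite (F_measurableE FF).
  apply: (@measurable_hit _ t t0 _ (g_sigma_algebraType (F t)) Z) => //.
  - by rewrite t0 lexx.
  - exact: (adapted_mprocess FF).
  - exact: (stopping_min_measurable FF).
  - move=> w; have /andP[h1 h2] := sT w.
    by rewrite le_min h1 t0 ge_min lexx orbT.
apply/seteqP; split=> w /=.
  have /andP[h1 h2] := sT w; have /andP[h3 h4] := hit_itv w h2.
  move=> ht; have st' : sigma w <= t by exact: le_trans ht.
  split=> //; exists (hit (sigma w) w); rewrite min_l// h3 ht; split=> //.
  by rewrite /Z hit_eq ?subrr// (le_lt_trans ht).
move=> [st' [s]]; rewrite min_l// => -[/andP[s1 s2] Zs].
apply: (le_trans _ s2); apply: ge_inf.
  by exists (sigma w); apply: lb_hit; case/andP : (sT w).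
right; split; first by rewrite s1 (le_trans s2 (ltW tT)).
by apply/eqP; rewrite -subr_eq0; apply/eqP.
Qed.

End hitting_time.

(** * The Snell envelope of one mode as supermartingale and stopped martingale *)

Section single_mode.
Context {R : realType} {disp : measure_display} {Omega : measurableType disp}.
Variables (P : probability Omega R) (T : R) (F : R -> set (set Omega)).
Hypotheses (hT : 0 < T) (FF : is_filtration T F).
Variables (Y Psi S : R -> Omega -> R).
Hypotheses (aY : adapted T F Y) (aS : adapted T F S).
Hypotheses (gY : good P T Y) (gPsi : good P T Psi) (gS : good P T S).
Let hT0 : 0 <= T := ltW hT.

Definition stop_reward t (tau : Omega -> R) w :=
  Psi (tau w) w - Psi t w + S (tau w) w * (tau w < T)%R%:R.

Local Notation Ex A f := (Rintegral P A f).
(** The Snell envelope enters this section only through this bound and the next one, which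
    [snell_mode_ge] and [snell_mode_approx] provide; no conditional expectation is left. *)
Hypothesis Y_ge : forall t tau A, 0 <= t <= T -> stopping_from T F t tau ->
  F t A -> Ex A (stop_reward t tau) <= Ex A (Y t).
Hypothesis Y_approx : forall t e, 0 <= t <= T -> 0 < e ->
  exists tau, stopping_from T F t tau /\
  Ex setT (Y t) <= Ex setT (stop_reward t tau) + e.

Lemma L1_alive N (tau : Omega -> R) : good P T N -> measurable_fun setT tau ->
  (forall w, 0 <= tau w <= T) ->
  L1 P (fun w => N (tau w) w * (tau w < T)%R%:R).
Proof.
move=> gN mtau tauT.
rewrite (_ : (fun w => _) = (fun w => N (tau w) w * \1_[set w | tau w < T] w)).
  by apply: L1_indic; [exact: measurable_setlt|exact: (good_sample hT0)].
apply/funext => w; rewrite indicE; congr (_ * (nat_of_bool _)%:R).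
by apply/idP/idP => [?|/set_mem//]; exact/mem_set.
Qed.

Lemma stop_reward_L1 t tau : 0 <= t <= T -> stopping_from T F t tau ->
  L1 P (stop_reward t tau).
Proof.
move=> tT [st _]; have mtau := stopping_measurable hT0 FF st.
apply: L1D; last by apply: L1_alive => //; exact: st.1.
by apply: L1B; [exact: (good_sample hT0) mtau st.1|exact: (good_L1 hT0)].
Qed.

(** From T on, the only stopping time is T itself, with zero reward: domination gives Y_T >= 0,
    near-optimality gives E[Y_T] <= 0. *)
Lemma terminal_zero : {ae P, forall w, Y T w = 0}.
Proof.
have TT : 0 <= T <= T by rewrite hT0 lexx.
have rew0 tau : stopping_from T F T tau -> stop_reward T tau = cst 0.
  move=> [st Ttau]; apply/funext => w; rewrite /stop_reward.
  have -> : tau w = T.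
    by apply/eqP; rewrite eq_le Ttau andbT; case/andP : (st.1 w).
  by rewrite subrr ltxx mulr0 addr0.
have sT : stopping_from T F T (cst T) by split=> //; exact: stopping_cst.
have Ex0 (A : set Omega) : measurable A -> Ex A (cst 0) = 0.
  by move=> mA; rewrite Rintegral_cst// mul0r.
have L1Y : L1 P (Y T) by exact: (good_L1 hT0).
have ge0 : {ae P, forall w, 0 <= Y T w}.
  apply: (ae_le_of_Ex (L1_cst P 0) L1Y).
  set A := [set w | _].
  have FA : F T A.
    rewrite (F_measurableE FF).
    apply: (@measurable_setlt _ _ (g_sigma_algebraType (F T))).
      by apply: aY.2.
    exact: measurable_cst.
  by have := Y_ge TT sT FA; rewrite rew0.
have := ae_eq_of_Ex (L1_cst P 0) L1Y ge0.
case.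
  rewrite Ex0//; apply/ler_addgt0Pr => e e0.
  have [tau [st]] := Y_approx TT e0.
  by rewrite rew0// Ex0.
by move=> N h; exists N; case: h => a b c; split=> // w /= h; apply: c => /= h'; apply: h.
Qed.

(** Stopping at once at t < T earns S_t. Countably many such t and continuity give all t < T on one
    event; T is reached as a limit from the left, since the reward ignores S_T. *)
Lemma obstacle_le : {ae P, forall w, forall t, 0 <= t <= T -> S t w <= Y t w}.
Proof.
have h t : 0 <= t -> t < T -> {ae P, forall w, S t w <= Y t w}.
  move=> t0 tT; have tTT : 0 <= t <= T by rewrite t0 ltW.
  have L1Y : L1 P (Y t) by exact: (good_L1 hT0).
  have L1S : L1 P (S t) by exact: (good_L1 hT0).
  apply: (ae_le_of_Ex L1S L1Y).
  have st : stopping_from T F t (cst t) by split=> //; exact: stopping_cst.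
  rewrite (_ : Ex _ (S t) = Ex [set w | Y t w < S t w] (stop_reward t (cst t))).
    apply: Y_ge => //; rewrite (F_measurableE FF).
    by apply: (@measurable_setlt _ _ (g_sigma_algebraType (F t))); [apply: aY.2|apply: aS.2].
  by apply: eq_Rintegral => w _; rewrite /stop_reward tT mulr1 subrr add0r.
have : {ae P, forall w, forall n : nat, clip 0 T (rat_enum n) < T ->
    S (clip 0 T (rat_enum n)) w <= Y (clip 0 T (rat_enum n)) w}.
  apply: ae_foralln => n; have /andP[h1 h2] := @clip_itv R 0 T hT0 (rat_enum n).
  have [lt|ge] := ltP (clip 0 T (rat_enum n)) T; last by apply: aeW.
  by apply: filterS (h _ h1 lt).
apply: filterS => w hw.
pose Z t := Y (clip 0 T t) w - S (clip 0 T t) w.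
have cZ : continuous Z.
  by move=> t; apply: cvgB; [exact: (aY.1 w t)|exact: (aS.1 w t)].
have Zlt t : 0 <= t -> t < T -> 0 <= Z t.
  move=> t0 tT; rewrite leNgt; apply/negP => Zt.
  have [n] : exists n, ([set r | Z r < 0] `&` [set r | r < T]) (rat_enum n : R).
    apply: rat_enum_dense; last by exists t.
    apply: openI; last exact: open_lt.
    rewrite (_ : [set _ | _] = Z @^-1` [set x | x < 0])//.
    by apply: open_comp => [x _|]; [exact: cZ|exact: open_lt].
  move=> [/= Zn nT]; move: Zn; rewrite ltNge /Z subr_ge0 hw//.
  by rewrite /clip gt_max hT gt_min nT.
move=> t /andP[t0 tT].
have : 0 <= Z t; last by rewrite /Z clip_id ?t0// subr_ge0.
move: tT; rewrite le_eqVlt => /predU1P[->|]; last exact: Zlt.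
rewrite leNgt; apply/negP => ZT.
have : nbhs T (Z @^-1` [set x | x < 0]).
  apply: open_nbhs_nbhs; split=> //.
  by apply: open_comp => [x _|]; [exact: cZ|exact: open_lt].
move=> /nbhs_ballP[e /= e0 he].
(* The minimum with T keeps the point at this distance before T inside [0, T]. *)
have m0 : 0 < Num.min (e / 2) T by rewrite lt_min hT divr_gt0.
have := he (T - Num.min (e / 2) T); rewrite /ball/= subKr ger0_norm ?(ltW m0)//.
rewrite gt_min [X in X || _](_ : _ = true); last by rewrite /=; lra.
move=> /(_ isT); rewrite ltNge Zlt//.
  by rewrite subr_ge0 ge_min lexx orbT.
by rewrite ltrBlDr ltrDl.
Qed.

(** A time that is nearly optimal from t is also a competitor from s, and its two rewards differ by
    Psi_t - Psi_s. *)
Lemma supermart_det s t C : 0 <= s -> s <= t -> t <= T -> F s C ->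
  Ex C (fun w => Y t w + Psi t w) <= Ex C (fun w => Y s w + Psi s w).
Proof.
move=> s0 st tT FC.
have t0 : 0 <= t by exact: le_trans st.
have tTT : 0 <= t <= T by rewrite t0.
have sTT : 0 <= s <= T by rewrite s0 (le_trans st).
have FtC := F_mono FF s0 st tT FC.
have mC := F_measurable FF tTT FtC.
have gL1 N r : good P T N -> 0 <= r <= T -> L1 P (N r) by exact: good_L1.
rewrite !ExD//; try by apply: gL1.
apply/ler_addgt0Pr => e e0.
have [tau [stau hY]] := Y_approx tTT e0.
have stau_s : stopping_from T F s tau.
  by case: stau => h1 h2; split=> // w; exact: le_trans (h2 w).
have L1t := stop_reward_L1 tTT stau.
(* Near-optimality in total mean localises to C, because Y_t dominates the reward on the
   complement. *)
have hC : Ex C (Y t) <= Ex C (stop_reward t tau) + e.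
  move: hY; rewrite (Ex_splitT mC L1t) (Ex_splitT mC (gL1 _ _ gY tTT)).
  have := Y_ge tTT stau (F_C FF FtC).
  lra.
have := Y_ge sTT stau_s FC.
rewrite (_ : Ex C (stop_reward s tau) =
    Ex C (fun w => stop_reward t tau w + (Psi t w - Psi s w))); last first.
  by apply: eq_Rintegral => w _; rewrite /stop_reward; ring.
rewrite ExD//; last by apply: L1B; apply: gL1.
rewrite ExB//; try by apply: gL1.
lra.
Qed.

Let gM : good P T (fun t w => Y t w + Psi t w). Proof. exact: goodD. Qed.

Lemma supermart (sigma tau : Omega -> R) A : stopping_time T F sigma ->
  stopping_time T F tau -> (forall w, sigma w <= tau w) ->
  stopped_sigma T F sigma A ->
  Ex A (fun w => Y (tau w) w + Psi (tau w) w) <=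
  Ex A (fun w => Y (sigma w) w + Psi (sigma w) w).
Proof.
move=> h1 h2 le FA.
apply: (optional_stopping hT FF gM h1 h2 le FA) => s t C s0 st tT FC _.
exact: supermart_det.
Qed.

Local Notation hitYS := (hit T Y S).

(** On [t, u] with u before the hitting time, the continuous gap Y - S has a positive minimum. Once
    the gap at tau_n is smaller, tau_n must exceed u; if tau_n = T, it does so anyway. *)
Let Y_ge_obstacle_cvg (t : R) (tau_ : nat -> R) (w : Omega) :
  0 <= t <= T -> (forall n, t <= tau_ n <= T) ->
  (forall r, 0 <= r <= T -> S r w <= Y r w) ->
  (Y (tau_ n) w - S (tau_ n) w) * (tau_ n < T)%R%:R @[n --> \oo] --> 0 ->
  Num.min (tau_ n) (hitYS t w) @[n --> \oo] --> hitYS t w.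
Proof.
move=> /andP[t0 tT] tauT SY cv; set h := hitYS t w.
have /andP[th hT'] : t <= h <= T by exact: hit_itv.
apply/cvgrPdist_le => e e0.
pose u := Num.max t (h - e).
have [ht|th'] := leP h t.
  apply: nearW => n; have /andP[tn _] := tauT n.
  by rewrite min_r ?subrr ?normr0 ?(ltW e0)// (le_trans ht tn).
have uh : u < h by rewrite gt_max th' ltrBlDr ltrDl.
have tu : t <= u by rewrite le_max lexx.
have uT : u <= T by apply: ltW; exact: lt_le_trans hT'.
pose Z r := Y (clip 0 T r) w - S (clip 0 T r) w.
have [|c /andP[]] := @EVT_min R Z t u tu.
  apply: continuous_subspaceT => r.
  by apply: cvgB; [exact: (aY.1 w r)|exact: (aS.1 w r)].
rewrite !bnd_simp => tc cu hc.
have cT : 0 <= c <= T by rewrite (le_trans t0) ?(le_trans cu).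
have Zc : 0 < Z c.
  rewrite /Z clip_id// subr_gt0 lt_neqAle SY// andbT eq_sym.
  by apply: (hit_before tT tc); exact: le_lt_trans uh.
have /cvgrPdist_lt/(_ _ Zc) := cv; apply: filterS => n.
rewrite sub0r normrN => hn.
have /andP[tn nT] := tauT n.
have un : u < tau_ n.
  rewrite ltNge; apply/negP => nu; move: hn.
  rewrite (lt_le_trans (le_lt_trans nu uh) hT') mulr1.
  apply/negP; rewrite -leNgt; apply: (le_trans _ (ler_norm _)).
  have := hc (tau_ n); rewrite in_itv/= tn nu => /(_ isT).
  by rewrite [in X in _ <= X]/Z clip_id// (le_trans t0 tn) nT.
rewrite ger0_norm ?subr_ge0 ?ge_min ?lexx ?orbT//.
have hu : h - e <= u by rewrite /u le_max lexx orbT.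
by rewrite /Num.min; case: ifP => _; lra.
Qed.

(* Along 2^-n-optimal stopping times, the gap between Y and the obstacle tends to 0,
   so their minimum with the hitting time tends to the hitting time. *)
Lemma hit_opt_det t C : 0 <= t <= T -> F t C ->
  Ex C (fun w => Y t w + Psi t w) <=
  Ex C (fun w => Y (hitYS t w) w + Psi (hitYS t w) w).
Proof.
move=> tT FC; have /andP[t0 tT'] := tT.
have mC := F_measurable FF tT FC.
have st : stopping_time T F (cst t) by exact: (stopping_cst FF).
have sh : stopping_time T F (fun w => hitYS t w).
  exact: (hit_stopping FF aY aS st).
have le_h w : t <= hitYS t w by case/andP : (hit_itv Y S w tT').
have L1M (tau : Omega -> R) : stopping_time T F tau ->
    L1 P (fun w => Y (tau w) w + Psi (tau w) w).
  by move=> s; apply: (good_sample hT0 gM) s.1; exact: (stopping_measurable hT0 FF).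
(* The supermartingale inequality on the complement of C turns the bound over Omega into the one
   over C. *)
suff total : Ex setT (fun w => Y t w + Psi t w) <=
    Ex setT (fun w => Y (hitYS t w) w + Psi (hitYS t w) w).
  move: total; rewrite (Ex_splitT mC (L1M _ st)) (Ex_splitT mC (L1M _ sh)).
  have := supermart st sh le_h (stopped_cst FF (F_C FF FC) t0).
  rewrite /=; lra.
have e_gt0 n : 0 < 1 / (2 ^ n.+1)%:R :> R by rewrite divr_gt0// ltr0n expn_gt0.
have /choice[tau_ tauP] : forall n, exists tau, stopping_from T F t tau /\
    Ex setT (Y t) <= Ex setT (stop_reward t tau) + 1 / (2 ^ n.+1)%:R.
  by move=> n; apply: Y_approx.
have sfrom n := (tauP n).1.
have stau n : stopping_time T F (tau_ n) := (sfrom n).1.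
have tau_ge n w : t <= tau_ n w := (sfrom n).2 w.
have tauT n w : 0 <= tau_ n w <= T := (stau n).1 w.
have mtau n : measurable_fun setT (tau_ n).
  exact: (stopping_measurable hT0 FF).
(* The loss from stopping at tau_n instead of receiving Y there. It is 0 at T, where Y vanishes and
   nothing is paid. *)
pose D n w := (Y (tau_ n w) w - S (tau_ n w) w) * (tau_ n w < T)%R%:R.
have L1D_ n : L1 P (D n).
  apply: (@L1_alive (fun t w => Y t w - S t w)) => //.
  by apply: goodD => //; exact: goodN.
have TT : 0 <= T <= T by rewrite hT0 lexx.
have DE n : {ae P, forall w, Y (tau_ n w) w =
    D n w + S (tau_ n w) w * (tau_ n w < T)%R%:R}.
  apply: filterS terminal_zero => w YT; rewrite /D -mulrDl subrK.
  have [_|Tn] := ltP (tau_ n w) T; first by rewrite mulr1.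
  rewrite mulr0; have -> : tau_ n w = T; last by [].
  by apply/eqP; rewrite eq_le Tn andbT; case/andP : (tauT n w).
have D_ge0 n : {ae P, forall w, 0 <= D n w}.
  apply: filterS obstacle_le => w SY; rewrite mulr_ge0// subr_ge0.
  exact: SY.
have L1Yn n : L1 P (fun w => Y (tau_ n w) w) by exact: (good_sample hT0 gY).
have L1Pn n : L1 P (fun w => Psi (tau_ n w) w) by exact: (good_sample hT0 gPsi).
have L1Pt : L1 P (Psi t) by exact: (good_L1 hT0).
have L1Yt : L1 P (Y t) by exact: (good_L1 hT0).
have L1Sn n : L1 P (fun w => S (tau_ n w) w * (tau_ n w < T)%R%:R).
  exact: L1_alive.
have EY n : Ex setT (fun w => Y (tau_ n w) w) = Ex setT (D n) +
    Ex setT (fun w => S (tau_ n w) w * (tau_ n w < T)%R%:R).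
  rewrite -ExD//; apply: eq_Ex_ae => //; first exact: L1D.
  by apply: filterS (DE n).
have ER n : Ex setT (stop_reward t (tau_ n)) =
    Ex setT (fun w => Psi (tau_ n w) w) - Ex setT (Psi t) +
    Ex setT (fun w => S (tau_ n w) w * (tau_ n w < T)%R%:R).
  by rewrite ExD ?ExB//; exact: L1B.
have EM n : Ex setT (fun w => Y (tau_ n w) w) + Ex setT (fun w => Psi (tau_ n w) w)
    <= Ex setT (Y t) + Ex setT (Psi t).
  rewrite -!ExD//.
  exact: (supermart st (stau n) (tau_ge n) (stopped_cst FF (F_T FF t) t0)).
(* The reward of tau_n is almost surely M_tau_n - Psi_t - D n with M = Y + Psi. By the
   supermartingale inequality its mean is at most E[Y_t] - E[D n], while near-optimality bounds it
   below by E[Y_t] - 2^-(n+1). *)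
have ED n : Ex setT (D n) <= 1 / (2 ^ n.+1)%:R.
  have := (tauP n).2; rewrite ER; have := EM n; rewrite EY; lra.
have ED0 n : 0 <= Ex setT (D n).
  rewrite (_ : 0 = Ex setT (cst 0)); last by rewrite Rintegral_cst// mul0r.
  apply: le_Ex_ae => //; first exact: L1_cst.
  by apply: filterS (D_ge0 n).
pose rho n w := Num.min (tau_ n w) (hitYS t w).
have srho n : stopping_time T F (rho n) by exact: (stopping_min FF).
have rho_cvg : {ae P, forall w, rho n w @[n --> \oo] --> hitYS t w}.
  have D0 := ae_cvg0_of_Ex L1D_ D_ge0 ED.
  apply: filterS2 D0 obstacle_le => w cv SY.
  apply: Y_ge_obstacle_cvg => // n.
  by rewrite tau_ge; case/andP : (tauT n w).
have cvM : Ex setT (fun w => Y (rho n w) w + Psi (rho n w) w) @[n --> \oo] -->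
    Ex setT (fun w => Y (hitYS t w) w + Psi (hitYS t w) w).
  apply: (good_cvg hT0 measurableT gM) => //.
  - by move=> n; exact: (stopping_measurable hT0 FF).
  - by move=> n w; exact: (srho n).1.
  - exact: (stopping_measurable hT0 FF).
  - exact: sh.1.
have small : 1 / (2 ^ n.+1)%:R @[n --> \oo] --> (0 : R).
  apply: squeeze_cvgr (cvg_cst 0) cvg_harmonic; apply: nearW => n.
  rewrite ltW//= div1r lef_pV2 ?posrE ?ltr0n ?expn_gt0// ler_nat.
  by apply: ltnW; exact: ltn_expl.
have cvR : Ex setT (fun w => Y (rho n w) w + Psi (rho n w) w) + 1 / (2 ^ n.+1)%:R
    @[n --> \oo] --> Ex setT (fun w => Y (hitYS t w) w + Psi (hitYS t w) w).
  by rewrite -[X in _ --> X]addr0; exact: cvgD.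
apply: ler_cvg_to (cvg_cst _) cvR _; apply: nearW => n.
have h1 : Ex setT (fun w => Y (tau_ n w) w + Psi (tau_ n w) w) <=
    Ex setT (fun w => Y (rho n w) w + Psi (rho n w) w).
  apply: (supermart (srho n) (stau n)).
    by move=> w; rewrite /rho ge_min lexx.
  by move=> s sT; rewrite setTI; exact: (srho n).2.
have := (tauP n).2; rewrite ER; move: h1.
rewrite (ExD measurableT (L1Yn n) (L1Pn n)) EY (ExD measurableT L1Yt L1Pt).
have := ED0 n; lra.
Qed.

(** One inequality is the supermartingale property. The other is optional stopping for the opposite
    of M stopped at the hitting time h: on an event with sigma <= s < h, the hitting time started
    from s is still h, and [hit_opt_det] applies. *)
Lemma hit_opt (sigma : Omega -> R) A : stopping_time T F sigma ->
  stopped_sigma T F sigma A ->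
  Ex A (fun w => Y (sigma w) w + Psi (sigma w) w) =
  Ex A (fun w => Y (hitYS (sigma w) w) w + Psi (hitYS (sigma w) w) w).
Proof.
move=> ssig FA; pose h w := hitYS (sigma w) w.
have sh : stopping_time T F h by apply: hit_stopping.
have mh : measurable_fun setT h by exact: (stopping_measurable hT0 FF).
have le_h w : sigma w <= h w.
  by have /andP[_ h2] := ssig.1 w; case/andP : (hit_itv Y S w h2).
apply/eqP; rewrite eq_le; apply/andP; split; last exact: supermart.
have mA := stopped_measurable hT0 FF ssig FA.
have L1M (tau : Omega -> R) : stopping_time T F tau ->
    L1 P (fun w => Y (tau w) w + Psi (tau w) w).
  by move=> s; apply: (good_sample hT0 gM) s.1; exact: (stopping_measurable hT0 FF).
pose N s w := - (Y (Num.min s (h w)) w + Psi (Num.min s (h w)) w).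
have gN : good P T N by apply: goodN; exact: (good_stop hT0 gM mh sh.1).
have := optional_stopping hT FF gN ssig sh le_h FA.
rewrite /N.
have -> : Ex A (fun w => - (Y (Num.min (h w) (h w)) w + Psi (Num.min (h w) (h w)) w))
    = - Ex A (fun w => Y (h w) w + Psi (h w) w).
  rewrite -ExN//; last exact: L1M.
  by apply: eq_Rintegral => w _; rewrite minxx.
have -> : Ex A (fun w => - (Y (Num.min (sigma w) (h w)) w +
      Psi (Num.min (sigma w) (h w)) w))
    = - Ex A (fun w => Y (sigma w) w + Psi (sigma w) w).
  rewrite -ExN//; last exact: L1M.
  by apply: eq_Rintegral => w _; rewrite min_l.
rewrite lerN2; apply => s t C s0 st tT FC CA.
have sT : s <= T by exact: le_trans tT.
have sTT : 0 <= s <= T by rewrite s0.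
have t0 : 0 <= t by exact: le_trans st.
have tTT : 0 <= t <= T by rewrite t0.
have mC := F_measurable FF sTT FC.
have hE w : C w -> hitYS s w = h w.
  move=> /CA[_ [h1 h2]]; rewrite /h (hit_later aY aS _ _ h1)//.
    by case/andP : (ssig.1 w).
  by case/andP : (ssig.1 w).
have stmin r : 0 <= r <= T -> stopping_time T F (fun w => Num.min r (h w)).
  by move=> rT; apply: (stopping_min FF) => //; exact: (stopping_cst FF).
rewrite !ExN//; try by apply: L1M; exact: stmin.
rewrite lerN2.
rewrite (_ : Ex C (fun w => Y (Num.min s (h w)) w + _) =
             Ex C (fun w => Y s w + Psi s w)); last first.
  by apply: eq_Rintegral => w /set_mem/CA[_ [_ sh']]; rewrite min_l// ltW.
apply: le_trans (hit_opt_det sTT FC) _.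
rewrite (_ : Ex C (fun w => Y (hitYS s w) w + _) =
             Ex C (fun w => Y (h w) w + Psi (h w) w)); last first.
  by apply: eq_Rintegral => w /set_mem Cw; rewrite hE.
apply: supermart => //; first exact: stmin.
  by move=> w; rewrite ge_min lexx orbT.
(* C is known at time min(t, h): it is in F_r for r >= s, and for r < s its trace is empty because s
   < h on C. *)
move=> r rT; have [sr|rs] := leP s r.
  apply: (F_I FF); last by case: (stmin t tTT) => _; exact.
  by apply: (F_mono FF s0 sr) FC; case/andP : rT.
rewrite (_ : C `&` _ = set0); first exact: (F_0 FF).
apply/seteqP; split=> // w [/CA[_ [_ sh']] /=].
by rewrite leNgt lt_min (lt_trans rs sh') (lt_le_trans rs st).
Qed.

End single_mode.

(** * Value processes of the switching problem *)

Section running_integral.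
Context {R : realType} {disp : measure_display} {Omega : measurableType disp}.
Variables (P : probability Omega R) (T : R).
Hypothesis hT : 0 < T.
Let hT0 : 0 <= T := ltW hT.
Local Notation mu := (@lebesgue_measure R).
Implicit Types f : R -> Omega -> R.

Definition running f (t : R) (w : Omega) : R :=
  (\int[mu]_(s in `[0, t]) f s w)%R.

Lemma path_integrable f w a b : cpath T f -> 0 <= a -> b <= T ->
  mu.-integrable `[a, b] (EFin \o f ^~ w).
Proof.
move=> cf a0 bT; apply: (@integrableS _ _ _ mu `[0, T]%classic) => //.
  by apply: subset_itv; rewrite bnd_simp.
apply: continuous_compact_integrable; first exact: segment_compact.
exact: (clip_within (cf w)).
Qed.

Lemma runningB f w a b : cpath T f -> 0 <= a -> a <= b -> b <= T ->
  running f b w - running f a w = (\int[mu]_(s in `[a, b]) f s w)%R.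
Proof.
move=> cf a0 ab bT.
rewrite /running Rintegral_itvB ?bnd_simp//; last exact: path_integrable.
apply: Rintegral_itv_obnd_cbnd.
apply: integrableS (path_integrable w cf a0 bT) => //.
by apply: subset_itv; rewrite bnd_simp.
Qed.

Lemma running_lipschitz f w K a b : cpath T f ->
  (forall s, 0 <= s <= T -> `|f s w| <= K) -> 0 <= a -> a <= b -> b <= T ->
  `|running f b w - running f a w| <= K * (b - a).
Proof.
move=> cf fK a0 ab bT; rewrite runningB//.
have intf := path_integrable w cf a0 bT.
apply: le_trans (le_normr_Rintegral _ intf) _ => //.
have K0 : 0 <= K by apply: le_trans (fK 0 _); rewrite ?normr_ge0// lexx.
have cstE : (\int[mu]_(_ in `[a, b]) K)%R = K * (b - a).
  rewrite Rintegral_cst//; congr (_ * _).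
  rewrite /= lebesgue_measure_itv/= lte_fin; case: ltP => //.
  by move=> ba; rewrite (_ : a = b) ?subrr//; apply/eqP; rewrite eq_le ab.
rewrite -cstE; apply: le_Rintegral => //.
- exact: (integrable_norm intf).
- apply: (@integrableS _ _ _ mu `[a, b]%classic) => //.
  apply: continuous_compact_integrable; first exact: segment_compact.
  by apply: continuous_subspaceT => x; exact: cvg_cst.
- move=> x; rewrite /= in_itv/= => /andP[ax xb]; apply: fK.
  by rewrite (le_trans a0 ax) (le_trans xb bT).
Qed.

Lemma running_cpath f : cpath T f -> cpath T (running f).
Proof.
move=> cf w t; have [s sT fK] := cpath_bounded hT0 cf w.
set K := `|f s w| in fK.
have lip a b : 0 <= a <= T -> 0 <= b <= T ->
    `|running f a w - running f b w| <= K * `|a - b|.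
  move=> /andP[a0 aT] /andP[b0 bT]; have [ab|ba] := leP a b.
    by rewrite distrC (distrC a) (ger0_norm (x := b - a)) ?subr_ge0//;
      exact: running_lipschitz.
  rewrite (ger0_norm (x := a - b)) ?subr_ge0; last exact: ltW.
  exact: (running_lipschitz cf fK b0 (ltW ba) aT).
apply/cvgrPdist_le => e e0.
have K1 : 0 < K + 1 by rewrite ltr_pwDr// normr_ge0.
have e1 : 0 < e / (K + 1) by rewrite divr_gt0.
have := @clip_continuous R 0 T t; move=> /cvgrPdist_le/(_ _ e1).
apply: filterS => r hr; apply: le_trans (lip _ _ _ _) _; try exact: clip_itv.
apply: (@le_trans _ _ ((K + 1) * (e / (K + 1)))).
  by apply: ler_pM => //; rewrite ?normr_ge0// lerDl.
by rewrite mulrC divfK// gt_eqF.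
Qed.

(** Tonelli's theorem makes the integrals of the positive and negative parts measurable in w;
    [running] is their difference. *)
Lemma running_measurable f t : mprocess T f -> 0 <= t <= T ->
  measurable_fun setT (running f t).
Proof.
move=> mf /andP[t0 tT].
have mz := mprocess_clip hT0 mf.
pose g (z : measurableTypeR R * Omega) := (f (clip 0 T z.1) z.2 * \1_(`[0, t]%classic : set R) z.1)%:E.
have mg : measurable_fun setT g.
  apply/measurable_EFinP; apply: measurable_funM => //.
  have := @measurable_indic _ (measurableTypeR R) R setT `[0, t]%classic.
  move=> /(_ (measurable_itv _)) mi.
  exact: (measurableT_comp mi measurable_fst).
have gE w : (\int[mu]_(s in `[0%R, t]) (f s w)%:E = \int[mu]_s g (s, w))%E.
  rewrite integral_mkcond; apply: eq_integral => s _.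
  rewrite /g/= patchE indicE; case: ifPn => [/set_mem|_]; last by rewrite mulr0.
  rewrite /= in_itv/= => /andP[s0 st]; rewrite mulr1 clip_id// s0.
  exact: le_trans tT.
rewrite (_ : running f t = fun w => fine (
    \int[mu]_s (g^\+ (s, w)) - \int[mu]_s (g^\- (s, w)))%E).
  apply: measurableT_comp; first exact: fine_measurable.
  apply: emeasurable_funB.
    have h : measurable_fun setT (fubini_G mu (g^\+)%E).
      apply: measurable_fun_fubini_tonelli_G => //.
      exact: measurable_funepos.
    exact: h.
  have h : measurable_fun setT (fubini_G mu (g^\-)%E).
      apply: measurable_fun_fubini_tonelli_G => //.
      exact: measurable_funeneg.
    exact: h.
apply/funext => w; rewrite /running /Rintegral gE integralE.
congr (fine (_ - _)%E); apply: eq_integral => s _.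
  by rewrite -[RHS]/(((g^\+)%E \o (fun r => (r, w))) s) -funepos_comp.
by rewrite -[RHS]/(((g^\-)%E \o (fun r => (r, w))) s) -funeneg_comp.
Qed.

Lemma running_good f : good P T f -> good P T (running f).
Proof.
move=> [mf [G hG fG]]; split; first split.
- by apply: running_cpath; case: mf.
- by move=> s sT; exact: running_measurable.
exists (fun w => T * G w); first exact: L1Z.
move=> w t tT; have /andP[t0 tT'] := tT.
have r0 : running f 0 w = 0 by rewrite /running set_itv1 Rintegral_set1.
have G0 : 0 <= G w by apply: le_trans (fG w t tT).
rewrite -(subr0 (running f t w)) -r0 mulrC.
apply: le_trans (running_lipschitz mf.1 (fG w) _ _ _) _ => //.
by rewrite subr0 ler_wpM2l.
Qed.

End running_integral.

Section vector_paths.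
Context {R : realType}.

Lemma within_continuous_in (U V W : topologicalType) (A : set V) (f : V -> W)
  (g : U -> V) : {within A, continuous f} -> continuous g ->
  (forall x, A (g x)) -> continuous (f \o g).
Proof.
move=> /subspace_continuousP cf cg gA x.
apply: cvg_comp (cf _ (gA x)) => //.
move=> V' h; have := cg x _ h; rewrite /nbhs/= => h'.
by apply: (@filterS U (nbhs x) _ _ _ _ h') => y /=; apply.
Qed.

Lemma cvg_row (I : Type) (G : set_system I) (FG : Filter G) k
    (x : I -> 'rV[R]_k) (y : 'rV[R]_k) :
  (forall j, x i ord0 j @[i --> G] --> y ord0 j) -> x i @[i --> G] --> y.
Proof.
move=> h; apply/cvg_ballP => e e0.
have : \forall i \near G, forall j, ball (y ord0 j) e (x i ord0 j).
  by apply: filter_forall => j; have /cvg_ballP := h j; exact.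
by apply: filterS => i hi; split=> // a b; rewrite (ord1 a).
Qed.

(** With the coordinates rounded to multiples of 1/(n+1), g takes one value per integer vector, on a
    measurable cell; there are countably many cells, and continuity of g gives the limit. *)
Lemma measurable_row_comp d (U : measurableType d) k (g : 'rV[R]_k -> R)
    (x : U -> 'rV[R]_k) : continuous g ->
  (forall j, measurable_fun setT (fun u => x u ord0 j)) ->
  measurable_fun setT (fun u => g (x u)).
Proof.
move=> cg mx.
pose h n u := g (\row_j ((Num.floor (n.+1%:R * x u ord0 j))%:~R / n.+1%:R)).
apply: (@measurable_fun_cvg _ _ _ _ h) => [n|u _]; last first.
  apply: (@cvg_comp _ _ _
    (fun n : nat => \row_j ((Num.floor (n.+1%:R * x u ord0 j))%:~R / n.+1%:R) : 'rV[R]_k)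
    g \oo (nbhs (x u)) (nbhs (g (x u)))); last exact: (cg (x u)).
  apply: cvg_row => j; under eq_fun do rewrite mxE; exact: cvg_floor_grid.
move=> _ V mV; rewrite setTI.
rewrite (_ : _ @^-1` V = \bigcup_(z : 'rV[int]_k)
    ([set u | V (g (\row_j ((z ord0 j)%:~R / n.+1%:R)))] `&`
    \bigcap_(j in [set: 'I_k]) ([set u | (z ord0 j)%:~R <= n.+1%:R * x u ord0 j] `&`
      [set u | n.+1%:R * x u ord0 j < (z ord0 j + 1)%:~R]))); last first.
  apply/seteqP; split=> u /=.
    move=> Vu; exists (\row_j Num.floor (n.+1%:R * x u ord0 j)) => //.
    split=> /=.
      move: Vu; rewrite /h; congr (V (g _)).
      by apply/rowP => j; rewrite !mxE.
    move=> j _ /=; rewrite mxE.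
    by have /andP[] := floor_itv (n.+1%:R * x u ord0 j).
  move=> [z _ [Vz zu]]; rewrite /h.
  rewrite (_ : \row_j _ = \row_j ((z ord0 j)%:~R / n.+1%:R))//.
  apply/rowP => j; rewrite !mxE; congr (_%:~R / _); apply: floor_def.
  by have [/= -> ->] := zu j I.
apply: countable_bigcupT_measurable => [|z]; first exact: countableP.
apply: measurableI.
  have [h1|h1] := pselect (V (g (\row_j ((z ord0 j)%:~R / n.+1%:R)))).
    by rewrite (_ : [set _ | _] = setT); [|apply/seteqP; split].
  by rewrite (_ : [set _ | _] = set0); [|apply/seteqP; split].
apply: fin_bigcap_measurable => // j _.
have mxj : measurable_fun setT (fun u => n.+1%:R * x u ord0 j).
  by apply: measurable_funM => //; exact: mx.
by apply: measurableI; [exact: measurable_setle|exact: measurable_setlt].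
Qed.

End vector_paths.

Section switch_max_properties.
Context {R : realType} {disp : measure_display} {Omega : measurableType disp}.
Variables (P : probability Omega R) (T : R) (F : R -> set (set Omega)) (q : nat).
Hypothesis hq : (2 <= q)%N.
Variables (l : 'I_q -> 'I_q -> R -> Omega -> R) (Y : 'I_q -> R -> Omega -> R).
Local Notation S := (switch_max l Y).

Definition other_mode (i : 'I_q) : 'I_q :=
  if i == mode1 hq then Ordinal hq else mode1 hq.

Lemma other_modeP i : other_mode i != i.
Proof.
by rewrite /other_mode; case: (eqVneq i (mode1 hq)) => [->|]; [|rewrite eq_sym].
Qed.

(** The seed is itself one of the terms with j <> i, so this real-valued maximum runs over exactly
    those modes. *)
Definition switch_bigmax i t w :=
  \big[Num.max/- l i (other_mode i) t w + Y (other_mode i) t w]_(j < q | j != i)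
    (- l i j t w + Y j t w).

Lemma switch_bigmax_attained i t w : exists j, j != i /\
  switch_bigmax i t w = - l i j t w + Y j t w.
Proof.
rewrite /switch_bigmax.
apply: (big_ind (fun v => exists j, j != i /\ v = - l i j t w + Y j t w)).
- by exists (other_mode i); rewrite other_modeP.
- move=> _ _ [j [ji ->]] [j' [j'i ->]].
  by rewrite /Num.max; case: ifP => _; [exists j'|exists j].
- by move=> j ji; exists j.
Qed.

Lemma switch_maxE i t w : S i t w = switch_bigmax i t w.
Proof.
rewrite /switch_max (_ : (\big[maxe/-oo]_(_ < _ | _) _)%E = (switch_bigmax i t w)%:E)//.
apply/eqP; rewrite eq_le; apply/andP; split.
  apply: bigmax_le => [|j ji]; first exact: leNye.
  by rewrite lee_fin; exact: le_bigmax_cond.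
have [j [ji ->]] := switch_bigmax_attained i t w.
exact: (@le_bigmax_cond _ _ _ _ j (fun j => j != i)
  (fun j => (- l i j t w + Y j t w)%:E)).
Qed.

Lemma switch_max_attained i t w : exists j, j != i /\
  S i t w = - l i j t w + Y j t w.
Proof. by rewrite switch_maxE; exact: switch_bigmax_attained. Qed.

Lemma le_switch_max i j t w : j != i -> - l i j t w + Y j t w <= S i t w.
Proof. by move=> ji; rewrite switch_maxE; exact: le_bigmax_cond. Qed.

Let switch_max_ind (Q : (R -> Omega -> R) -> Prop) i :
  (forall N N', Q N -> Q N' -> Q (fun t w => Num.max (N t w) (N' t w))) ->
  (forall j, i != j -> Q (fun t w => - l i j t w + Y j t w)) -> Q (S i).
Proof.
move=> Qmax Q1.
rewrite (_ : S i = switch_bigmax i); last first.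
  by apply/funext => t; apply/funext => w; exact: switch_maxE.
rewrite /switch_bigmax; elim: (index_enum _) => [|j r IH].
  rewrite (_ : (fun _ => _) = fun t w =>
      - l i (other_mode i) t w + Y (other_mode i) t w).
    by apply: Q1; rewrite eq_sym other_modeP.
  by apply/funext => t; apply/funext => w; rewrite big_nil.
have [ji|/negbTE ji] := boolP (j != i).
  rewrite (_ : (fun _ => _) = fun t w => Num.max (- l i j t w + Y j t w)
      (\big[Num.max/- l i (other_mode i) t w + Y (other_mode i) t w]_(j <- r | j != i)
        (- l i j t w + Y j t w))).
    by apply: Qmax => //; apply: Q1; rewrite eq_sym.
  by apply/funext => t; apply/funext => w; rewrite big_cons ji.
rewrite (_ : (fun _ => _) = fun t w =>
      (\big[Num.max/- l i (other_mode i) t w + Y (other_mode i) t w]_(j <- r | j != i)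
        (- l i j t w + Y j t w)))//.
by apply/funext => t; apply/funext => w; rewrite big_cons ji.
Qed.

Lemma switch_max_good i : (forall j, i != j -> good P T (l i j)) ->
  (forall j, good P T (Y j)) -> good P T (S i).
Proof.
move=> gl gY; apply: switch_max_ind; first exact: good_max.
by move=> j ij; apply: goodD => //; apply: goodN; exact: gl.
Qed.

Lemma switch_max_adapted i : (forall j, i != j -> adapted T F (l i j)) ->
  (forall j, adapted T F (Y j)) -> adapted T F (S i).
Proof.
move=> al aY; apply: switch_max_ind; first by move=> *; apply: adapted_max.
by move=> j ij; apply: adaptedD => //; apply: adaptedN => //; exact: al.
Qed.

End switch_max_properties.

Section payoff_properties.
Context {R : realType} {disp : measure_display} {Omega : measurableType disp}.
Variables (P : probability Omega R) (T : R) (q k : nat).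
Hypothesis hT : 0 < T.
Variables (X : R -> Omega -> 'rV[R]_k) (psi : 'I_q -> R -> 'rV[R]_k -> R).
Hypothesis gX : forall j, good P T (fun t w => X t w ord0 j).
Hypothesis psi_cont : forall i : 'I_q,
    {within `[0, T] `*` [set: 'rV[R]_k],
      continuous (fun z : R * 'rV[R]_k => psi i z.1 z.2)}.
Hypothesis psi_growth : forall i : 'I_q, exists C : R,
    forall t (x : 'rV[R]_k), 0 <= t <= T -> `|psi i t x| <= C * (1 + `|x|).
Let hT0 : 0 <= T := ltW hT.

Definition payoff i (s : R) w := psi i s (X s w).

Lemma payoff_cpath i : cpath T (payoff i).
Proof.
move=> w.
have cX : continuous (fun s => X (clip 0 T s) w).
  by move=> s; apply: cvg_row => j; exact: ((gX j).1.1 w s).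
pose g (s : R) : R * 'rV[R]_k := (clip 0 T s, X (clip 0 T s) w).
have cg : continuous g.
  by move=> s; exact: (cvg_pair (@clip_continuous R 0 T s) (cX s)).
have gA s : (`[0, T]%classic `*` [set: 'rV[R]_k]) (g s).
  by split=> //=; rewrite in_itv/= clip_itv.
exact: (within_continuous_in (@psi_cont i) cg gA).
Qed.

Lemma payoff_measurable i s : 0 <= s <= T -> measurable_fun setT (payoff i s).
Proof.
move=> sT; apply: (measurable_row_comp (g := psi i s)); last first.
  by move=> j; exact: ((gX j).1.2 s sT).
pose g (x : 'rV[R]_k) : R * 'rV[R]_k := (s, x).
have cg : continuous g.
  by move=> x; exact: (cvg_pair (cvg_cst s) (@cvg_id _ (nbhs x))).
have gA x : (`[0, T]%classic `*` [set: 'rV[R]_k]) (g x).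
  by split=> //=; rewrite in_itv.
exact: (within_continuous_in (@psi_cont i) cg gA).
Qed.

Lemma rV_norm_le_sum (x : 'rV[R]_k) : `|x| <= \sum_j `|x ord0 j|.
Proof.
rewrite [leLHS]/Num.norm /= mx_normrE; apply: bigmax_le => [|[a j] _].
  by apply: sumr_ge0.
by rewrite (ord1 a)/= (bigD1 j)//= lerDl sumr_ge0.
Qed.

Lemma payoff_good i : good P T (payoff i).
Proof.
split; first split; first exact: payoff_cpath.
  by move=> s; exact: payoff_measurable.
have [C hC] := psi_growth i.
have /choice[G hG] : forall j : 'I_k, exists G : Omega -> R, L1 P G /\
    forall w t, 0 <= t <= T -> `|X t w ord0 j| <= G w.
  by move=> j; have [_ [G L1G XG]] := gX j; exists G.
exists (fun w => `|C| * (1 + \sum_j G j w)).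
  apply: L1Z; apply: L1D; first exact: L1_cst.
  by apply: L1_sum => j _; exact: (hG j).1.
move=> w t tT; apply: le_trans (hC t (X t w) tT) _.
apply: (@le_trans _ _ (`|C| * (1 + `|X t w|))).
  by apply: ler_wpM2r; [rewrite addr_ge0|exact: ler_norm].
apply: ler_wpM2l => //; rewrite lerD2l.
apply: le_trans (rV_norm_le_sum _) _.
by apply: ler_sum => j _; exact: (hG j).2.
Qed.

End payoff_properties.

Section snell_modes.
Context {R : realType} {disp : measure_display} {Omega : measurableType disp}.
Variables (P : probability Omega R) (T : R) (F : R -> set (set Omega)) (q k : nat).
Hypotheses (hT : 0 < T) (FF : is_filtration T F).
Variables (X : R -> Omega -> 'rV[R]_k) (psi : 'I_q -> R -> 'rV[R]_k -> R).
Variables (l : 'I_q -> 'I_q -> R -> Omega -> R) (Y : 'I_q -> R -> Omega -> R).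
Local Notation S := (switch_max l Y).
Local Notation f := (payoff X psi).
Hypotheses (gf : forall i, good P T (f i)) (gS : forall i, good P T (S i)).
Hypotheses (gY : forall i, good P T (Y i)).
Hypothesis Ysys : snell_system P T F X psi l Y.
Let hT0 : 0 <= T := ltW hT.

Let r i t (s : R) w : R :=
  (\int[lebesgue_measure]_(x in `[t, s]) f i x w)%R + S i s w * (s < T)%R%:R.

(** The integral from t to tau becomes a difference of values of one process, which can be sampled
    and optionally stopped. *)
Let rE i t tau : 0 <= t <= T -> stopping_from T F t tau ->
  (fun w => r i t (tau w) w) = stop_reward T (running (f i)) (S i) t tau.
Proof.
move=> /andP[t0 tT] [st tge]; apply/funext => w; rewrite /r /stop_reward.
congr (_ + _).
by rewrite (runningB w (good_cpath (gf i)) t0 (tge w))//; case/andP : (st.1 w).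
Qed.

Let r_L1 i t tau : 0 <= t <= T -> stopping_from T F t tau ->
  L1 P (fun w => r i t (tau w) w).
Proof.
move=> tT st; rewrite rE//; apply: (stop_reward_L1 hT FF) => //.
exact: running_good.
Qed.

Lemma snell_mode_ge i t tau A : 0 <= t <= T -> stopping_from T F t tau ->
  F t A -> Rintegral P A (stop_reward T (running (f i)) (S i) t tau) <=
           Rintegral P A (Y i t).
Proof.
move=> tT st FA; rewrite -rE//.
have rL1 := fun tau => @r_L1 i t tau tT.
have L1Y : L1 P (Y i t) by exact: (good_L1 hT0).
exact: (snell_ge (r := r i t) FF tT rL1 L1Y (Ysys i tT) st FA).
Qed.

Lemma snell_mode_approx i t e : 0 <= t <= T -> 0 < e ->
  exists tau, stopping_from T F t tau /\ Rintegral P setT (Y i t) <=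
    Rintegral P setT (stop_reward T (running (f i)) (S i) t tau) + e.
Proof.
move=> tT e0.
have L1Y : L1 P (Y i t) by exact: (good_L1 hT0).
have rL1 := fun tau => @r_L1 i t tau tT.
have [tau [st h]] :=
  snell_approx (r := r i t) hT0 FF tT rL1 L1Y (Ysys i tT) e0.
by exists tau; split=> //; rewrite -rE.
Qed.

End snell_modes.

Section stopped_sigma_algebra.
Context {R : realType} {disp : measure_display} {Omega : measurableType disp}.
Variables (T : R) (F : R -> set (set Omega)).
Hypothesis FF : is_filtration T F.

Lemma stopped_sigma_algebra tau : stopping_time T F tau ->
  sigma_algebra setT (stopped_sigma T F tau).
Proof.
move=> st; split.
- by move=> t tT; rewrite set0I; exact: (F_0 FF).
- move=> A hA t tT; rewrite (_ : _ `&` _ =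
      [set w | tau w <= t] `&` ~` (A `&` [set w | tau w <= t])).
    by apply: (F_I FF); [exact: st.2|apply: (F_C FF); exact: hA].
  apply/seteqP; split=> w /=; first by move=> [[_ nA] h]; split=> // -[].
  by move=> [h nA]; split=> //; split=> // Aw; apply: nA.
- move=> A hA t tT; rewrite setI_bigcupl.
  rewrite (F_measurableE FF); apply: bigcupT_measurable => n.
  by rewrite -(F_measurableE FF); exact: hA.
Qed.

Section measurable_events.
Variable tau : Omega -> R.
Hypothesis st : stopping_time T F tau.
Local Notation OmegaS := (g_sigma_algebraType (stopped_sigma T F tau)).

Lemma stopped_measurableE A :
  stopped_sigma T F tau A = measurable (A : set OmegaS).
Proof.
by rewrite /measurable/= sigma_algebra_id//; exact: stopped_sigma_algebra.
Qed.

End measurable_events.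

Lemma measurable_fin_preimage d (U : measurableType d) (I : finType) (x : U -> I) :
  (forall i, measurable (x @^-1` [set i])) -> forall A, measurable (x @^-1` A).
Proof.
move=> mx A; rewrite (_ : _ @^-1` A = \bigcup_(i in A) x @^-1` [set i]).
  by apply: fin_bigcup_measurable => // i _; exact: mx.
apply/seteqP; split=> u /=; first by move=> Au; exists (x u).
by move=> [i Ai /= ->].
Qed.

Lemma measurable_ffun_preimage d (U : measurableType d) (I J : finType)
    (x : U -> {ffun I -> J}) : (forall i j, measurable [set u | x u i = j]) ->
  forall A, measurable (x @^-1` A).
Proof.
move=> mx; apply: measurable_fin_preimage => b.
rewrite (_ : _ @^-1` _ = \bigcap_(i in [set: I]) [set u | x u i = b i]).
  by apply: fin_bigcap_measurable => // i _; exact: mx.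
apply/seteqP; split=> u /=; first by move=> xb i _ /=; rewrite xb.
by move=> h; apply/ffunP => i; exact: h.
Qed.

End stopped_sigma_algebra.

Section select.
Context {R : realType} {disp : measure_display} {Omega : measurableType disp}.
Variable P : probability Omega R.

Lemma L1_select (I : finType) (xi : Omega -> I) (g : I -> Omega -> R) :
  (forall i, measurable (xi @^-1` [set i])) -> (forall i, L1 P (g i)) ->
  L1 P (fun w => g (xi w) w).
Proof.
move=> mxi hg; rewrite (_ : (fun w => _) =
    fun w => \sum_i g i w * \1_(xi @^-1` [set i]) w).
  by apply: L1_sum => i _; exact: L1_indic.
apply/funext => w; rewrite (bigD1 (xi w))//= indicE mem_set// mulr1.
by rewrite big1 ?addr0// => i ixi; rewrite indicE memNset ?mulr0//= => /eqP; rewrite eq_sym (negbTE ixi).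
Qed.

Lemma Ex_select (I : finType) (xi : Omega -> I) (g : I -> Omega -> R) A :
  measurable A ->
  (forall i, measurable (xi @^-1` [set i])) -> (forall i, L1 P (g i)) ->
  Rintegral P A (fun w => g (xi w) w) =
  \sum_i Rintegral P (A `&` xi @^-1` [set i]) (g i).
Proof.
move=> mA mxi hg; rewrite (@Ex_fin _ _ _ _ _ xi)//.
- by apply: eq_bigr => i _; apply: eq_Rintegral => w /set_mem[_ /= ->].
- exact: L1_select.
- by move=> i; exact: measurableI.
Qed.

End select.

(** * Verification along a switching strategy *)

Section verification.
Context {R : realType} {disp : measure_display} {Omega : measurableType disp}.
Variables (P : probability Omega R) (T : R) (F : R -> set (set Omega)) (q k : nat).
Hypotheses (hq : (2 <= q)%N) (hT : 0 < T) (FF : is_filtration T F).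
Variables (X : R -> Omega -> 'rV[R]_k) (psi : 'I_q -> R -> 'rV[R]_k -> R).
Variables (l : 'I_q -> 'I_q -> R -> Omega -> R).
Hypothesis gf : forall i, good P T (payoff X psi i).
Hypothesis al : forall i j : 'I_q, i != j -> adapted T F (l i j).
Hypothesis gl : forall i j : 'I_q, i != j -> good P T (l i j).
Let hT0 : 0 <= T := ltW hT.
Local Notation Ex A f := (Rintegral P A f).
Local Notation Psi i := (running (payoff X psi i)).

Definition value_system (Y : 'I_q -> R -> Omega -> R) :=
  [/\ forall i, adapted T F (Y i), forall i, good P T (Y i) &
      snell_system P T F X psi l Y].

Let gPsi i : good P T (Psi i). Proof. exact: running_good. Qed.

Section value_system_properties.
Variable Y : 'I_q -> R -> Omega -> R.
Hypothesis VY : value_system Y.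
Local Notation S i := (switch_max l Y i).

Let aY i : adapted T F (Y i). Proof. by case: VY. Qed.
Let gY i : good P T (Y i). Proof. by case: VY. Qed.
Let aS i : adapted T F (S i).
Proof. by apply: switch_max_adapted => // j ij; exact: al. Qed.
Let gS i : good P T (S i).
Proof. by apply: switch_max_good => // j ij; exact: gl. Qed.
Let Ysys : snell_system P T F X psi l Y. Proof. by case: VY. Qed.

Let Yge i := fun t tau A => @snell_mode_ge _ _ _ P T F q k hT FF X psi l Y gf gS gY Ysys i t tau A.
Let Yapp i := fun t e => @snell_mode_approx _ _ _ P T F q k hT FF X psi l Y gf gS gY Ysys i t e.

Lemma value_terminal : {ae P, forall w, forall i, Y i T w = 0}.
Proof.
have h i : {ae P, forall w, Y i T w = 0}.
  exact: (terminal_zero hT FF (aY i) (gY i) (@Yge i) (@Yapp i)).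
exact: filter_forall h.
Qed.

Lemma value_obstacle : {ae P, forall w, forall i t, 0 <= t <= T ->
  S i t w <= Y i t w}.
Proof.
have h i : {ae P, forall w, forall t, 0 <= t <= T -> S i t w <= Y i t w}.
  exact: (obstacle_le hT FF (aY i) (aS i) (gY i) (gS i) (@Yge i)).
exact: filter_forall h.
Qed.

Lemma value_supermart i (sigma tau : Omega -> R) A : stopping_time T F sigma ->
  stopping_time T F tau -> (forall w, sigma w <= tau w) ->
  stopped_sigma T F sigma A ->
  Ex A (fun w => Y i (tau w) w + Psi i (tau w) w) <=
  Ex A (fun w => Y i (sigma w) w + Psi i (sigma w) w).
Proof.
exact: (supermart hT FF (gY i) (gPsi i) (gS i) (@Yge i) (@Yapp i)).
Qed.

Lemma value_hit i (sigma : Omega -> R) A : stopping_time T F sigma ->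
  stopped_sigma T F sigma A ->
  Ex A (fun w => Y i (sigma w) w + Psi i (sigma w) w) =
  Ex A (fun w => Y i (hit T (Y i) (S i) (sigma w) w) w +
                 Psi i (hit T (Y i) (S i) (sigma w) w) w).
Proof.
exact: (hit_opt hT FF (aY i) (aS i) (gY i) (gPsi i) (gS i) (@Yge i) (@Yapp i)).
Qed.

End value_system_properties.

(** A switching strategy whose starting time and mode are free, as uniqueness compares solutions
    from every t and i. Reaching T is not part of it: for optimal chains it is proved. *)
Record chain (tau : nat -> Omega -> R) (xi : nat -> Omega -> 'I_q) : Prop := Chain {
  chain_stopping : forall n, stopping_time T F (tau n);
  chain_le : forall n w, tau n w <= tau n.+1 w;
  chain_mode : forall n (A : set 'I_q), stopped_sigma T F (tau n) (xi n @^-1` A);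
  chain_neq : {ae P, forall w, forall n, xi n w != xi n.+1 w} }.

(* l i i is unconstrained, hence may be non-measurable *)
Definition cost_process (i j : 'I_q) (t : R) (w : Omega) : R :=
  if i == j then 0 else l i j t w.

Lemma cost_process_good i j : good P T (cost_process i j).
Proof.
have [<-|ij] := eqVneq i j; last first.
  rewrite (_ : cost_process i j = l i j); first exact: gl.
  by apply/funext => t; apply/funext => w; rewrite /cost_process (negbTE ij).
rewrite (_ : cost_process i i = cst (cst 0)).
  split; first by split=> [w s|s sT]; [exact: cvg_cst|exact: measurable_cst].
  exists (cst 0); first exact: L1_cst.
  by move=> w t _; rewrite normr0.
by apply/funext => t; apply/funext => w; rewrite /cost_process eqxx.
Qed.

Section chains.
Variables (tau : nat -> Omega -> R) (xi : nat -> Omega -> 'I_q).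
Hypothesis ch : chain tau xi.

Definition chain_gain n w := Psi (xi n w) (tau n.+1 w) w - Psi (xi n w) (tau n w) w.

Definition chain_cost n w :=
  cost_process (xi n w) (xi n.+1 w) (tau n.+1 w) w * (tau n.+1 w < T)%R%:R.

Let st n := chain_stopping ch n.
Let tauT n := (st n).1.

Lemma chain_tau_measurable n : measurable_fun setT (tau n).
Proof. exact: (stopping_measurable hT0 FF). Qed.

Lemma chain_mode_measurable n A : measurable (xi n @^-1` A).
Proof. exact: (stopped_measurable hT0 FF (st n) (chain_mode ch n A)). Qed.

Lemma chain_tau_mono m n w : (m <= n)%N -> tau m w <= tau n w.
Proof.
elim: n => [|n IH]; first by rewrite leqn0 => /eqP ->.
rewrite leq_eqVlt ltnS => /predU1P[->//|/IH/le_trans]; apply.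
exact: (chain_le ch).
Qed.

Lemma chain_stopped A n : stopped_sigma T F (tau 0) A ->
  stopped_sigma T F (tau n) A.
Proof. by apply: (stopped_mono FF (st n)) => w; exact: chain_tau_mono. Qed.

Lemma chain_select_L1 (N : 'I_q -> R -> Omega -> R) m n :
  (forall i, good P T (N i)) -> L1 P (fun w => N (xi m w) (tau n w) w).
Proof.
move=> gN; apply: (L1_select (xi := xi m) (g := fun i w => N i (tau n w) w)).
  by move=> i; exact: chain_mode_measurable.
by move=> i; apply: (good_sample hT0) => //; exact: chain_tau_measurable.
Qed.

Lemma chain_gain_L1 n : L1 P (chain_gain n).
Proof. by apply: L1B; exact: (chain_select_L1 _ _ gPsi). Qed.

Lemma chain_cost_L1 n : L1 P (chain_cost n).
Proof.
apply: (L1_select (xi := fun w => (xi n w, xi n.+1 w)) (g := fun ij w =>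
  cost_process ij.1 ij.2 (tau n.+1 w) w * (tau n.+1 w < T)%R%:R)) => [[i j]|[i j]].
  rewrite (_ : _ @^-1` _ = xi n @^-1` [set i] `&` xi n.+1 @^-1` [set j]).
    by apply: measurableI; exact: chain_mode_measurable.
  by apply/seteqP; split=> w /= [-> ->].
apply: (L1_alive hT); [exact: cost_process_good|exact: chain_tau_measurable|].
exact: tauT.
Qed.

Section chain_value.
Variable Y : 'I_q -> R -> Omega -> R.
Hypothesis VY : value_system Y.

Definition chain_value n w := Y (xi n w) (tau n w) w.

Let gY i : good P T (Y i). Proof. by case: VY. Qed.

Lemma chain_value_L1 n : L1 P (chain_value n).
Proof. exact: chain_select_L1. Qed.

Definition chain_optimal :=
  (forall n w, tau n.+1 w =
     hit T (Y (xi n w)) (switch_max l Y (xi n w)) (tau n w) w) /\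
  {ae P, forall w, forall n, switch_max l Y (xi n w) (tau n.+1 w) w =
     - l (xi n w) (xi n.+1 w) (tau n.+1 w) w + Y (xi n.+1 w) (tau n.+1 w) w}.

Let ExM_select A m n : measurable A ->
  Ex A (fun w => Y (xi m w) (tau n w) w + Psi (xi m w) (tau n w) w) =
  \sum_i Ex (A `&` xi m @^-1` [set i])
     (fun w => Y i (tau n w) w + Psi i (tau n w) w).
Proof.
move=> mA; apply: (Ex_select (xi := xi m)
  (g := fun i w => Y i (tau n w) w + Psi i (tau n w) w)) => //.
  by move=> i; exact: chain_mode_measurable.
move=> i; apply: (@good_sample _ _ _ P T hT0 (fun t w => Y i t w + Psi i t w)).
- exact: goodD.
- exact: chain_tau_measurable.
- exact: tauT.
Qed.

Let L1Yn m n : L1 P (fun w => Y (xi m w) (tau n w) w).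
Proof. exact: chain_select_L1. Qed.

Let L1Psin m n : L1 P (fun w => Psi (xi m w) (tau n w) w).
Proof. exact: (chain_select_L1 m n gPsi). Qed.

Let step_split A n : measurable A ->
  Ex A (fun w => Y (xi n w) (tau n.+1 w) w + Psi (xi n w) (tau n.+1 w) w) -
  Ex A (fun w => Y (xi n w) (tau n w) w + Psi (xi n w) (tau n w) w) =
  Ex A (fun w => Y (xi n w) (tau n.+1 w) w) + Ex A (chain_gain n) -
  Ex A (chain_value n).
Proof.
move=> mA.
have -> : Ex A (chain_gain n) = Ex A (fun w => Psi (xi n w) (tau n.+1 w) w) -
    Ex A (fun w => Psi (xi n w) (tau n w) w) by exact: ExB.
rewrite (ExD mA (L1Yn n n.+1) (L1Psin n n.+1)) (ExD mA (L1Yn n n) (L1Psin n n)).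
have e (a b c d : R) : a + b - (c + d) = a + (b - d) - c by ring.
exact: e.
Qed.

(** The current mode is known at tau_n. Splitting A according to it reduces the claim to the
    supermartingale property of each fixed mode between tau_n and tau_(n+1). *)
Lemma chain_step A n : stopped_sigma T F (tau n) A ->
  Ex A (fun w => Y (xi n w) (tau n.+1 w) w) + Ex A (chain_gain n) <=
  Ex A (chain_value n).
Proof.
move=> FA; have mA := stopped_measurable hT0 FF (st n) FA.
rewrite -subr_le0 -(step_split n mA) subr_le0.
rewrite (ExM_select n n.+1 mA) (ExM_select n n mA).
apply: ler_sum => i _; apply: value_supermart => //; first exact: (chain_le ch).
by apply: (stopped_I FF) => //; exact: (chain_mode ch).
Qed.

Lemma chain_step_optimal A n : chain_optimal -> stopped_sigma T F (tau n) A ->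
  Ex A (fun w => Y (xi n w) (tau n.+1 w) w) + Ex A (chain_gain n) =
  Ex A (chain_value n).
Proof.
move=> [opt _] FA; have mA := stopped_measurable hT0 FF (st n) FA.
apply/eqP; rewrite -subr_eq0 -(step_split n mA) subr_eq0; apply/eqP.
rewrite (ExM_select n n.+1 mA) (ExM_select n n mA).
apply: eq_bigr => i _.
have FAi : stopped_sigma T F (tau n) (A `&` xi n @^-1` [set i]).
  by apply: (stopped_I FF) => //; exact: (chain_mode ch).
rewrite [RHS](value_hit VY i (st n) FAi).
by apply: eq_Rintegral => w /set_mem[_ /= xii]; rewrite opt xii.
Qed.

(** Before T this is domination of the obstacle; at T no cost is charged and all the values
    vanish. *)
Lemma chain_switch : {ae P, forall w, forall n,
  - chain_cost n w + chain_value n.+1 w <= Y (xi n w) (tau n.+1 w) w}.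
Proof.
apply: filterS3 (chain_neq ch) (value_terminal VY) (value_obstacle VY).
move=> w neq YT SY n; rewrite /chain_cost /cost_process (negbTE (neq n)).
rewrite /chain_value.
have [_|Tn] := ltP (tau n.+1 w) T.
  rewrite mulr1; apply: le_trans (SY _ _ (tauT n.+1 w)).
  by apply: (le_switch_max hq); rewrite eq_sym.
have -> : tau n.+1 w = T.
  by apply/eqP; rewrite eq_le Tn andbT; case/andP : (tauT n.+1 w).
by rewrite mulr0 oppr0 add0r !YT.
Qed.

Lemma chain_switch_optimal : chain_optimal -> {ae P, forall w, forall n,
  - chain_cost n w + chain_value n.+1 w = Y (xi n w) (tau n.+1 w) w}.
Proof.
move=> [opt sw]; have [aY _ _] := VY.
have aS i : adapted T F (switch_max l Y i).
  by apply: switch_max_adapted => // j ij; exact: al.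
apply: filterS3 (chain_neq ch) (value_terminal VY) sw.
move=> w neq YT sw n; rewrite /chain_cost /cost_process (negbTE (neq n)).
rewrite /chain_value.
have [nT|Tn] := ltP (tau n.+1 w) T.
  rewrite mulr1 -sw; have /andP[h0 hT'] := tauT n w.
  rewrite opt; apply/esym; apply: (hit_eq (aY _) (aS _)) => //.
  by rewrite -opt.
have -> : tau n.+1 w = T.
  by apply/eqP; rewrite eq_le Tn andbT; case/andP : (tauT n.+1 w).
by rewrite mulr0 oppr0 add0r !YT.
Qed.

(** Each round first lets time run in a fixed mode ([chain_step]), then changes the mode at a fixed
    time ([chain_switch]). *)
Lemma chain_verif A n : stopped_sigma T F (tau 0) A ->
  \sum_(m < n) (Ex A (chain_gain m) - Ex A (chain_cost m)) +
    Ex A (chain_value n) <= Ex A (chain_value 0).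
Proof.
move=> FA; elim: n => [|n IH]; first by rewrite big_ord0 add0r.
apply: le_trans IH; rewrite big_ord_recr/= -addrA lerD2l.
have FAn := chain_stopped n FA.
have mA := stopped_measurable hT0 FF (st n) FAn.
have := chain_step FAn.
have : Ex A (fun w => - chain_cost n w + chain_value n.+1 w) <=
    Ex A (fun w => Y (xi n w) (tau n.+1 w) w).
  apply: le_Ex_ae => //.
    by apply: L1D; [apply: L1N; exact: chain_cost_L1|exact: chain_value_L1].
  by apply: filterS chain_switch => w h _; exact: h.
rewrite (ExD mA (L1N (chain_cost_L1 n)) (chain_value_L1 n.+1)).
rewrite (ExN mA (chain_cost_L1 n)).
lra.
Qed.

Lemma chain_verif_optimal A n : chain_optimal -> stopped_sigma T F (tau 0) A ->
  \sum_(m < n) (Ex A (chain_gain m) - Ex A (chain_cost m)) +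
    Ex A (chain_value n) = Ex A (chain_value 0).
Proof.
move=> opt FA; elim: n => [|n IH]; first by rewrite big_ord0 add0r.
rewrite -IH; rewrite big_ord_recr/= -addrA; congr (_ + _).
have FAn := chain_stopped n FA.
have mA := stopped_measurable hT0 FF (st n) FAn.
have <- := chain_step_optimal opt FAn.
have <- : Ex A (fun w => - chain_cost n w + chain_value n.+1 w) =
    Ex A (fun w => Y (xi n w) (tau n.+1 w) w).
  apply: eq_Ex_ae => //.
    by apply: L1D; [apply: L1N; exact: chain_cost_L1|exact: chain_value_L1].
  by apply: filterS (chain_switch_optimal opt) => w h _; exact: h.
rewrite (ExD mA (L1N (chain_cost_L1 n)) (chain_value_L1 n.+1)).
rewrite (ExN mA (chain_cost_L1 n)).
ring.
Qed.

End chain_value.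
End chains.
End verification.

(** * Reaching the horizon, and limits along chains *)

Section chain_limits.
Context {R : realType} {disp : measure_display} {Omega : measurableType disp}.
Variables (P : probability Omega R) (T : R) (F : R -> set (set Omega)) (q k : nat).
Hypotheses (hq : (2 <= q)%N) (hT : 0 < T) (FF : is_filtration T F).
Variables (X : R -> Omega -> 'rV[R]_k) (psi : 'I_q -> R -> 'rV[R]_k -> R).
Variables (l : 'I_q -> 'I_q -> R -> Omega -> R).
Hypothesis gf : forall i, good P T (payoff X psi i).
Hypothesis al : forall i j : 'I_q, i != j -> adapted T F (l i j).
Hypothesis gl : forall i j : 'I_q, i != j -> good P T (l i j).
Let hT0 : 0 <= T := ltW hT.
Local Notation Ex A f := (Rintegral P A f).
Local Notation value_system := (value_system P T F X psi l).

Lemma family_bound (N : 'I_q -> R -> Omega -> R) : (forall i, good P T (N i)) ->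
  exists G : Omega -> R, L1 P G /\
    forall w i t, 0 <= t <= T -> `|N i t w| <= G w.
Proof.
move=> gN; have /choice[G hG] : forall i : 'I_q, exists G : Omega -> R, L1 P G /\
    forall w t, 0 <= t <= T -> `|N i t w| <= G w.
  by move=> i; have [_ [G L1G NG]] := gN i; exists G.
exists (fun w => \sum_i G i w); split; first by apply: L1_sum => i _; exact: (hG i).1.
move=> w i t tT; apply: le_trans ((hG i).2 w t tT) _.
rewrite (bigD1 i)//= lerDl; apply: sumr_ge0 => j _.
by apply: le_trans ((hG j).2 w t tT); exact: normr_ge0.
Qed.

Section chains.
Variables (tau : nat -> Omega -> R) (xi : nat -> Omega -> 'I_q).
Hypothesis ch : chain P T F tau xi.
Local Notation gain := (chain_gain X psi tau xi).
Local Notation cost := (chain_cost T l tau xi).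
Local Notation value Y := (chain_value tau xi Y).

Let st n := chain_stopping ch n.
Let tauT n := (st n).1.
Let mtau n := chain_tau_measurable hT FF ch n.

Lemma chain_gain_le (K : R) w n :
  (forall i s, 0 <= s <= T -> `|payoff X psi i s w| <= K) ->
  `|gain n w| <= K * (tau n.+1 w - tau n w).
Proof.
move=> hK; rewrite /chain_gain.
apply: (running_lipschitz hT (good_cpath (gf (xi n w)))).
- exact: hK.
- by case/andP : (tauT n w).
- exact: (chain_le ch).
- by case/andP : (tauT n.+1 w).
Qed.

Lemma chain_gain_sum_le (K : R) w m n : (m <= n)%N ->
  (forall i s, 0 <= s <= T -> `|payoff X psi i s w| <= K) ->
  `|\sum_(m <= j < n) gain j w| <= K * (tau n w - tau m w).
Proof.
move=> mn hK; rewrite -(telescope_sumr (fun j => tau j w) mn) mulr_sumr.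
apply: le_trans (ler_norm_sum _ _ _) _.
by apply: ler_sum => j _; exact: chain_gain_le.
Qed.

Definition reaches_T := {ae P, forall w, exists n, tau n w = T}.

Lemma tau_stay_T w n m : tau n w = T -> (n <= m)%N -> tau m w = T.
Proof.
move=> tn nm; apply/eqP; rewrite eq_le; apply/andP; split.
  by case/andP : (tauT m w).
by rewrite -tn; exact: (chain_tau_mono ch).
Qed.

(** Almost surely the value is Y_T = 0 from some rank on; the dominating variable is common to all
    modes. *)
Lemma chain_value_cvg0 Y A : value_system Y -> reaches_T -> measurable A ->
  Ex A (value Y n) @[n --> \oo] --> 0.
Proof.
move=> VY rT mA; have [_ gY _] := VY.
have [G [L1G YG]] := family_bound gY.
rewrite (_ : 0 = Ex A (cst 0)); last by rewrite Rintegral_cst// mul0r.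
apply: (@Ex_dominated _ _ _ P A (fun n => value Y n) (cst 0) G) => //.
- by move=> n; apply: L1_measurable (chain_value_L1 hT FF ch VY n).
- apply: filterS2 rT (value_terminal hq hT FF gf gl VY) => w [n tn] YT _.
  apply: cvg_near_cst; exists n => // m /= nm.
  by rewrite /chain_value (tau_stay_T tn nm) YT.
- by apply: aeW => w n; exact: YG.
Qed.

(* Along a Y-optimal chain, Y is the expected gain minus cost, while Y' dominates it. *)
Lemma chain_value_compare Y Y' A : value_system Y -> value_system Y' ->
  chain_optimal P T l tau xi Y -> reaches_T -> stopped_sigma T F (tau 0) A ->
  Ex A (value Y 0) <= Ex A (value Y' 0).
Proof.
move=> VY VY' opt rT FA; have mA := stopped_measurable hT0 FF (st 0) FA.
have cv : Ex A (value Y 0) + (Ex A (value Y' n) - Ex A (value Y n)) @[n --> \oo] -->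
    Ex A (value Y 0).
  rewrite -[X in _ --> X]addr0; apply: cvgD; first exact: cvg_cst.
  by rewrite -[X in _ --> X](subrr 0); apply: cvgB; exact: chain_value_cvg0.
apply: ler_cvg_to cv (cvg_cst _) _; apply: nearW => n.
have := chain_verif hq hT FF gf al gl ch VY' n FA.
have := chain_verif_optimal hq hT FF gf al gl ch VY n opt FA.
move=> <-; lra.
Qed.

Lemma optimal_cost_le Y : value_system Y -> chain_optimal P T l tau xi Y ->
  exists C : R, forall n, \sum_(m < n) Ex setT (cost m) <= C.
Proof.
move=> VY opt; have [_ gY _] := VY.
have [G [L1G YG]] := family_bound gY.
have [K [L1K fK]] := family_bound gf.
(* In the verification identity, the gains telescope to at most T K, and G bounds the value at stage
   n and at stage 0. *)
exists (Ex setT (fun w => T * K w) + Ex setT G + Ex setT G) => n.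
have FT : stopped_sigma T F (tau 0) setT by move=> t tT; rewrite setTI; exact: (st 0).2.
have := chain_verif_optimal hq hT FF gf al gl ch VY n opt FT.
rewrite sumrB => e.
have value_G m : `|Ex setT (value Y m)| <= Ex setT G.
  have L1v := chain_value_L1 hT FF ch VY m.
  apply: le_trans (le_normr_Rintegral measurableT L1v) _.
  apply: le_Rintegral => //; first exact: L1_norm.
  by move=> w _; exact: YG.
have gain_K : \sum_(m < n) Ex setT (gain m) <= Ex setT (fun w => T * K w).
  rewrite -Ex_sum//; last by move=> m _; exact: (chain_gain_L1 hT FF gf ch).
  apply: le_Rintegral => //.
  - by apply: L1_sum => m _; exact: (chain_gain_L1 hT FF gf ch).
  - exact: L1Z.
  move=> w _; rewrite -(big_mkord xpredT (fun m => gain m w)).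
  apply: le_trans (ler_norm _) _.
  apply: le_trans (chain_gain_sum_le (leq0n n) (fK w)) _.
  have K0 : 0 <= K w by apply: le_trans (fK w (xi 0%N w) 0 _); rewrite ?lexx.
  rewrite mulrC; apply: ler_wpM2r => //.
  have /andP[h1 h2] := tauT n w; have /andP[h3 h4] := tauT 0%N w.
  lra.
have := value_G n; have := value_G 0%N; rewrite !ler_norml => /andP[h1 h2] /andP[h3 h4].
lra.
Qed.

Variable gamma : R.
Hypothesis gamma0 : 0 < gamma.
Hypothesis l_gamma : {ae P, forall w, forall t, 0 <= t <= T ->
    forall i j : 'I_q, i != j -> gamma <= l i j t w}.

Lemma chain_cost_ge : {ae P, forall w, forall n,
  gamma * (tau n.+1 w < T)%R%:R <= cost n w}.
Proof.
apply: filterS2 (chain_neq ch) l_gamma => w neq lg n.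
rewrite /chain_cost /cost_process (negbTE (neq n)).
by apply: ler_wpM2r => //; exact: lg.
Qed.

Lemma measurable_before_T : measurable [set w | forall n, tau n w < T].
Proof.
rewrite (_ : [set w | _] = \bigcap_n [set w | tau n w < T]).
  apply: bigcapT_measurable => n; apply: measurable_setlt => //; exact: mtau.
by apply/seteqP; split=> w h n; [move=> _|]; exact: h.
Qed.

(* If T is not reached with probability c > 0, the first n switches cost at least
   n gamma c in expectation. *)
Lemma optimal_finite Y : value_system Y -> chain_optimal P T l tau xi Y ->
  P [set w | forall n, tau n w < T] = 0%E.
Proof.
move=> VY opt; have [C hC] := optimal_cost_le VY opt.
set B := [set w | _]; have mB : measurable B by exact: measurable_before_T.
have L1B : L1 P (fun w => gamma * \1_B w).
  by apply: L1Z; exact: integrable_indic.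
have hB n : n%:R * Ex setT (fun w => gamma * \1_B w) <= C.
  apply: le_trans (hC n).
  rewrite mulr_natl -[n in _ *+ n]card_ord -sumr_const.
  apply: ler_sum => m _; apply: le_Ex_ae => //.
    exact: (chain_cost_L1 hT FF gl ch).
  apply: filterS chain_cost_ge => w h _; apply: le_trans (h m).
  apply: ler_wpM2l; first exact: ltW.
  rewrite indicE; have [/set_mem Bw|_] := boolP (w \in B).
    by rewrite Bw.
  by rewrite ler0n.
have E0 : Ex setT (fun w => gamma * \1_B w) <= 0.
  rewrite leNgt; apply/negP => E0.
  have := hB (Num.truncn (C / Ex setT (fun w => gamma * \1_B w))).+1.
  apply/negP; rewrite -ltNge -ltr_pdivrMr//.
  exact: truncnS_gt.
have E1 : Ex setT (fun w => gamma * \1_B w) = gamma * fine (P B).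
  rewrite RintegralZl//; last exact: integrable_indic.
  by congr (_ * _); rewrite /Rintegral integral_indic// setIT.
move: E0; rewrite E1 pmulr_rle0// => P0.
apply/eqP; rewrite -[P B]fineK ?fin_num_measure//.
by rewrite eqe eq_le P0 fine_ge0.
Qed.

Lemma reaches_T_null : reaches_T <-> P [set w | forall n, tau n w < T] = 0%E.
Proof.
have mB := measurable_before_T.
rewrite -(negligibleP _ mB); split.
  move=> [N [mN N0 hN]]; exists N; split=> // w /= h; apply: hN => /= -[n tn].
  by have := h n; rewrite tn ltxx.
move=> [N [mN N0 hN]]; exists N; split=> // w /= h; apply: hN => /= n.
rewrite lt_neqAle; have /andP[_ ->] := tauT n w; rewrite andbT.
by apply/eqP => tn; apply: h; exists n.
Qed.

Lemma optimal_reaches_T Y : value_system Y -> chain_optimal P T l tau xi Y ->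
  reaches_T.
Proof. by move=> VY opt; apply/reaches_T_null; exact: (optimal_finite VY). Qed.

End chains.
End chain_limits.

(** * Total profit *)

Section integrable_union.
Context {R : realType} d {U : measurableType d} (mu : {measure set U -> \bar R}).

Lemma integrable_setU2 (A B : set U) (f : U -> \bar R) : measurable A ->
  measurable B -> [disjoint A & B] -> mu.-integrable A f ->
  mu.-integrable B f -> mu.-integrable (A `|` B) f.
Proof.
move=> mA mB AB /integrableP[mfA fA] /integrableP[mfB fB].
have mf : measurable_fun (A `|` B) f by apply/measurable_funU.
apply/integrableP; split=> //; rewrite ge0_integral_setU//.
  exact: lte_add_pinfty.
exact: measurableT_comp.
Qed.

End integrable_union.

Section profit.
Context {R : realType} {disp : measure_display} {Omega : measurableType disp}.
Variables (P : probability Omega R) (T : R) (F : R -> set (set Omega)) (q k : nat).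
Hypotheses (hq : (2 <= q)%N) (hT : 0 < T) (FF : is_filtration T F).
Variables (X : R -> Omega -> 'rV[R]_k) (psi : 'I_q -> R -> 'rV[R]_k -> R).
Variables (l : 'I_q -> 'I_q -> R -> Omega -> R).
Hypothesis gf : forall i, good P T (payoff X psi i).
Hypothesis al : forall i j : 'I_q, i != j -> adapted T F (l i j).
Hypothesis gl : forall i j : 'I_q, i != j -> good P T (l i j).
Let hT0 : 0 <= T := ltW hT.
Local Notation Ex A f := (Rintegral P A f).
Local Notation value_system := (value_system P T F X psi l).
Local Notation mu := (@lebesgue_measure R).

Variables (tau : nat -> Omega -> R) (xi : nat -> Omega -> 'I_q).
Hypothesis ch : chain P T F tau xi.
Hypothesis tau0 : forall w, tau 0%N w = 0.
Hypothesis rT : reaches_T P T tau.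
Variable gamma : R.
Hypothesis gamma0 : 0 < gamma.
Hypothesis l_gamma : {ae P, forall w, forall t, 0 <= t <= T ->
    forall i j : 'I_q, i != j -> gamma <= l i j t w}.
Local Notation gain := (chain_gain X psi tau xi).
Local Notation cost := (chain_cost T l tau xi).
Local Notation value Y := (chain_value tau xi Y).

Let st n := chain_stopping ch n.
Let tauT n := (st n).1.
Let mtau n := chain_tau_measurable hT FF ch n.

Definition controlled_payoff w (s : R) := payoff X psi (mode_indicator tau xi s w) s w.

Lemma mode_indicatorE n w s : tau n w < s <= tau n.+1 w ->
  mode_indicator tau xi s w = xi n w.
Proof.
move=> /andP[h1 h2]; rewrite /mode_indicator; congr (xi _ w).
apply: xget_unique; first by rewrite /= h1 h2.
move=> m /= /andP[h3 h4]; apply/eqP; rewrite eqn_leq; apply/andP; split.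
  rewrite leqNgt; apply/negP => nm.
  have := chain_tau_mono ch w nm; rewrite leNgt.
  by rewrite (lt_le_trans h3 h2).
rewrite leqNgt; apply/negP => mn.
have := chain_tau_mono ch w mn; rewrite leNgt.
by rewrite (lt_le_trans h1 h4).
Qed.

(** Induction over the intervals ]tau_n, tau_(n+1)], on which the mode is frozen. Integrability is
    carried along because the integrand is known only piecewise, and the additivity step requires
    it. *)
Lemma controlled_integral n w :
  mu.-integrable `[0, tau n w] (EFin \o controlled_payoff w) /\
  (\int[mu]_(s in `[0, tau n w]) controlled_payoff w s)%R =
  \sum_(m < n) gain m w.
Proof.
elim: n => [|n [int IH]].
  rewrite tau0 big_ord0 set_itv1 Rintegral_set1; split=> //.
  apply/integrableP; split; first exact: measurable_fun_set1.
  by rewrite integral_set1.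
have /andP[a0 aT] := tauT n w; have /andP[b0 bT] := tauT n.+1 w.
have ab := chain_le ch n w.
have eqf s : s \in `]tau n w, tau n.+1 w]%classic ->
    payoff X psi (xi n w) s w = controlled_payoff w s.
  by move=> /set_mem /=; rewrite in_itv/= /controlled_payoff => h; rewrite (mode_indicatorE h).
have int1 : mu.-integrable `]tau n w, tau n.+1 w] (EFin \o (payoff X psi (xi n w))^~ w).
  apply: (@integrableS _ _ _ mu `[tau n w, tau n.+1 w]%classic) => //.
    by apply: subset_itv; rewrite bnd_simp.
  exact: (path_integrable w (good_cpath (gf _)) a0 bT).
have int2 : mu.-integrable `]tau n w, tau n.+1 w] (EFin \o controlled_payoff w).
  by apply: eq_integrable int1 => // s hs /=; rewrite eqf.
have U : `[0, tau n.+1 w]%classic =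
    `[0, tau n w]%classic `|` `]tau n w, tau n.+1 w]%classic.
  by rewrite (@itv_bndbnd_setU _ _ _ (BRight (tau n w)))// bnd_simp.
have dis : [disjoint `[0, tau n w]%classic & `]tau n w, tau n.+1 w]%classic].
  apply/disj_setPS => s [/=]; rewrite !in_itv/= => /andP[_ h] /andP[h' _].
  by move: h'; rewrite ltNge h.
have intU : mu.-integrable `[0, tau n.+1 w] (EFin \o controlled_payoff w).
  by rewrite U; apply: integrable_setU2.
split=> //; rewrite big_ord_recr/= -IH U Rintegral_setU//; last by rewrite -U.
congr (_ + _).
rewrite -(@eq_Rintegral _ _ _ mu _ _ _ eqf) Rintegral_itv_obnd_cbnd//.
by rewrite /chain_gain (runningB w (good_cpath (gf _)) a0 ab bT).
Qed.

(** What is collected after tau_n is at most K times the remaining time. K is quantified inside the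
    almost sure event so that it may depend on w. *)
Lemma controlled_total : {ae P, forall w, forall (K : R) n,
  (forall i s, 0 <= s <= T -> `|payoff X psi i s w| <= K) ->
  `|(\int[mu]_(s in `[0%R, T]) controlled_payoff w s)%R - \sum_(m < n) gain m w|
  <= K * (T - tau n w)}.
Proof.
apply: filterS rT => w [N tN] K n hK.
have tM : tau (maxn n N) w = T by apply: (tau_stay_T ch tN); exact: leq_maxr.
rewrite -tM (controlled_integral _ w).2 -!(big_mkord xpredT (fun m => gain m w)).
rewrite (big_cat_nat (n := n) (p := maxn n N))//=; last exact: leq_maxl.
by rewrite [_ + _ - _]addrAC subrr add0r; apply: (chain_gain_sum_le hT gf ch) => //; exact: leq_maxl.
Qed.

Let chain_cost_ae : {ae P, forall w, forall n, 0 <= cost n w /\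
  l (xi n w) (xi n.+1 w) (tau n.+1 w) w * (tau n.+1 w < T)%R%:R = cost n w}.
Proof.
apply: filterS2 (chain_neq ch) (chain_cost_ge ch l_gamma) => w neq cg n; split.
  by apply: le_trans (cg n); apply: mulr_ge0; [exact: ltW|exact: ler0n].
by rewrite /chain_cost /cost_process (negbTE (neq n)).
Qed.

Section bounds.
Variable K : Omega -> R.
Hypotheses (L1K : L1 P K).
Hypothesis fK : forall w i t, 0 <= t <= T -> `|payoff X psi i t w| <= K w.

(** A bound for the running payoff still to come after the n-th switch. *)
Let slack n w := K w * (T - tau n w).

Let K0 w : 0 <= K w.
Proof. by apply: le_trans (fK w (xi 0%N w) (t := 0) _); rewrite ?lexx. Qed.

Let slack_bound n w : `|slack n w| <= T * K w.
Proof.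
have /andP[h1 h2] := tauT n w.
rewrite normrM (ger0_norm (K0 w)) ger0_norm ?subr_ge0// mulrC.
by apply: ler_wpM2r => //; lra.
Qed.

Let slack_L1 n : L1 P (slack n).
Proof.
apply: (L1_le _ (L1Z T L1K)); last exact: slack_bound.
apply: measurable_funM; first exact: L1_measurable L1K.
by apply: measurable_funB => //; exact: mtau.
Qed.

Let slack_cvg0 : Ex setT (slack n) @[n --> \oo] --> 0.
Proof.
rewrite (_ : 0 = Ex setT (cst 0)); last by rewrite Rintegral_cst// mul0r.
apply: (@Ex_dominated _ _ _ P setT slack (cst 0) (fun w => T * K w)) => //.
- by move=> n; apply: L1_measurable (slack_L1 n).
- apply: filterS rT => w [n tn] _; apply: cvg_near_cst; exists n => // m /= nm.
  by rewrite /slack (tau_stay_T ch tn nm) subrr mulr0.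
- exact: L1Z.
- by apply: aeW => w n; exact: slack_bound.
Qed.

Let gainsum n w := \sum_(m < n) gain m w.
Let costsum n w := \sum_(m < n) cost m w.

Let gainsum_L1 n : L1 P (gainsum n).
Proof. by apply: L1_sum => m _; exact: (chain_gain_L1 hT FF gf ch). Qed.

Let costsum_L1 n : L1 P (costsum n).
Proof. by apply: L1_sum => m _; exact: (chain_cost_L1 hT FF gl ch). Qed.

Let FT : stopped_sigma T F (tau 0) setT.
Proof. by move=> t tT; rewrite setTI; exact: (st 0).2. Qed.

Let sum_ExB n : \sum_(m < n) (Ex setT (gain m) - Ex setT (cost m)) =
  Ex setT (gainsum n) - Ex setT (costsum n).
Proof.
rewrite sumrB !Ex_sum//.
  by move=> m _; exact: (chain_cost_L1 hT FF gl ch).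
by move=> m _; exact: (chain_gain_L1 hT FF gf ch).
Qed.

(** Costs are nonnegative, so keeping only the first n of them and adding the slack majorises the
    profit by an integrable variable. [chain_verif] bounds its mean, and the slack and the remaining
    value tend to 0. *)
Lemma total_profit_le Y : value_system Y ->
  (total_profit P T X psi l tau xi <= (Ex setT (value Y 0))%:E)%E.
Proof.
move=> VY.
have maj n : (total_profit P T X psi l tau xi <=
    (Ex setT (fun w => gainsum n w + slack n w - costsum n w))%:E)%E.
  have L1m : L1 P (fun w => gainsum n w + slack n w - costsum n w).
    by apply: L1B => //; exact: L1D.
  rewrite -Ex_EFin//; apply: ae_le_integral_nomeas.
  apply: filterS2 chain_cost_ae controlled_total => w hc hg.
  rewrite EFinB; apply: leeB.
    rewrite lee_fin -lerBlDl; apply: le_trans (ler_norm _) _.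
    exact: (hg (K w) n (fK w)).
  rewrite /costsum -sumEFin -(big_mkord xpredT (fun m => (cost m w)%:E)).
  rewrite (@eq_eseriesr _ _ (fun m => (cost m w)%:E)); last first.
    by move=> m _; rewrite (hc m).2.
  by apply: nneseries_lim_ge => m _ _; rewrite lee_fin (hc m).1.
have cv : Ex setT (value Y 0) - Ex setT (value Y n) + Ex setT (slack n) @[n --> \oo]
    --> Ex setT (value Y 0).
  rewrite -[X in _ --> X]addr0; apply: cvgD => //.
  rewrite -[X in _ --> X]subr0; apply: cvgB; first exact: cvg_cst.
  exact: (chain_value_cvg0 hq hT FF gf gl ch VY rT measurableT).
have maj2 n : (total_profit P T X psi l tau xi <=
    (Ex setT (value Y 0) - Ex setT (value Y n) + Ex setT (slack n))%:E)%E.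
  apply: le_trans (maj n) _; rewrite lee_fin.
  rewrite ExB//; last exact: L1D.
  rewrite ExD//.
  have := chain_verif hq hT FF gf al gl ch VY n FT.
  rewrite sum_ExB; lra.
(* The profit may be -oo, so the limit is taken only once it is known to be real. *)
case: (total_profit _ _ _ _ _ _ _) maj2 => [r||] h.
- rewrite lee_fin; apply: ler_cvg_to (cvg_cst r) cv _; apply: nearW => n.
  by have := h n; rewrite lee_fin.
- by have := h 0%N.
- exact: leNye.
Qed.

(** Here the whole series of costs must be subtracted. The verification equality shows that it is
    integrable and bounds its mean from above. *)
Lemma total_profit_optimal Y : value_system Y -> chain_optimal P T l tau xi Y ->
  ((Ex setT (value Y 0))%:E <= total_profit P T X psi l tau xi)%E.
Proof.
move=> VY opt.
(* Costs are nonnegative only almost surely; their positive parts are so everywhere, so that sum and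
   integral can be exchanged. *)
pose cost0 n w := Num.max 0 (cost n w).
have L1c n : L1 P (cost n) by exact: (chain_cost_L1 hT FF gl ch).
have L1c0 n : L1 P (cost0 n).
  apply: (L1_le _ (L1_norm (L1c n))).
    by apply: measurable_maxr; [exact: measurable_cst|exact: L1_measurable (L1c n)].
  by move=> w; rewrite /cost0 /Num.max; case: ltP => // _; rewrite normr0.
have cost0_ge0 n w : 0 <= cost0 n w by rewrite /cost0 le_max lexx.
have Ecost0 n : Ex setT (cost0 n) = Ex setT (cost n).
  apply: eq_Ex_ae => //; apply: filterS chain_cost_ae => w hc _.
  by rewrite /cost0 max_r//; exact: (hc n).1.
pose C w := (\sum_(0 <= n <oo) (cost0 n w)%:E)%E.
have mc0 n : measurable_fun setT (fun w => (cost0 n w)%:E).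
  by apply/measurable_EFinP; exact: L1_measurable (L1c0 n).
have C_ge0 w : (0 <= C w)%E by apply: nneseries_ge0 => n _ _; rewrite lee_fin.
have intCE : (\int[P]_w C w = \sum_(0 <= n <oo) (Ex setT (cost0 n))%:E)%E.
  rewrite /C integral_nneseries//.
    by apply: eq_eseriesr => n _; rewrite Ex_EFin.
  by move=> n w _; rewrite lee_fin.
have EY0 := chain_value_cvg0 hq hT FF gf gl ch VY rT measurableT.
(* For large m, the first m costs have mean E[gains up to m] + E[value m] - E[value 0], where the
   value at m is below e and the gains after n are at most the slack at n. *)
have intC_le n e : 0 < e -> (\int[P]_w C w <=
    (Ex setT (gainsum n) + Ex setT (slack n) + e - Ex setT (value Y 0))%:E)%E.
  move=> e0; rewrite intCE; apply: lime_le.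
    by apply: is_cvg_nneseries => m _ _; rewrite lee_fin; apply: Rintegral_ge0 => w _; exact: cost0_ge0.
  have /cvgrPdist_lt/(_ _ e0) := EY0.
  move=> [N _ hN]; exists (maxn n N) => // m /=; rewrite geq_max => /andP[nm Nm].
  rewrite sumEFin lee_fin big_mkord.
  rewrite (eq_bigr (fun i => Ex setT (cost (nat_of_ord i)))); last by move=> i _; exact: Ecost0.
  rewrite -Ex_sum//.
  have := chain_verif_optimal hq hT FF gf al gl ch VY m opt FT.
  rewrite sum_ExB => hv.
  have hg : Ex setT (gainsum m) <= Ex setT (gainsum n) + Ex setT (slack n).
    rewrite -ExD//; apply: le_Ex_ae => //; first exact: L1D.
    apply: aeW => w _; rewrite -lerBlDl.
    rewrite /gainsum -!(big_mkord xpredT (fun m => gain m w)).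
    rewrite (big_cat_nat (n := n) (p := m))//= [_ + _ - _]addrAC subrr add0r.
    apply: le_trans (ler_norm _) _.
    apply: le_trans (chain_gain_sum_le hT gf ch nm (fK w)) _.
    by apply: ler_wpM2l => //; rewrite lerD2r; case/andP : (tauT m w).
  have := hN m Nm; rewrite /= sub0r normrN => /(le_lt_trans (ler_norm _)) hy.
  have : Ex setT (fun w => \sum_(i < m) cost i w) = Ex setT (costsum m) by [].
  move: hv hg hy; lra.
have intC : P.-integrable setT C.
  apply/integrableP; split.
    by apply: ge0_emeasurable_sum => // n w _ _; rewrite lee_fin.
  rewrite (eq_integral C); last by move=> w _; rewrite gee0_abs.
  by apply: le_lt_trans (intC_le 0%N 1 ltr01) _; exact: ltry.
have minor n : ((Ex setT (fun w => gainsum n w - slack n w))%:E - \int[P]_w C w <=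
    total_profit P T X psi l tau xi)%E.
  have L1m : L1 P (fun w => gainsum n w - slack n w) by exact: L1B.
  rewrite -Ex_EFin// -integralB//; apply: ae_le_integral_nomeas.
  apply: filterS2 chain_cost_ae controlled_total => w hc hg /=.
  apply: leeB.
    rewrite lee_fin; have := hg (K w) n (fK w).
    by rewrite ler_norml => /andP[+ _]; rewrite /slack /gainsum /controlled_payoff /payoff; lra.
  rewrite (@eq_eseriesr _ _ (fun m => (cost0 m w)%:E))// => m _.
  by rewrite (hc m).2 /cost0 max_r//; exact: (hc m).1.
have fC : (\int[P]_w C w)%E \is a fin_num by exact: integrable_fin_num.
(* The slack is lost twice, in the gains and in the bound on the costs; the last third is the error
   in [intC_le]. *)
apply/lee_addgt0Pr => e e0; have e3 : 0 < e / 3 by rewrite divr_gt0.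
have /cvgrPdist_lt/(_ _ e3)[n _ hn] := slack_cvg0.
have := hn n (leqnn n); rewrite /= sub0r normrN => /(le_lt_trans (ler_norm _)) hs.
have := minor n; have := intC_le n (e / 3) e3.
rewrite -(fineK fC) -EFinB lee_fin ExB// => hC hm.
apply: le_trans (leeD hm (lexx _)); rewrite -EFinD lee_fin.
by move: hC hs; lra.
Qed.

End bounds.
End profit.

(** * Optimal strategies *)

Section optimal_chain.
Context {R : realType} {disp : measure_display} {Omega : measurableType disp}.
Variables (P : probability Omega R) (T : R) (F : R -> set (set Omega)) (q : nat).
Hypotheses (hq : (2 <= q)%N) (FF : is_filtration T F).
Variables (l : 'I_q -> 'I_q -> R -> Omega -> R) (Y : 'I_q -> R -> Omega -> R).
Hypothesis al : forall i j : 'I_q, i != j -> adapted T F (l i j).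
Hypothesis aY : forall i, adapted T F (Y i).
Local Notation S i := (switch_max l Y i).
Let aS i : adapted T F (S i).
Proof. by apply: (switch_max_adapted hq) => // j; exact: al. Qed.

Definition next_hit (tau : Omega -> R) (xi : Omega -> 'I_q) w :=
  hit T (Y (xi w)) (S (xi w)) (tau w) w.

(** Taking the first maximiser in a fixed enumeration keeps the choice measurable; one exists by
    [switch_max_attained]. *)
Definition next_mode (tau : Omega -> R) (xi : Omega -> 'I_q) w :=
  odflt (other_mode hq (xi w)) [pick j | (j != xi w) &&
    (S (xi w) (tau w) w == - l (xi w) j (tau w) w + Y j (tau w) w)].

Lemma next_modeP tau xi w : next_mode tau xi w != xi w /\
  S (xi w) (tau w) w = - l (xi w) (next_mode tau xi w) (tau w) w
                       + Y (next_mode tau xi w) (tau w) w.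
Proof.
rewrite /next_mode; case: pickP => [j /andP[ji /eqP e]//|no].
have [j [ji e]] := switch_max_attained hq l Y (xi w) (tau w) w.
by have := no j; rewrite ji/= e eqxx.
Qed.

(** On the event xi = i this is the hitting time for mode i, and that event, known at tau, is known
    at the later hitting time as well. *)
Lemma next_hit_stopping tau xi : stopping_time T F tau ->
  (forall A, stopped_sigma T F tau (xi @^-1` A)) ->
  stopping_time T F (next_hit tau xi).
Proof.
move=> st mxi.
have sth i : stopping_time T F (fun w => hit T (Y i) (S i) (tau w) w).
  exact: (hit_stopping FF).
split=> [w|t tT]; first exact: (sth (xi w)).1.
have -> : [set w | next_hit tau xi w <= t] = \bigcup_(i in [set: 'I_q])
    (xi @^-1` [set i] `&` [set w | hit T (Y i) (S i) (tau w) w <= t]).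
  apply/seteqP; split=> [w h|w [i _ [/= <- //]]].
  by exists (xi w).
rewrite (F_measurableE FF); apply: fin_bigcup_measurable => //= i _.
rewrite -(F_measurableE FF).
have : stopped_sigma T F (fun w => hit T (Y i) (S i) (tau w) w) (xi @^-1` [set i]).
  apply: (stopped_mono FF (sth i) _ (mxi _)) => w.
  by have /andP[_ h] := st.1 w; case/andP: (hit_itv (Y i) (S i) w h).
exact.
Qed.

(** The new mode is a function of the old one and of a finite Boolean table recording which j attain
    the maximum for which i; each entry of the table is known at tau by [stopped_set0]. *)
Lemma next_mode_stopped tau xi : stopping_time T F tau ->
  (forall A, stopped_sigma T F tau (xi @^-1` A)) ->
  forall A, stopped_sigma T F tau (next_mode tau xi @^-1` A).
Proof.
move=> st mxi A; rewrite (stopped_measurableE FF st).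
pose OmegaS := g_sigma_algebraType (stopped_sigma T F tau).
pose b (w : Omega) : {ffun 'I_q * 'I_q -> bool} := [ffun ij : 'I_q * 'I_q =>
  (ij.2 != ij.1) && (S ij.1 (tau w) w == - l ij.1 ij.2 (tau w) w + Y ij.2 (tau w) w)].
pose phi (z : 'I_q * {ffun 'I_q * 'I_q -> bool}) :=
  odflt (other_mode hq z.1) [pick j | z.2 (z.1, j)].
have -> : next_mode tau xi @^-1` A = (fun w => (xi w, b w)) @^-1` (phi @^-1` A).
  have e w : next_mode tau xi w = phi (xi w, b w).
    by rewrite /next_mode /phi/=; congr (odflt _ _); apply: eq_pick => j; rewrite ffunE.
  by apply/seteqP; split=> w /=; rewrite e.
have mb : forall B, measurable (b @^-1` B : set OmegaS).
  apply: (@measurable_ffun_preimage _ OmegaS).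
  move=> [i j] c.
  (* Diagonal entries are constantly false, so that nothing is asked of l i i. *)
  have [ij|ij] := eqVneq i j.
    have -> : [set w | b w (i, j) = c] = if c then set0 else setT.
      apply/seteqP; split=> w /=; rewrite ffunE/= ij eqxx/=; case: c => //.
    by case: (c); [exact: measurable0|exact: measurableT].
  pose N t w := S i t w - (- l i j t w + Y j t w).
  have aN : adapted T F N.
    apply: (adaptedD) => //; apply: (adaptedN); apply: (adaptedD) => //.
    by apply: (adaptedN); exact: al.
  have mN : measurable ([set w | N (tau w) w = 0] : set OmegaS).
    by rewrite -(stopped_measurableE FF st); exact: (stopped_set0 FF).
  have -> : [set w | b w (i, j) = c] = if c then [set w | N (tau w) w = 0]
      else ~` [set w | N (tau w) w = 0].
    apply/seteqP; split=> w /=; rewrite ffunE/= eq_sym ij/= -subr_eq0;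
      case: c => /=; by [move=> /eqP|move=> ->; rewrite eqxx|
        move=> /eqP|move=> h; apply/eqP].
  by case: (c) => //; exact: measurableC.
apply: (@measurable_fin_preimage _ OmegaS) => -[i beta].
have -> : (fun w => (xi w, b w)) @^-1` [set (i, beta)] =
   xi @^-1` [set i] `&` b @^-1` [set beta].
  by apply/seteqP; split=> [w /= [<- <-]|w /= [-> ->]].
apply: measurableI; last exact: mb.
by rewrite -(stopped_measurableE FF st).
Qed.

Fixpoint greedy (t0 : R) (i0 : 'I_q) (n : nat) : (Omega -> R) * (Omega -> 'I_q) :=
  if n is m.+1 then
    let: (tau, xi) := greedy t0 i0 m in
    (next_hit tau xi, next_mode (next_hit tau xi) xi)
  else (cst t0, cst i0).

Let greedyE t0 i0 n : greedy t0 i0 n.+1 =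
  (next_hit (greedy t0 i0 n).1 (greedy t0 i0 n).2,
   next_mode (next_hit (greedy t0 i0 n).1 (greedy t0 i0 n).2) (greedy t0 i0 n).2).
Proof. by rewrite /=; case: (greedy t0 i0 n). Qed.

Lemma stopped_cst_fun t (i : 'I_q) A : 0 <= t <= T ->
  stopped_sigma T F (cst t) ((cst i : Omega -> 'I_q) @^-1` A).
Proof.
move=> /andP[t0 tT]; apply: (stopped_cst FF) => //.
rewrite preimage_cst; case: ifP => _; [exact: (F_T FF)|exact: (F_0 FF)].
Qed.

Let next_hit_ge tau xi w : stopping_time T F tau -> tau w <= next_hit tau xi w.
Proof. by move=> st; have /andP[_ h] := st.1 w; case/andP: (hit_itv (Y (xi w)) (S (xi w)) w h). Qed.

Let greedy_stopped t0 i0 n : 0 <= t0 <= T -> stopping_time T F (greedy t0 i0 n).1 /\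
  forall A, stopped_sigma T F (greedy t0 i0 n).1 ((greedy t0 i0 n).2 @^-1` A).
Proof.
move=> t0T; elim: n => [|n [IH1 IH2]].
  by split; [exact: (stopping_cst FF)|move=> A; exact: stopped_cst_fun].
rewrite greedyE/=; have st := next_hit_stopping IH1 IH2.
split=> // A; apply: next_mode_stopped => // B.
by apply: (stopped_mono FF st _ (IH2 B)) => w; exact: next_hit_ge.
Qed.

Lemma optimal_chain_exists t0 i0 : 0 <= t0 <= T -> exists tau xi,
  [/\ tau 0%N = cst t0, xi 0%N = cst i0, chain P T F tau xi &
      chain_optimal P T l tau xi Y].
Proof.
move=> t0T; pose g := greedy t0 i0.
exists (fun n => (g n).1), (fun n => (g n).2); split=> //.
- split.
  + by move=> n; exact: (greedy_stopped i0 n t0T).1.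
  + by move=> n w; rewrite /g greedyE/=; apply: next_hit_ge; exact: (greedy_stopped i0 n t0T).1.
  + by move=> n; exact: (greedy_stopped i0 n t0T).2.
  + by apply: aeW => w n; rewrite /g greedyE/= eq_sym; exact: (next_modeP _ _ _).1.
- split; first by move=> n w; rewrite /g greedyE.
  by apply: aeW => w n; rewrite /g greedyE/=; exact: (next_modeP _ _ _).2.
Qed.

End optimal_chain.

(** * The Brownian filtration and its triviality at time 0 *)

Section brownian_filtration.
Context {R : realType} {disp : measure_display} {Omega : measurableType disp}.
Variables (P : probability Omega R) (T : R) (d : nat).
Variable B : R -> Omega -> 'rV[R]_d.
Hypothesis hB : brownian_motion P T B.
Local Notation F := (completed_filtration P B).

Let sigma_measurable : sigma_algebra setT (@measurable _ Omega).
Proof.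
split; first exact: measurable0.
  by move=> A mA; rewrite setTD; exact: measurableC.
by move=> A mA; exact: bigcupT_measurable.
Qed.

Lemma completed_filtrationP : is_filtration T F.
Proof.
have [mB _ _ _ _] := hB; split.
- by move=> t; exact: smallest_sigma_algebra.
- move=> t /andP[t0 tT]; apply: smallest_sub => // A [|[]//].
  move: A; apply: smallest_sub => // A [s /=]; rewrite in_itv/= => /andP[s0 st] [j _].
  move=> [U mU <-]; apply: mB => //.
  by rewrite s0 (le_trans st tT).
- move=> s t s0 st tT; apply: sub_smallest2r; first exact: smallest_sigma_algebra.
  apply: setSU; apply: sub_smallest2r; first exact: smallest_sigma_algebra.
  by apply: bigcup_subset; apply: subset_itv; rewrite bnd_simp.
Qed.

(** The almost sure or almost impossible events form a sigma-algebra. It contains the null sets, and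
    the events generated by B_0 because B_0 = 0 almost surely. *)
Lemma completed_filtration0_trivial A : F 0 A ->
  {ae P, forall w, A w} \/ {ae P, forall w, ~ A w}.
Proof.
have [_ B0 _ _ _] := hB.
pose G := [set A | {ae P, forall w, A w} \/ {ae P, forall w, ~ A w}].
suff : F 0 `<=` G by exact.
have sG : sigma_algebra setT G.
  split; first by right; apply: aeW => w [].
    move=> C [h|h]; [right|left]; apply: filterS h => w Cw; rewrite setTD//=.
  move=> C hC.
  have [[n hn]|no] := pselect (exists n, {ae P, forall w, C n w}).
    by left; apply: filterS hn => w Cw; exists n.
  right; have : {ae P, forall w, forall n, ~ C n w}.
    by apply: ae_foralln => n; case: (hC n) => // h; case: no; exists n.
  by apply: filterS => w h [n _]; exact: h.
apply: smallest_sub => // C [|[mC C0]].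
  move: C; apply: smallest_sub => // C [s /=]; rewrite in_itv/= => s0 [j _].
  have {s0} -> : s = 0 by apply/eqP; rewrite eq_le andbC.
  move=> [U mU <-]; have [U0|U0] := pselect (U 0).
    by left; apply: filterS B0 => w B0w; rewrite /setI/= B0w mxE.
  by right; apply: filterS B0 => w B0w; rewrite /setI/= B0w mxE => -[].
by right; exists C; split=> // w /= h; apply: contrapT => h'; exact: h.
Qed.

(** Triviality of the event c < f puts f almost surely on one side of its mean c, and equality of
    the means forces f = c. *)
Lemma completed_filtration0_cst (f : Omega -> R) : L1 P f ->
  measurable_fun setT (f : g_sigma_algebraType (F 0) -> R) ->
  {ae P, forall w, f w = Rintegral P setT f}.
Proof.
move=> f1 mf; set c := Rintegral P setT f.
have Ec : Rintegral P setT (cst c) = c.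
  by rewrite Rintegral_cst// [X in fine X](@probability_setT _ _ _ P) mulr1.
have c1 : L1 P (cst c) by exact: L1_cst.
have F0 : F 0 [set w | c < f w].
  rewrite (F_measurableE completed_filtrationP).
  by apply: measurable_setlt => //; exact: measurable_cst.
case: (completed_filtration0_trivial F0) => h.
  have : {ae P, forall w, cst c w = f w}.
    by apply: ae_eq_of_Ex => //; [apply: filterS h => w /ltW|rewrite Ec].
  by apply: filterS => w /= ->.
apply: ae_eq_of_Ex => //; last by rewrite Ec.
by apply: filterS h => w /= /negP; rewrite -leNgt.
Qed.

End brownian_filtration.

Section strategies.
Context {R : realType} {disp : measure_display} {Omega : measurableType disp}.
Variables (P : probability Omega R) (T : R) (F : R -> set (set Omega)) (q : nat).
Hypotheses (hq : (2 <= q)%N) (hT : 0 < T) (FF : is_filtration T F).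
Implicit Types (tau : nat -> Omega -> R) (xi : nat -> Omega -> 'I_q).
Let hT0 : 0 <= T := ltW hT.

Lemma measurable_eq_mode (x y : Omega -> 'I_q) :
  (forall A, measurable (x @^-1` A)) -> (forall A, measurable (y @^-1` A)) ->
  measurable [set w | x w = y w].
Proof.
move=> mx my; have -> : [set w | x w = y w] =
    \bigcup_(i in [set: 'I_q]) (x @^-1` [set i] `&` y @^-1` [set i]).
  by apply/seteqP; split=> [w /= h|w [i _ [/= -> ->]]//]; exists (x w).
by apply: fin_bigcup_measurable => //= i _; exact: measurableI.
Qed.

Lemma ae_neq_mode (x y : Omega -> 'I_q) :
  (forall A, measurable (x @^-1` A)) -> (forall A, measurable (y @^-1` A)) ->
  P [set w | x w = y w] = 0%E <-> {ae P, forall w, x w != y w}.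
Proof.
move=> mx my; have mE := measurable_eq_mode mx my.
rewrite -(negligibleP _ mE); split.
  by apply: negligibleS => w /= /negP; rewrite negbK => /eqP.
by apply: negligibleS => w /= ->; rewrite eqxx.
Qed.

Let initial_stopped A : stopped_sigma T F (cst 0) ((cst (mode1 hq) : Omega -> 'I_q) @^-1` A).
Proof. by apply: stopped_cst_fun => //; rewrite lexx. Qed.

Lemma strategy_chain tau xi : strategy P T F hq tau xi ->
  [/\ tau 0%N = cst 0, xi 0%N = cst (mode1 hq) & chain P T F tau xi].
Proof.
move=> [init st le mode neq].
have tau0 : tau 0%N = cst 0 by apply/funext => w; case: (init w).
have xi0 : xi 0%N = cst (mode1 hq) by apply/funext => w; case: (init w).
have st' n : stopping_time T F (tau n).
  by case: n => [|n]; [rewrite tau0; apply: (stopping_cst FF); rewrite lexx|exact: st].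
have mode' n A : stopped_sigma T F (tau n) (xi n @^-1` A).
  by case: n => [|n]; [rewrite tau0 xi0|exact: mode].
split=> //; split=> //; apply: ae_foralln => n.
by apply/ae_neq_mode => // A; exact: (stopped_measurable hT0 FF (st' _) (mode' _ _)).
Qed.

Lemma chain_finite_strategy tau xi : tau 0%N = cst 0 ->
  xi 0%N = cst (mode1 hq) -> chain P T F tau xi -> reaches_T P T tau ->
  finite_strategy P T F hq tau xi.
Proof.
move=> tau0 xi0 ch rT; split.
- split.
  + by rewrite tau0 xi0.
  + by move=> n _; exact: (chain_stopping ch).
  + exact: (chain_le ch).
  + by move=> n _; exact: (chain_mode ch).
  + move=> n; apply/ae_neq_mode; try exact: (chain_mode_measurable hT FF ch).
    by apply: filterS (chain_neq ch) => w.
- apply: filterS rT => w [n tn]; apply: cvg_near_cst; exists n => // m /= nm.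
  exact: (tau_stay_T ch tn nm).
- exact/(reaches_T_null hT FF ch).
Qed.

Lemma finite_strategy_reaches_T tau xi : finite_strategy P T F hq tau xi ->
  reaches_T P T tau.
Proof.
move=> [/strategy_chain[_ _ ch] _ h]; exact/(reaches_T_null hT FF ch).
Qed.

(** [recursive_strategy] does not postulate that the tau_n are stopping times: this is recovered by
    induction together with the measurability of the modes. *)
Lemma recursive_strategy_chain l Y tau xi :
  (forall i j : 'I_q, i != j -> adapted T F (l i j)) ->
  (forall i, adapted T F (Y i)) -> recursive_strategy P T F l Y hq tau xi ->
  [/\ tau 0%N = cst 0, xi 0%N = cst (mode1 hq), chain P T F tau xi &
      chain_optimal P T l tau xi Y].
Proof.
move=> al aY [init_tau init_xi step].
have tau0 : tau 0%N = cst 0 by apply/funext.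
have xi0 : xi 0%N = cst (mode1 hq) by apply/funext.
have tauE n w : tau n.+1 w = next_hit T l Y (tau n) (xi n) w by case: (step n).
have st n : stopping_time T F (tau n) /\
    forall A, stopped_sigma T F (tau n) (xi n @^-1` A).
  elim: n => [|n [IH1 IH2]].
    rewrite tau0 xi0; split=> //.
    by apply: (stopping_cst FF); rewrite lexx.
  split; last by case: (step n).
  have -> : tau n.+1 = next_hit T l Y (tau n) (xi n) by apply/funext.
  exact: (next_hit_stopping hq FF).
split=> //; split.
- by move=> n; exact: (st n).1.
- move=> n w; rewrite tauE; have /andP[_ h] := (st n).1.1 w.
  by case/andP: (hit_itv (Y (xi n w)) (switch_max l Y (xi n w)) w h).
- by move=> n; exact: (st n).2.
- apply: ae_foralln => n; case: (step n) => _ _.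
  by apply: filterS => w [+ _]; rewrite eq_sym.
- by move=> n w; exact: tauE.
- by apply: ae_foralln => n; case: (step n) => _ _; apply: filterS => w [].
Qed.

End strategies.

(** * Uniqueness and optimality *)

Section comparison.
Context {R : realType} {disp : measure_display} {Omega : measurableType disp}.
Variables (P : probability Omega R) (T : R) (F : R -> set (set Omega)) (q k : nat).
Hypotheses (hq : (2 <= q)%N) (hT : 0 < T) (FF : is_filtration T F).
Variables (X : R -> Omega -> 'rV[R]_k) (psi : 'I_q -> R -> 'rV[R]_k -> R).
Variables (l : 'I_q -> 'I_q -> R -> Omega -> R).
Hypothesis gf : forall i, good P T (payoff X psi i).
Hypothesis al : forall i j : 'I_q, i != j -> adapted T F (l i j).
Hypothesis gl : forall i j : 'I_q, i != j -> good P T (l i j).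
Variable gamma : R.
Hypothesis gamma0 : 0 < gamma.
Hypothesis l_gamma : {ae P, forall w, forall t, 0 <= t <= T ->
    forall i j : 'I_q, i != j -> gamma <= l i j t w}.
Let hT0 : 0 <= T := ltW hT.
Local Notation value_system := (value_system P T F X psi l).

(** A chain that is optimal for Y and starts from mode i at time t compares the means of Y and Y'
    over any event of F_t; the event Y' < Y is the one to test. *)
Lemma value_le_at Y Y' i t : value_system Y -> value_system Y' -> 0 <= t <= T ->
  {ae P, forall w, Y i t w <= Y' i t w}.
Proof.
move=> VY VY' tT; have [aY gY _] := VY; have [aY' gY' _] := VY'.
have [tau [xi [tau0 xi0 ch opt]]] := optimal_chain_exists P hq FF al aY i tT.
have rT := optimal_reaches_T hq hT FF gf al gl ch gamma0 l_gamma VY opt.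
have FA : F t [set w | Y' i t w < Y i t w].
  rewrite (F_measurableE FF).
  by apply: measurable_setlt; [exact: (aY' i).2|exact: (aY i).2].
have SA : stopped_sigma T F (tau 0%N) [set w | Y' i t w < Y i t w].
  by rewrite tau0; apply: (stopped_cst FF FA); case/andP : tT.
have := chain_value_compare hq hT FF gf al gl ch VY VY' opt rT SA.
rewrite /chain_value tau0 xi0 => h.
by apply: ae_le_of_Ex => //; exact: (good_L1 hT0 _ tT).
Qed.

Lemma value_le Y Y' : value_system Y -> value_system Y' ->
  {ae P, forall w, forall i t, 0 <= t <= T -> Y i t w <= Y' i t w}.
Proof.
move=> VY VY'; have [_ gY _] := VY; have [_ gY' _] := VY'.
apply: filter_forall => i.
have : {ae P, forall w, forall n,
    Y i (clip 0 T (rat_enum n)) w <= Y' i (clip 0 T (rat_enum n)) w}.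
  by apply: ae_foralln => n; apply: value_le_at => //; exact: clipT.
apply: filterS => w h t tT.
exact: (le_cpath (good_cpath (gY i)) (good_cpath (gY' i)) h tT).
Qed.

End comparison.

Theorem theorem1
  (R : realType) (disp : measure_display) (Omega : measurableType disp)
  (P : probability Omega R)
  (T : R) (hT : 0 < T) (p : R) (hp : 1 < p)
  (d k q : nat) (hd : (1 <= d)%N) (hk : (1 <= k)%N) (hq : (2 <= q)%N)
  (B : R -> Omega -> 'rV[R]_d) (hB : brownian_motion P T B)
  (F : R -> set (set Omega)) (hF : F = completed_filtration P B)
  (X : R -> Omega -> 'rV[R]_k)
  (hX : forall j : 'I_k, Sp_process P T F p (fun t w => X t w ord0 j))
  (psi : 'I_q -> R -> 'rV[R]_k -> R)
  (hpsi_cont : forall i : 'I_q,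
    {within `[0, T] `*` [set: 'rV[R]_k],
      continuous (fun z : R * 'rV[R]_k => psi i z.1 z.2)})
  (hpsi_growth : forall i : 'I_q, exists C : R,
    forall t (x : 'rV[R]_k), 0 <= t <= T -> `|psi i t x| <= C * (1 + `|x|))
  (l : 'I_q -> 'I_q -> R -> Omega -> R)
  (hl : forall i j : 'I_q, i != j -> Sp_process P T F p (l i j))
  (gamma : R) (hgamma : 0 < gamma)
  (hl_gamma : {ae P, forall w, forall t, 0 <= t <= T ->
    forall i j : 'I_q, i != j -> gamma <= l i j t w})
  (Y : 'I_q -> R -> Omega -> R)
  (hY : forall i, Sp_process P T F p (Y i))
  (hYsys : snell_system P T F X psi l Y) :
  [/\
    (* uniqueness, up to indistinguishability *)
    forall Y' : 'I_q -> R -> Omega -> R,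
      (forall i, Sp_process P T F p (Y' i)) ->
      snell_system P T F X psi l Y' ->
      {ae P, forall w, forall i t, 0 <= t <= T -> Y' i t w = Y i t w},
    (* (i) *)
    {ae P, forall w, (Y (mode1 hq) 0 w)%:E =
      ereal_sup [set J | exists theta v,
        finite_strategy P T F hq theta v /\
        J = total_profit P T X psi l theta v]}
  & (* (ii) *)
    forall (tau : nat -> Omega -> R) (xi : nat -> Omega -> 'I_q),
      recursive_strategy P T F l Y hq tau xi ->
      finite_strategy P T F hq tau xi /\
      forall theta v, finite_strategy P T F hq theta v ->
        (total_profit P T X psi l theta v <= total_profit P T X psi l tau xi)%E].
Proof.
have FF : is_filtration T F by rewrite hF; exact: completed_filtrationP hB.
have hT0 : 0 <= T by exact: ltW.
have gX j : good P T (fun t w => X t w ord0 j) by exact: (Sp_good hT0 FF hp (hX j)).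
have gf i : good P T (payoff X psi i) by exact: payoff_good.
have al (i j : 'I_q) : i != j -> adapted T F (l i j).
  by move=> ij; exact: (Sp_adapted hT0 (hl _ _ ij)).
have gl (i j : 'I_q) : i != j -> good P T (l i j).
  by move=> ij; exact: (Sp_good hT0 FF hp (hl _ _ ij)).
have system Y' : (forall i, Sp_process P T F p (Y' i)) ->
    snell_system P T F X psi l Y' -> value_system P T F X psi l Y'.
  move=> hY' hsys; split=> // i; first exact: (Sp_adapted hT0 (hY' i)).
  exact: (Sp_good hT0 FF hp (hY' i)).
have VY := system Y hY hYsys; have [aY gY _] := VY.
have [K [L1K fK]] := family_bound gf.
have T0 : 0 <= (0 : R) <= T by apply/andP; split.
pose V := Rintegral P setT (Y (mode1 hq) 0).
have upper theta v : finite_strategy P T F hq theta v ->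
    (total_profit P T X psi l theta v <= V%:E)%E.
  move=> fin; have rT := finite_strategy_reaches_T hT FF fin.
  case: fin => /(strategy_chain hT FF)[theta0 v0 ch] _ _.
  have theta0' w : theta 0%N w = 0 by rewrite theta0.
  have := total_profit_le hq hT FF gf al gl ch theta0' rT hgamma hl_gamma L1K fK VY.
  by rewrite /chain_value theta0 v0.
have optimal tau xi : tau 0%N = cst 0 -> xi 0%N = cst (mode1 hq) ->
    chain P T F tau xi -> chain_optimal P T l tau xi Y ->
    finite_strategy P T F hq tau xi /\ (V%:E <= total_profit P T X psi l tau xi)%E.
  move=> tau0 xi0 ch opt.
  have rT := optimal_reaches_T hq hT FF gf al gl ch hgamma hl_gamma VY opt.
  split; first exact: (chain_finite_strategy hT FF).
  have tau0' w : tau 0%N w = 0 by rewrite tau0.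
  have := total_profit_optimal hq hT FF gf al gl ch tau0' rT hgamma hl_gamma L1K fK VY opt.
  by rewrite /chain_value tau0 xi0.
split.
- move=> Y' hY' hsys; have VY' := system Y' hY' hsys.
  have h1 := value_le hq hT FF gf al gl hgamma hl_gamma VY VY'.
  have h2 := value_le hq hT FF gf al gl hgamma hl_gamma VY' VY.
  apply: filterS2 h1 h2 => w h1 h2 i t tT.
  by apply/eqP; rewrite eq_le h1// h2.
- have [tau [xi [tau0 xi0 ch opt]]] := optimal_chain_exists P hq FF al aY (mode1 hq) T0.
  have [fin ge] := optimal tau xi tau0 xi0 ch opt.
  have supE : ereal_sup [set J | exists theta v,
        finite_strategy P T F hq theta v /\
        J = total_profit P T X psi l theta v] = V%:E.
    apply/eqP; rewrite eq_le; apply/andP; split.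
      by apply: ge_ereal_sup => _ [theta [v [h ->]]]; exact: upper.
    apply: le_trans ge _; apply: ereal_sup_ubound.
    by exists tau, xi.
  rewrite supE.
  have := @completed_filtration0_cst _ _ _ P T d B hB (Y (mode1 hq) 0) (good_L1 hT0 (gY _) T0).
  rewrite -hF => /(_ ((aY (mode1 hq)).2 0 T0)).
  by apply: filterS => w ->.
- move=> tau xi rec.
  have [tau0 xi0 ch opt] := recursive_strategy_chain hT FF al aY rec.
  have [fin ge] := optimal tau xi tau0 xi0 ch opt.
  by split=> // theta v h; apply: le_trans ge; exact: upper.
Qed.
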